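(* Let $\mathbb{G}$ be a stratified Lie group of homogeneous dimension $Q$, and let $\Omega\subset\mathbb{G}$ be a bounded open set. Let $s\in(0,1)$, $\frac{Q}{s}>p\ge 2$, $p_s^*=\frac{pQ}{Q-ps}$ and $q\in[1,p_s^* )$. Let $h:\Omega\times\mathbb{R}\to\mathbb{R}$ be a Carathéodory function (Haar measurable in the first variable, continuous in the second) such that $$|h(x,t)|\le a_1+a_2|t|^{q-1}\quad\text{for a.e. } x\in\Omega \text{ and all } t\in\mathbb{R},$$ for some $a_1,a_2>0$. Then for every $\mu>0$ there exists $\Lambda_\mu>0$ such that, for every $0<\lambda<\Lambda_\mu$, the problem $$(-\Delta_{\mathbb{G},p})^s u=\mu|u|^{p_s^*-2}u+\lambda h(x,u)\ \text{ in }\Omega,\qquad u=0\ \text{ in }\mathbb{G}\setminus\Omega,$$ admits at least one (real-valued) weak solution $u_\lambda\in X_0^{s,p}(\Omega)$ which is a local minimum of the energy functional $\mathfrak{I}_{\mu,\lambda}:X_0^{s,p}(\Omega)\to\mathbb{R}$, $$\mathfrak{I}_{\mu,\lambda}(u)=\frac1p\iint_{\mathbb{G}\times\mathbb{G}}\frac{|u(x)-u(y)|^p}{|y^{-1}x|^{Q+sp}}\,dx\,dy-\frac{\mu}{p_s^*}\int_\Omega|u(x)|^{p_s^*}dx-\lambda\int_\Omega\int_0^{u(x)}h(x,\tau)\,d\tau\,dx .$$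
   Context: Stratified Lie group: $\mathbb{G}=(\mathbb{R}^N,\circ,D_\lambda)$, a Lie group on $\mathbb{R}^N=\mathbb{R}^{N_1}\times\cdots\times\mathbb{R}^{N_k}$ such that for each $\lambda>0$ the dilation $D_\lambda(x)=(\lambda x^{(1)},\lambda^2x^{(2)},\dots,\lambda^kx^{(k)})$, $x^{(i)}\in\mathbb{R}^{N_i}$, is a group automorphism, and such that the left-invariant vector fields $X_1,\dots,X_{N_1}$ with $X_i(0)=\partial/\partial x_i|_0$ generate the whole Lie algebra of $\mathbb{G}$ (the Lie algebra they generate has rank $N$ at every point). The homogeneous dimension is $Q=\sum_{i=1}^k iN_i$. Haar measure $dx$ is Lebesgue measure on $\mathbb{R}^N$. $|\cdot|$ on $\mathbb{G}$ is a fixed homogeneous quasi-norm: a continuous function $\mathbb{G}\to[0,\infty)$ with $|x^{-1}|=|x|$, $|x|=0$ iff $x=0$, $|D_\lambda x|=\lambda|x|$; $y^{-1}x=y^{-1}\circ x$. Function space: $[u]_{s,p,\mathbb{G}}=\left(\iint_{\mathbb{G}\times\mathbb{G}}\frac{|u(x)-u(y)|^p}{|y^{-1}x|^{Q+ps}}dx\,dy\right)^{1/p}$, $W^{s,p}(\mathbb{G})=\{u\in L^p(\mathbb{G}):[u]_{s,p,\mathbb{G}}<\infty\}$, $X_0^{s,p}(\Omega)=\{u\in W^{s,p}(\mathbb{G}):u=0\text{ in }\mathbb{G}\setminus\Omega\}$, with norm $\|u\|_{X_0^{s,p}(\Omega)}=[u]_{s,p,\mathbb{G}}$ (for bounded $\Omega$).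 Functions are real-valued. Operator: $(-\Delta_{\mathbb{G},p})^su(x)=C(Q,s,p)\,\mathrm{P.V.}\int_{\mathbb{G}}\frac{|u(x)-u(y)|^{p-2}(u(x)-u(y))}{|y^{-1}x|^{Q+ps}}dy$, with a positive normalization constant $C(Q,s,p)$ that is omitted (taken to be 1) in the weak formulation. A weak solution of $(-\Delta_{\mathbb{G},p})^su=f(x,u)$ in $\Omega$, $u=0$ in $\mathbb{G}\setminus\Omega$, is $u\in X_0^{s,p}(\Omega)$ with $$\iint_{\mathbb{G}\times\mathbb{G}}\frac{|u(x)-u(y)|^{p-2}(u(x)-u(y))(\varphi(x)-\varphi(y))}{|y^{-1}x|^{Q+ps}}dx\,dy=\int_\Omega f(x,u(x))\varphi(x)\,dx\quad\forall\varphi\in X_0^{s,p}(\Omega).$$ Local minimum is meant with respect to the norm of $X_0^{s,p}(\Omega)$. *)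

(* Defs.v *)
From HB Require Import structures.
From mathcomp Require Import all_boot all_order all_algebra.
From mathcomp Require Import all_classical all_reals all_analysis.

Set Implicit Arguments.
Unset Strict Implicit.
Unset Printing Implicit Defensive.
Import Order.TTheory GRing.Theory Num.Theory.
Import numFieldNormedType.Exports.

Local Open Scope classical_set_scope.
Local Open Scope ring_scope.

Definition borel_rV (R : realType) (n : nat) : Type := 'rV[R]_n.

Section borel_rV.
Variables (R : realType) (n : nat).

Let coord (i : 'I_n) (x : 'rV[R]_n) : measurableTypeR R := x ord0 i.

HB.instance Definition _ := Pointed.copy (borel_rV R n) 'rV[R]_n.

Let borel_rV_set0 : g_sigma_preimage coord set0.
Proof. exact: sigma_algebra0. Qed.

Let borel_rV_setC A : g_sigma_preimage coord A -> g_sigma_preimage coord (~` A).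
Proof. exact: sigma_algebraC. Qed.

Let borel_rV_bigcup (F : _^nat) : (forall i, g_sigma_preimage coord (F i)) ->
  g_sigma_preimage coord (\bigcup_i (F i)).
Proof. exact: sigma_algebra_bigcup. Qed.

(* The sigma-algebra generated by the coordinate functions, i.e. the Borel
   sigma-algebra of R^n. *)
HB.instance Definition _ := @isMeasurable.Build
  (measure_tuple_display default_measure_display)
  (borel_rV R n) (g_sigma_preimage coord)
  borel_rV_set0 borel_rV_setC borel_rV_bigcup.
End borel_rV.

Section lebesgue_rV.
Variable R : realType.

Definition cons_rV n (z : measurableTypeR R * borel_rV R n) : borel_rV R n.+1 :=
  row_mx (z.1 : R)%:M (z.2 : 'rV[R]_n) : 'rV[R]_(1 + n).

Definition uncons_rV n (x : borel_rV R n.+1) : measurableTypeR R * borel_rV R n :=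
  ((x : 'rV[R]_n.+1) ord0 ord0, \row_j (x : 'rV[R]_n.+1) ord0 (lift ord0 j)).

Lemma cons_rV0 n z : (@cons_rV n z : 'rV[R]_n.+1) ord0 ord0 = z.1.
Proof.
have -> : ord0 = lshift n (ord0 : 'I_1) :> 'I_n.+1 by exact/val_inj.
by rewrite [LHS](row_mxEl _ _ ord0 (ord0 : 'I_1)) mxE eqxx.
Qed.

Lemma cons_rVS n z (j : 'I_n) :
  (@cons_rV n z : 'rV[R]_n.+1) ord0 (lift ord0 j) = (z.2 : 'rV[R]_n) ord0 j.
Proof.
have -> : lift ord0 j = rshift 1 j :> 'I_n.+1 by exact/val_inj.
exact: (row_mxEr _ _ ord0 j).
Qed.

Lemma cons_rVK n : cancel (@cons_rV n) (@uncons_rV n).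
Proof.
move=> z; rewrite /uncons_rV cons_rV0 [RHS]surjective_pairing; congr pair.
by apply/rowP => j; rewrite mxE cons_rVS.
Qed.

Lemma measurable_coord_rV n (i : 'I_n) :
  measurable_fun [set: borel_rV R n]
    (fun x => (x : 'rV[R]_n) ord0 i : measurableTypeR R).
Proof.
move=> _ Y mY; rewrite setTI; apply: sub_sigma_algebra => /=.
rewrite -bigcup_seq/=; exists i => /=; first by rewrite mem_index_enum.
by exists Y => //; rewrite setTI.
Qed.

Lemma measurable_rVP d (T : measurableType d) n (f : T -> borel_rV R n) :
  (forall i, measurable_fun [set: T]
    (fun x => (f x : 'rV[R]_n) ord0 i : measurableTypeR R)) ->
  measurable_fun [set: T] f.
Proof.
move=> mf; apply: (@measurability _ _ _ _ setT f
  (\big[setU/set0]_(i < n) preimage_set_system setT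
    (fun x : 'rV[R]_n => x ord0 i : measurableTypeR R) measurable)) => //.
move=> _ [B + <-]; rewrite -bigcup_seq => -[i _ [C mC <-]].
by rewrite setTI; have := mf i measurableT C mC; rewrite !setTI.
Qed.

Lemma measurable_cons_rV n : measurable_fun setT (@cons_rV n).
Proof.
apply: measurable_rVP => i; have [j ->|->] := unliftP ord0 i.
- rewrite (_ : (fun _ => _) =
    (fun y : borel_rV R n => (y : 'rV[R]_n) ord0 j : measurableTypeR R) \o snd).
    by apply: measurableT_comp; [exact: measurable_coord_rV|].
  by apply/funext => z /=; rewrite cons_rVS.
- rewrite (_ : (fun _ => _) = fst) //.
  by apply/funext => z /=; rewrite cons_rV0.
Qed.

Lemma measurable_uncons_rV n : measurable_fun setT (@uncons_rV n).
Proof.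
apply/measurable_fun_pairP; split; first exact: measurable_coord_rV.
apply: measurable_rVP => i; under eq_fun do rewrite /= mxE.
exact: measurable_coord_rV.
Qed.

Section step.
Variables (n : nat) (m : {sigma_finite_measure set (borel_rV R n) -> \bar R}).

Definition lebesgue_cons : set (borel_rV R n.+1) -> \bar R :=
  pushforward (@lebesgue_measure R \x m)%E (@cons_rV n).

Let measurable_cons_preimage A :
  measurable A -> measurable (@cons_rV n @^-1` A).
Proof. by move=> mA; rewrite -[X in measurable X]setTI; exact: measurable_cons_rV. Qed.

Let lebesgue_cons0 : lebesgue_cons set0 = 0%E.
Proof. by rewrite /lebesgue_cons /pushforward preimage_set0 measure0. Qed.

Let lebesgue_cons_ge0 A : (0 <= lebesgue_cons A)%E.
Proof. exact: (measure_ge0 (@lebesgue_measure R \x m)%E). Qed.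

Let lebesgue_cons_sigma_additive : semi_sigma_additive lebesgue_cons.
Proof.
move=> F mF tF mUF; rewrite /lebesgue_cons /pushforward preimage_bigcup.
apply: measure_semi_sigma_additive.
- by move=> k; exact: measurable_cons_preimage.
- apply/trivIsetP => /= i j _ _ ij; rewrite -preimage_setI.
  by move/trivIsetP : tF => /(_ _ _ _ _ ij) ->//; rewrite preimage_set0.
- by rewrite -preimage_bigcup; exact: measurable_cons_preimage.
Qed.

HB.instance Definition _ := isMeasure.Build _ _ _ lebesgue_cons
  lebesgue_cons0 lebesgue_cons_ge0 lebesgue_cons_sigma_additive.

Let lebesgue_cons_sigma_finite : sigma_finite setT lebesgue_cons.
Proof.
have /sigma_finiteP[F [TF ndF mF]] := sigma_finiteT (@lebesgue_measure R).
have /sigma_finiteP[G [TG ndG mG]] := sigma_finiteT m.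
exists (fun k => @uncons_rV n @^-1` (F k `*` G k)).
  rewrite -preimage_bigcup -[LHS](preimage_setT (@uncons_rV n)).
  congr preimage; rewrite -setXTT TF TG predeqE => -[x y]; split.
    move=> [/= [i _ Fx] [j _ Gy]]; exists (maxn i j) => //; split.
    - by move: x Fx; exact/subsetPset/ndF/leq_maxl.
    - by move: y Gy; exact/subsetPset/ndG/leq_maxr.
  by move=> [i _ []/= ? ?]; split; exists i.
move=> k; have [mFk Fkoo] := mF k; have [mGk Gkoo] := mG k; split.
  rewrite -[X in measurable X]setTI; apply: measurable_uncons_rV => //.
  exact: measurableX.
rewrite /lebesgue_cons /pushforward -comp_preimage.
rewrite (_ : _ \o _ = id); last by apply/funext => z /=; rewrite cons_rVK.
by rewrite preimage_id product_measure1E// lte_mul_pinfty// ge0_fin_numE.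
Qed.

HB.instance Definition _ := Measure_isSigmaFinite.Build _ _ _ lebesgue_cons
  lebesgue_cons_sigma_finite.
End step.

Fixpoint borel_lebesgue_rV n : {sigma_finite_measure set (borel_rV R n) -> \bar R} :=
  if n is n'.+1 then lebesgue_cons (borel_lebesgue_rV n')
  else \d_((0 : 'rV[R]_0) : borel_rV R 0).

End lebesgue_rV.

(* R^n with the Caratheodory sigma-algebra of the outer measure, i.e. the
   Lebesgue-measurable sets. *)
Definition lebesgue_space (R : realType) (n : nat) :=
  caratheodory_type (mu_ext (borel_lebesgue_rV R n)).

Definition lebesgue_rV (R : realType) (n : nat) :
    set (lebesgue_space R n) -> \bar R :=
  @completed_measure_extension _ _ _ (borel_lebesgue_rV R n).
HB.instance Definition _ (R : realType) (n : nat) :=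
  Measure.on (@lebesgue_rV R n).
HB.instance Definition _ (R : realType) (n : nat) :=
  Measure_isSigmaFinite.Build _ _ _ (@lebesgue_rV R n)
    (completed_measure_extension_sigma_finite (sigma_finiteT (borel_lebesgue_rV R n))).

(* The directional derivatives of all orders up to [m] exist and are
   continuous; on R^n this is the class C^m. *)
Fixpoint Ck (R : realType) (V W : normedModType R) (m : nat) (f : V -> W) : Prop :=
  if m is m'.+1 then
    [/\ continuous f, forall x v, derivable f x v & forall v, Ck m' ('D_v f)]
  else continuous f.

Definition smooth (R : realType) (V W : normedModType R) (f : V -> W) : Prop :=
  forall m, Ck m f.

Section vector_fields.
Variables (R : realType) (n : nat).
Implicit Types X Y : 'rV[R]_n -> 'rV[R]_n.

Definition lie_bracket X Y : 'rV[R]_n -> 'rV[R]_n :=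
  fun x => 'D_(X x) Y x - 'D_(Y x) X x.

Inductive lie_algebra_generated (S : set ('rV[R]_n -> 'rV[R]_n)) :
    set ('rV[R]_n -> 'rV[R]_n) :=
| lie_generator X : S X -> lie_algebra_generated S X
| lie_lin (a : R) X Y :
    lie_algebra_generated S X -> lie_algebra_generated S Y ->
    lie_algebra_generated S (fun x => a *: X x + Y x)
| lie_brack X Y :
    lie_algebra_generated S X -> lie_algebra_generated S Y ->
    lie_algebra_generated S (lie_bracket X Y).

(* [D_(X y) (op x) y] is the differential at y of the left translation by x,
   applied to X(y). *)
Definition left_invariant (op : 'rV[R]_n -> 'rV[R]_n -> 'rV[R]_n) X : Prop :=
  forall x y, 'D_(X y) (op x) y = X (op x y).
End vector_fields.

Section stratified.
Variables (R : realType) (k : nat) (N : 'I_k.+1 -> nat).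

Local Notation dim := (\sum_i N i)%N.

(* Layers are numbered from 0: [submxrow x i] is x^(i+1), scaled by l^(i+1). *)
Definition dilation (l : R) (x : 'rV[R]_dim) : 'rV[R]_dim :=
  \mxrow_(i < k.+1) (l ^+ i.+1 *: submxrow x i).

Definition first_layer_fields (op : 'rV[R]_dim -> 'rV[R]_dim -> 'rV[R]_dim) :
    set ('rV[R]_dim -> 'rV[R]_dim) :=
  [set X | left_invariant op X /\
    exists j : 'I_(N ord0), X 0 = delta_mx ord0 (tagnat.Rank ord0 j)].

(* The neutral element is necessarily 0, the only fixed point of the dilations. *)
Record stratified_group := StratifiedGroup {
  gop : 'rV[R]_dim -> 'rV[R]_dim -> 'rV[R]_dim;
  ginv : 'rV[R]_dim -> 'rV[R]_dim;
  gopA : associative gop;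
  gop0x : left_id 0 gop;
  gopx0 : right_id 0 gop;
  gopVx : left_inverse 0 ginv gop;
  gopxV : right_inverse 0 ginv gop;
  gop_smooth : smooth (fun z : 'rV[R]_dim * 'rV[R]_dim => gop z.1 z.2);
  ginv_smooth : smooth ginv;
  dilation_gop : forall l, 0 < l -> {morph dilation l : x y / gop x y};
  lie_rank : forall x v,
    exists2 X, lie_algebra_generated (first_layer_fields gop) X & X x = v }.

Definition homogeneous_dim : nat := (\sum_(i < k.+1) i.+1 * N i)%N.

Record homogeneous_quasinorm (G : stratified_group) (nu : 'rV[R]_dim -> R) : Prop :=
  HomogeneousQuasinorm {
    quasinorm_continuous : continuous nu;
    quasinorm_ge0 : forall x, 0 <= nu x;
    quasinormV : forall x, nu (ginv G x) = nu x;
    quasinorm_eq0 : forall x, nu x = 0 <-> x = 0;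
    quasinorm_dilation : forall l x, 0 < l -> nu (dilation l x) = l * nu x }.

Local Notation space := (lebesgue_space R dim).
Local Notation leb := (@lebesgue_rV R dim).
Local Notation leb2 := (leb \x leb)%E.
Local Notation Q := (homogeneous_dim%:R : R).

Variables (G : stratified_group) (nu : 'rV[R]_dim -> R) (s p : R).

Definition kernel (z : space * space) : R :=
  (nu (gop G (ginv G z.2) z.1) `^ (Q + p * s))^-1.

Definition gagliardo (u : space -> R) : \bar R :=
  ((\int[leb2]_z (`|u z.1 - u z.2| `^ p * kernel z)%:E) `^ p^-1)%E.

(* Functions stand for their classes modulo equality almost everywhere. *)
Definition sobolev : set (space -> R) :=
  [set u | [/\ measurable_fun setT u,
    ('N[leb]_p%:E[EFin \o u] < +oo)%E & (gagliardo u < +oo)%E]].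

Definition sobolev0 (Omega : set space) : set (space -> R) :=
  [set u | sobolev u /\ {ae leb, forall x, ~ Omega x -> u x = 0}].

Definition weak_integrand (u phi : space -> R) (z : space * space) : R :=
  `|u z.1 - u z.2| `^ (p - 2) * (u z.1 - u z.2) * (phi z.1 - phi z.2) * kernel z.

(* The integral of real-valued functions is a total operator, hence the
   integrability clauses. *)
Definition weak_solution (Omega : set space) (f : space -> R -> R)
    (u : space -> R) : Prop :=
  sobolev0 Omega u /\
  forall phi, sobolev0 Omega phi ->
    [/\ leb2.-integrable setT (EFin \o weak_integrand u phi),
      leb.-integrable Omega (fun x => (f x (u x) * phi x)%:E) &
      \int[leb2]_z weak_integrand u phi z =
      \int[leb]_(x in Omega) (f x (u x) * phi x)].

Definition local_minimum (Omega : set space) (I : (space -> R) -> R)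
    (u : space -> R) : Prop :=
  sobolev0 Omega u /\
  exists2 r : R, 0 < r & forall v, sobolev0 Omega v ->
    (gagliardo (fun x => (v x - u x)%R) < r%:E)%E -> I u <= I v.

Definition critical_exponent : R := p * Q / (Q - p * s).

Definition caratheodory (Omega : set space) (h : space -> R -> R) : Prop :=
  (forall t, measurable_fun Omega (h ^~ t)) /\
  (forall x, Omega x -> continuous (h x)).

Definition primitive (g : R -> R) (t : R) : R :=
  if 0 <= t then \int[@lebesgue_measure R]_(tau in `[0, t]) g tau
  else - \int[@lebesgue_measure R]_(tau in `[t, 0]) g tau.

Definition energy (Omega : set space) (h : space -> R -> R) (m l : R)
    (u : space -> R) : R :=
  p^-1 * \int[leb2]_z (`|u z.1 - u z.2| `^ p * kernel z)
  - m / critical_exponent * \int[leb]_(x in Omega) (`|u x| `^ critical_exponent)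
  - l * \int[leb]_(x in Omega) primitive (h x) (u x).

End stratified.

(* Main.v *)
Require Import Defs.
From mathcomp Require Import all_boot all_order all_algebra.
From mathcomp Require Import all_classical all_reals all_analysis.
From mathcomp Require Import measurable_realfun.
From mathcomp Require Import ring lra.
Import Order.TTheory GRing.Theory Num.Theory.
Import numFieldNormedType.Exports.

(** The solution is a minimizer of the energy functional J over a small ball
    {A u <= eta} of the function space, where A u is the p-th power of the norm,
    and the smallness of lambda keeps the minimizer away from the boundary of the
    ball.

    Two facts about the group are needed. The fractional Sobolev inequality bounds
    the integral of |u| ^ r, r being the critical exponent, by S * A u ^ (r / p).
    Compactness says that a sequence of bounded energy has a subsequence which
    converges almost everywhere. Both are proved for an abstract measure and an
    abstract kernel, from sets V x t of measure c * t ^ Q on which the kernel is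
    at least t ^ - (Q + p s) ([sobolev_inequality], [l1_subsequence]). In a
    stratified group these sets are left translates of dilated boxes. Their
    measure is computed in coordinates: homogeneity forces the derivative of the
    product x y with respect to a coordinate of y to be constant in all
    coordinates of the same or a lower layer ([gop_derivative]), so that left translations are
    triangular maps, and such maps multiply Lebesgue measure by the product of
    their slopes ([measure_triangular_preimage]).

    The embedding into L^r is not compact, so that the critical term may jump in
    the limit of a minimizing sequence w_n. If w_n tends to u pointwise, then
    Fatou's lemma bounds this jump by a multiple of the critical integral of
    w_n - u ([critical_gap]), and shows that the energy drops at least by a
    multiple of A (w_n - u) ([energy_gap]). As r > p, the Sobolev inequality makes
    the drop outweigh the jump when eta is small with respect to mu
    ([exists_sobolev_absorbs]). Hence J is lower semicontinuous along the sequence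
    ([functional_lsc]) and the minimum v is attained. Since J v <= J 0 = 0, the
    energy of v is of order lambda, hence less than eta for small lambda
    ([exists_interior_minimizer]); thus v minimizes J in a neighbourhood of v
    ([renergy_neighborhood]).

    The weak formulation is the vanishing of the derivative of J at v. The
    difference quotients of the three integrals converge by dominated convergence
    ([cvg_integral_difference_quotient]), and the derivative is nonnegative in
    every direction phi, hence also in the direction - phi ([euler_lagrange]). *)

Set Implicit Arguments.
Unset Strict Implicit.
Unset Printing Implicit Defensive.
Local Open Scope classical_set_scope.
Local Open Scope ring_scope.

(** * Real powers *)

Section power.
Variable R : realType.
Implicit Types a b t r d : R.

Lemma le_powR2 r a b : 0 <= r -> 0 <= a -> a <= b -> a `^ r <= b `^ r.
Proof.
by move=> r0 a0 ab; apply: ge0_ler_powR => //; rewrite nnegrE// (le_trans a0).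
Qed.

Lemma gt0_powRD t a b : 0 < t -> t `^ (a + b) = t `^ a * t `^ b.
Proof. by move=> t0; rewrite powRD// (gt_eqF t0) implybT. Qed.

(** If |b| <= d |a| the first term alone bounds the left-hand side, otherwise the second
    one does. A small d brings the weight of |a| close to 1, at the expense of that of
    |b|. *)
Lemma normr_powRD_le d a b r : 0 < d -> 0 <= r ->
  `|a + b| `^ r <= (1 + d) `^ r * `|a| `^ r + (1 + d^-1) `^ r * `|b| `^ r.
Proof.
move=> d0 r0; have dV0 : 0 < d^-1 by rewrite invr_gt0.
have [ba|ab] := leP `|b| (d * `|a|).
- apply: (@le_trans _ _ (((1 + d) * `|a|) `^ r)).
    apply: le_powR2 => //.
    by apply: (le_trans (ler_normD _ _)); rewrite mulrDl mul1r lerD2l.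
  by rewrite powRM ?addr_ge0 ?(ltW d0)// lerDl mulr_ge0 ?powR_ge0.
- apply: (@le_trans _ _ (((1 + d^-1) * `|b|) `^ r)).
    apply: le_powR2 => //.
    apply: (le_trans (ler_normD _ _)); rewrite mulrDl mul1r addrC lerD2l.
    by rewrite -ler_pdivrMl ?invr_gt0// invrK ltW.
  by rewrite powRM ?addr_ge0 ?(ltW dV0)// lerDr mulr_ge0 ?powR_ge0.
Qed.

Lemma normr_powRD_le2 a b r : 0 <= r ->
  `|a + b| `^ r <= 2 `^ r * (`|a| `^ r + `|b| `^ r).
Proof.
move=> r0; have := @normr_powRD_le 1 a b r ltr01 r0.
by rewrite invr1 -mulrDr.
Qed.

(** Below the threshold d the first term suffices, above it the second one. It is used
    with a large d, to make a lower power a small multiple of a higher one, and with a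
    small d, to make the additive constant small. *)
Lemma powR_le_interpolation d a b t : 0 < d -> 0 <= a -> a <= b -> 0 <= t ->
  t `^ a <= d `^ a + d `^ (a - b) * t `^ b.
Proof.
move=> d0 a0 ab t0; have [td|dt] := leP t d.
  by apply: (le_trans (le_powR2 a0 t0 td)); rewrite lerDl mulr_ge0 ?powR_ge0.
have t_gt0 : 0 < t by apply: lt_trans dt.
rewrite -[leLHS]add0r lerD ?powR_ge0//.
have -> : t `^ a = t `^ (a - b) * t `^ b.
  by rewrite -gt0_powRD// subrK.
rewrite ler_wpM2r ?powR_ge0//.
have -> : a - b = - (b - a) by rewrite opprB.
rewrite !powRN lef_pV2 ?posrE ?powR_gt0//.
by rewrite le_powR2 ?subr_ge0// ltW.
Qed.

(** At the origin the difference quotient is |h| ^ (r - 1) up to sign, which tends to 0. *)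
Lemma is_derive_normr_powR r (x : R) : 2 <= r ->
  is_derive x 1 (fun t => `|t| `^ r) (r * (`|x| `^ (r - 2) * x)).
Proof.
move=> r2; have r0 : 0 < r by apply: lt_le_trans r2.
have [x0|x0|->] := ltgtP x 0.
- have nx : 0 < - x by rewrite oppr_gt0.
  have H : is_derive x 1 (fun t => (- t) `^ r) (r * ((- x) `^ (r - 2) * x)).
    have -> : r * ((- x) `^ (r - 2) * x) = (r * (- x) `^ (r - 1)) * (-1).
      have -> : r - 1 = (r - 2) + 1 by lra.
      rewrite [in RHS]gt0_powRD ?powRr1 ?(ltW nx)//.
      by ring.
    apply: (@is_derive1_comp _ (fun t : R => t `^ r) (fun t => - t)).
    exact: is_derive1_powR.
  rewrite ltr0_norm//; apply: near_eq_is_derive H.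
  by near=> t; rewrite ltr0_norm//; near: t; exact: lt_nbhsl.
- rewrite gtr0_norm//.
  have H : is_derive x 1 (fun t => t `^ r) (r * (x `^ (r - 2) * x)).
    have -> : r * (x `^ (r - 2) * x) = r * x `^ (r - 1).
      congr (r * _).
      have -> : r - 1 = (r - 2) + 1 by lra.
      by rewrite [in RHS]gt0_powRD ?powRr1 ?(ltW x0).
    exact: is_derive1_powR.
  apply: near_eq_is_derive H.
  by near=> t; rewrite gtr0_norm//; near: t; exact: lt_nbhsr.
- rewrite !mulr0.
  pose f (t : R) : R := `|t| `^ r.
  have H : h^-1 *: ((f \o shift 0) (h *: (1 : R)) - f 0) @[h --> (0 : R)^'] --> (0 : R).
    apply/cvgrPdist_le => e e0; near=> h.
    rewrite /f /= sub0r normrN normr0 powR0 ?gt_eqF// subr0 addr0 [h *: 1]mulr1.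
    rewrite normrZ normfV norm_powR// normr_id.
    rewrite ler_pdivrMl ?normr_gt0//; last by near: h; exact: nbhs_dnbhs_neq.
    have -> : `|h| `^ r = `|h| * `|h| `^ (r - 1).
      by rewrite mulr_powRB1.
    rewrite ler_wpM2l//.
    have -> : e = (e `^ (r - 1)^-1) `^ (r - 1).
      by rewrite -powRrM mulVf ?powRr1 ?(ltW e0)//; lra.
    apply: le_powR2 => //; first lra.
    near: h; apply: nbhs_dnbhs.
    have := @nbhs0_le R R (e `^ (r - 1)^-1); apply.
    exact: powR_gt0.
  by apply: DeriveDef; [apply/cvg_ex; exists 0|exact: cvg_lim H].
Unshelve. all: by end_near. Qed.
End power.

(** * Substitution into Caratheodory functions, and Fatou's lemma *)

Section measurable_substitution.
Context d (T : measurableType d) (R : realType).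

(** On each of the countably many pieces where c n is constant, the n-th approximation is
    g with a frozen parameter, hence measurable; g x (u x) is the pointwise limit of these
    approximations. *)
Lemma measurable_fun_subst_cvg (X : Type) (I : countType) (g : T -> X -> R)
    (u : T -> X) (c : nat -> T -> I) (e : nat -> I -> X) :
  (forall n i, measurable (c n @^-1` [set i])) ->
  (forall n i, measurable_fun setT (fun x => g x (e n i))) ->
  (forall x, g x (e n (c n x)) @[n --> \oo] --> g x (u x)) ->
  measurable_fun setT (fun x => g x (u x)).
Proof.
move=> mc mg gu.
apply: (@measurable_fun_cvg _ _ _ _ (fun n x => g x (e n (c n x)))) => [n|x _]; last exact: gu.
move=> _ Y mY; rewrite setTI.
rewrite (_ : _ @^-1` Y = \bigcup_(i in [set: I])
    (c n @^-1` [set i] `&` ((fun x => g x (e n i)) @^-1` Y))).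
  apply: countable_bigcupT_measurable => // i.
  apply: measurableI => //.
  by rewrite -[X in measurable X]setTI; exact: mg.
apply/seteqP; split => x /=; first by move=> Yx; exists (c n x).
by move=> [i _ [/= <-]].
Qed.

Lemma cvg_floorM_div (t : R) : (Num.floor (n.+1%:R * t))%:~R / n.+1%:R @[n --> \oo] --> t.
Proof.
apply/cvgrPdist_le => eps eps0; near=> n.
have n0 : 0 < n.+1%:R :> R by rewrite ltr0n.
have /andP[h1 h2] := mem_rg1_floor (n.+1%:R * t).
have -> : t - (Num.floor (n.+1%:R * t))%:~R / n.+1%:R =
    (n.+1%:R * t - (Num.floor (n.+1%:R * t))%:~R) / n.+1%:R.
  by field; rewrite gt_eqF.
rewrite ger0_norm; last by rewrite divr_ge0 ?subr_ge0// ltW.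
apply: (@le_trans _ _ n.+1%:R^-1).
  by rewrite ler_pdivrMr// mulVf ?gt_eqF//; move: h2; lra.
by apply: ltW; near: n; exact: (near_infty_natSinv_lt (PosNum eps0)).
Unshelve. all: by end_near. Qed.

(** The values of u are rounded down to multiples of 1 / (n + 1). *)
Lemma measurable_fun_caratheodory (g : T -> R -> R) (u : T -> R) :
  (forall t, measurable_fun setT (g ^~ t)) -> (forall x, continuous (g x)) ->
  measurable_fun setT u -> measurable_fun setT (fun x => g x (u x)).
Proof.
move=> mg cg mu.
pose c (n : nat) x := Num.floor (n.+1%:R * u x).
pose e (n : nat) (i : int) : R := i%:~R / n.+1%:R.
apply: (@measurable_fun_subst_cvg _ _ _ _ c e) => // [n i|x].
- have -> : c n @^-1` [set i] = (fun x => n.+1%:R * u x) @^-1` `[i%:~R, (i + 1)%:~R[.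
    apply/seteqP; split => x /=; rewrite in_itv/= /c.
      by move=> <-; exact: floor_itv.
    exact: floor_def.
  rewrite -[X in measurable X]setTI.
  have := @measurable_funM _ _ _ setT (cst n.+1%:R) u; apply => //.
- apply: continuous_cvg; first exact: cg.
  exact: cvg_floorM_div.
Qed.
End measurable_substitution.

Section integral_limits.
Context d (T : measurableType d) (R : realType) (mu : {measure set T -> \bar R}).
Variables (D : set T) (mD : measurable D).
Implicit Types f g : T -> R.

Lemma limn_einf_gt_near (u : (\bar R)^nat) (a : \bar R) :
  (a < limn_einf u)%E -> \forall n \near \oo, (a < u n)%E.
Proof.
rewrite limn_einf_lim => au.
have uE := cvg_lim (@ereal_hausdorff _) (@cvg_einfs_sup _ u).
rewrite uE in au; have [_ [n _ <-] an] := ereal_sup_gt au.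
near=> m; apply: (lt_le_trans an).
apply: ereal_inf_lbound; exists m => //=.
by near: m; exists n.
Unshelve. all: by end_near. Qed.

(** Fatou's lemma for the nonnegative functions a_n + b. The form with an e keeps limits
    inferior of extended reals out of the later estimates. *)
Lemma fatou_lower_bound (a_ : nat -> T -> R) (a b : T -> R) :
  (forall n, mu.-integrable D (EFin \o a_ n)) ->
  mu.-integrable D (EFin \o a) -> mu.-integrable D (EFin \o b) ->
  (forall n x, D x -> - b x <= a_ n x) ->
  (forall x, D x -> a_ n x @[n --> \oo] --> a x) ->
  forall e, 0 < e -> \forall n \near \oo,
    \int[mu]_(x in D) a x - e <= \int[mu]_(x in D) a_ n x.
Proof.
move=> ia_ ia ib a_ge cva e e0.
pose f n x : \bar R := (a_ n x + b x)%:E.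
have iab n : mu.-integrable D (f n) by exact: (integrableD mD (ia_ n) ib).
have mf n : measurable_fun D (f n) by exact: measurable_int (iab n).
have f0 n x : D x -> (0 <= f n x)%E.
  by move=> Dx; rewrite lee_fin -lerBlDr sub0r a_ge.
have := @fatou _ _ _ mu D mD f mf f0.
have -> : (\int[mu]_(x in D) limn_einf (f^~ x) =
    (\int[mu]_(x in D) a x + \int[mu]_(x in D) b x)%:E)%E.
  rewrite -RintegralD// /Rintegral fineK; last first.
    by apply: integrable_fin_num => //; exact: (integrableD mD ia ib).
  apply: eq_integral => x /set_mem Dx.
  apply: (cvg_limn_einf_sup _).1 => //.
  apply: cvg_EFin; first by near=> n.
  by apply: cvgD; [exact: cva|exact: cvg_cst].
set L := (_ + _)%R => HL.
have : ((L - e)%:E < limn_einf (fun n : nat => \int[mu]_(x in D) f n x))%E.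
  by apply: lt_le_trans HL; rewrite lte_fin ltrBlDr ltrDl.
move=> /limn_einf_gt_near; apply: filterS => n.
have -> : (\int[mu]_(x in D) f n x = (\int[mu]_(x in D) a_ n x + \int[mu]_(x in D) b x)%:E)%E.
  rewrite -RintegralD// /Rintegral fineK//.
  by apply: integrable_fin_num => //; exact: (integrableD mD (ia_ n) ib).
rewrite lte_fin /L; lra.
Unshelve. all: by end_near. Qed.
End integral_limits.

(** * Difference quotients of integral functionals *)

Section gateaux.
Context d (T : measurableType d) (R : realType) (mu : {measure set T -> \bar R}).
Variables (D : set T) (mD : measurable D).

Lemma is_derive_line (F f : R -> R) (a b t : R) :
  (forall t : R, is_derive t (1 : R) F (f t)) ->
  is_derive t (1 : R) (fun t : R => F (a + t * b)) (f (a + t * b) * b).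
Proof.
move=> dF; apply: (@is_derive1_comp _ F (fun t => a + t * b)).
have -> : (fun t : R => a + t * b) = (cst a + b \*: id).
  by apply/funext => x; rewrite mulrC.
by apply: is_derive_eq; rewrite add0r; exact: mulr1.
Qed.

Lemma cvg_difference_quotient (F f : R -> R) (a b : R) :
  (forall t : R, is_derive t (1 : R) F (f t)) ->
  n.+1%:R * (F (a + n.+1%:R^-1 * b) - F a) @[n --> \oo] --> f a * b.
Proof.
move=> dF; have := @is_derive_line F f a b 0 dF.
rewrite mul0r addr0 => -[dG <-].
have H : (fun n => n.+1%:R^-1 : R) @ \oo --> (0 : R)^'.
  move=> A HA.
  have : \forall n \near \oo, (harmonic n : R) != 0 -> A (harmonic n).
    exact: (@cvg_harmonic R _ HA).
  rewrite /= nbhs_simpl; apply: filterS => n; apply.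
  by rewrite gt_eqF// invr_gt0.
have := cvg_comp _ _ H dG; apply: cvg_trans; apply: near_eq_cvg; near=> n => /=.
by rewrite /shift/= addr0 invrK mul0r addr0 [X in X * b]mulr1.
Unshelve. all: by end_near. Qed.

(** By the mean value theorem the difference quotient of F x along the segment from a x in
    the direction b x is a value of the derivative at an intermediate point, so that g
    dominates it. Only the steps 1 / (n + 1) are considered, which suffices to read off
    the sign of a first variation. *)
Lemma cvg_integral_difference_quotient (F f : T -> R -> R) (a b g : T -> R) :
  mu.-integrable D (EFin \o g) ->
  (forall x (t : R), D x -> is_derive t (1 : R) (F x) (f x t)) ->
  (forall x (t : R), D x -> 0 <= t <= 1 -> `|f x (a x + t * b x) * b x| <= g x) ->
  (forall t : R, 0 <= t <= 1 -> mu.-integrable D (fun x => (F x (a x + t * b x))%:E)) ->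
  measurable_fun D (fun x => f x (a x) * b x) ->
  mu.-integrable D (fun x => (f x (a x) * b x)%:E) /\
  n.+1%:R * (\int[mu]_(x in D) F x (a x + n.+1%:R^-1 * b x) - \int[mu]_(x in D) F x (a x))
    @[n --> \oo] --> \int[mu]_(x in D) (f x (a x) * b x).
Proof.
move=> ig dF fg iF mfab.
pose q n x : R := n.+1%:R * (F x (a x + n.+1%:R^-1 * b x) - F x (a x)).
have t01 n : 0 <= (n.+1%:R^-1 : R) <= 1.
  apply/andP; split; first by rewrite invr_ge0.
  by rewrite invf_le1 ?ltr0n// ler1n.
have iF0 : mu.-integrable D (fun x => (F x (a x))%:E).
  have := iF 0; rewrite lexx ler01 => /(_ isT).
  by under eq_fun do rewrite mul0r addr0.
have iq n : mu.-integrable D (EFin \o q n).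
  exact: (integrableZl mD n.+1%:R (integrableB mD (iF _ (t01 n)) iF0)).
have qg n x : D x -> `|q n x| <= g x.
  move=> Dx; have n0 : 0 < n.+1%:R^-1 :> R by rewrite invr_gt0.
  have dG t := @is_derive_line (F x) (f x) (a x) (b x) t (dF x ^~ Dx).
  have [c c01 Gc] := @MVT_segment _ _ _ 0 n.+1%:R^-1 (ltW n0) (fun t _ => dG t)
    (derivable_within_continuous (fun t _ => @ex_derive _ _ _ _ _ _ _ (dG t))).
  move: Gc; rewrite mul0r addr0 subr0 => Gc.
  rewrite /q Gc mulrCA mulfV ?mulr1; last by rewrite pnatr_eq0.
  apply: fg => //; move: c01; rewrite in_itv/= => /andP[-> /le_trans]/=.
  by apply; case/andP: (t01 n).
have [] := @dominated_convergence _ _ _ mu D mD (fun n x => (q n x)%:E)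
  (fun x => (f x (a x) * b x)%:E) (EFin \o g).
- by move=> n; exact: measurable_int (iq n).
- exact/measurable_EFinP.
- apply: aeW => x Dx; apply: cvg_EFin; first by near=> n.
  exact: cvg_difference_quotient (dF x ^~ Dx).
- exact: ig.
- by apply: aeW => x n Dx; rewrite lee_fin qg.
move=> i_ _ H; split; first exact: i_.
have : fine (\int[mu]_(x in D) (q n x)%:E) @[n --> \oo] --> \int[mu]_(x in D) (f x (a x) * b x).
  apply: fine_cvg.
  by rewrite /Rintegral fineK ?integrable_fin_num.
apply: cvg_trans; apply: near_eq_cvg; near=> n.
rewrite -RintegralB//; last exact: iF.
rewrite -RintegralZl//; exact: (integrableB mD (iF _ (t01 n)) iF0).
Unshelve. all: by end_near. Qed.
End gateaux.

(** * Primitives of continuous functions *)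

Section primitive.
Variable R : realType.
Local Notation leb := (@lebesgue_measure R).

Let integrable_itv (g : R -> R) (a b : R) : continuous g ->
  leb.-integrable `[a, b] (EFin \o g).
Proof.
move=> cg; apply: continuous_compact_integrable; first exact: segment_compact.
exact: continuous_subspaceT.
Qed.

(** A base point below both t and 0 removes the case distinction in the definition of the
    primitive, so that the fundamental theorem of calculus applies at every t, the origin
    included. *)
Lemma primitiveE (g : R -> R) (c t : R) : continuous g -> c <= t -> c <= 0 ->
  primitive g t = \int[leb]_(x in `[c, t]) g x - \int[leb]_(x in `[c, 0]) g x.
Proof.
move=> cg ct c0; rewrite /primitive; have [t0|t0] := leP 0 t.
- rewrite Rintegral_itvB ?bnd_simp//; last exact: integrable_itv.
  rewrite Rintegral_itv_obnd_cbnd//.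
  by apply: integrableS (integrable_itv 0 t cg) => //; exact: subset_itv_oc_cc.
- rewrite -opprB Rintegral_itvB ?bnd_simp//; last 2 first.
    exact: integrable_itv.
    exact: ltW.
  rewrite Rintegral_itv_obnd_cbnd//.
  by apply: integrableS (integrable_itv t 0 cg) => //; exact: subset_itv_oc_cc.
Qed.

Lemma is_derive_primitive (g : R -> R) (t : R) : continuous g ->
  is_derive t (1 : R) (primitive g) (g t).
Proof.
move=> cg; pose c := Num.min t 0 - 1.
have ct : c < t by rewrite /c; case: (leP t 0); lra.
have c0 : c <= 0 by rewrite /c; case: (leP t 0); lra.
have ttS : t < t + 1 by rewrite ltrDl.
have [dF F'] := @continuous_FTC1_closed R g c t (t + 1) ttS
  (integrable_itv c (t + 1) cg) ct (cg t).
have H : is_derive t (1 : R) (fun x => \int[leb]_(x in `[c, x]) g x + (- \int[leb]_(x in `[c, 0]) g x)) (g t).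
  have -> : g t = g t + 0 by rewrite addr0.
  apply: is_deriveD; first by apply: DeriveDef; [exact: dF|rewrite -derive1E; exact: F'].
apply: near_eq_is_derive H; near=> x.
by rewrite (@primitiveE _ c)//; apply: ltW; near: x; exact: lt_nbhsr.
Unshelve. all: by end_near. Qed.

Lemma primitive0 (g : R -> R) : primitive g 0 = 0.
Proof. by rewrite /primitive lexx set_itv1 Rintegral_set1. Qed.

(** Tonelli's theorem for the positive and the negative part; h is jointly measurable as a
    Caratheodory function on T x R. *)
Lemma measurable_Rintegral_param d (T : measurableType d) (h : T -> R -> R) (A : set R) :
  measurable A ->
  (forall t, measurable_fun setT (h ^~ t)) -> (forall x, continuous (h x)) ->
  measurable_fun setT (fun x => \int[leb]_(t in A) h x t).
Proof.
move=> mA mh ch.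
pose k (z : T * measurableTypeR R) : \bar R := (h z.1 z.2 * \1_A z.2)%:E.
have mk : measurable_fun setT k.
  apply/measurable_EFinP; apply: measurable_funM; last first.
    by apply: measurableT_comp => //; exact: measurable_indic.
  apply: (@measurable_fun_caratheodory _ _ _ (fun z : T * measurableTypeR R => h z.1) snd) => //.
  by move=> t; apply: (@measurableT_comp _ _ _ _ _ _ (h ^~ t)).
have -> : (fun x => \int[leb]_(t in A) h x t) =
   (fun x => fine (fubini_F leb k^\+ x - fubini_F leb k^\- x)).
  apply/funext => x; rewrite /Rintegral integral_mkcond integralE.
  have kE t : ((fun t => (h x t)%:E) \_ A) t = k (x, t).
    by rewrite /k/= patchE indicE; case: ifPn => _; rewrite ?mulr1// mulr0.
  by congr (fine (_ - _)); apply: eq_integral => t _; rewrite !(funeposE, funenegE) kE.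
apply: measurableT_comp => //; apply: emeasurable_funB.
- apply: measurable_fun_fubini_tonelli_F => //; exact: measurable_funepos.
- apply: measurable_fun_fubini_tonelli_F => //; exact: measurable_funeneg.
Qed.

Lemma measurable_primitive d (T : measurableType d) (h : T -> R -> R) (u : T -> R) :
  (forall t, measurable_fun setT (h ^~ t)) -> (forall x, continuous (h x)) ->
  measurable_fun setT u ->
  measurable_fun setT (fun x => primitive (h x) (u x)).
Proof.
move=> mh ch mu; apply: (@measurable_fun_caratheodory _ _ _ (fun x => primitive (h x))) => //.
- move=> t; have [t0|t0] := leP 0 t.
    rewrite (_ : (fun _ => _) = fun x => \int[leb]_(y in `[0, t]) h x y).
      exact: measurable_Rintegral_param.
    by apply/funext => x; rewrite /primitive t0.
  rewrite (_ : (fun _ => _) = fun x => - \int[leb]_(y in `[t, 0]) h x y).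
    by apply: measurableT_comp => //; exact: measurable_Rintegral_param.
  by apply/funext => x; rewrite /primitive leNgt t0.
- move=> x t; apply: differentiable_continuous; apply/derivable1_diffP.
  exact: (@ex_derive _ _ _ _ _ _ _ (is_derive_primitive t (ch x))).
Qed.

Lemma normr_primitive_le (g : R -> R) (M t : R) : continuous g ->
  (forall x, `|x| <= `|t| -> `|g x| <= M) -> `|primitive g t| <= M * `|t|.
Proof.
move=> cg gM.
have dP x := @is_derive_primitive g x cg.
have cP (a b : R) : {within `[a, b], continuous (primitive g)}.
  by apply: derivable_within_continuous => x _; exact: (@ex_derive _ _ _ _ _ _ _ (dP x)).
have [t0|t0] := leP 0 t.
- have [c] := @MVT_segment _ _ _ 0 t t0 (fun x _ => dP x) (cP _ _).
  rewrite in_itv/= => /andP[c0 ct]; rewrite primitive0 !subr0 => ->.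
  by rewrite normrM ler_wpM2r// gM// !ger0_norm.
- have [c] := @MVT_segment _ _ _ t 0 (ltW t0) (fun x _ => dP x) (cP _ _).
  rewrite in_itv/= => /andP[tc c0]; rewrite primitive0 !sub0r => /eqP.
  rewrite eqr_oppLR => /eqP ->.
  by rewrite normrN normrM normrN ler_wpM2r// gM// !ler0_norm ?lerN2// ltW.
Qed.
End primitive.

Section fatou.
Context d (T : measurableType d) (R : realType) (mu : {measure set T -> \bar R}).

Lemma fatou_le (f_ : nat -> T -> R) (f : T -> R) (c : \bar R) :
  (forall n, measurable_fun setT (f_ n)) -> (forall n x, 0 <= f_ n x) ->
  (forall x, f_ n x @[n --> \oo] --> f x) ->
  (forall n, \int[mu]_x (f_ n x)%:E <= c)%E -> (\int[mu]_x (f x)%:E <= c)%E.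
Proof.
move=> mf f0 cvf fc.
have := @fatou _ _ _ mu setT measurableT (fun n x => (f_ n x)%:E) (fun n => (measurable_EFinP _ _).2 (mf n)) _.
have -> : (\int[mu]_x limn_einf (fun n => (f_ n x)%:E) = \int[mu]_x (f x)%:E)%E.
  apply: eq_integral => x _; apply: (cvg_limn_einf_sup _).1.
  by apply: cvg_EFin; [near=> n|exact: cvf].
move=> H; apply: le_trans; first by apply: H => n x _; rewrite lee_fin.
rewrite leNgt; apply/negP => /limn_einf_gt_near [N _ /(_ N)/= /(_ (leqnn _))].
by rewrite ltNge fc.
Unshelve. all: by end_near. Qed.
End fatou.

Lemma measurable_normr_powR d (T : measurableType d) (R : realType) (D : set T)
    (f : T -> R) (q : R) :
  measurable_fun D f -> measurable_fun D (fun x => `|f x| `^ q).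
Proof.
move=> mf; apply: (measurableT_comp (measurable_powR q)).
exact: measurableT_comp.
Qed.

(** * The fractional Sobolev inequality *)

Section sobolev.
Context d (T : measurableType d) (R : realType)
  (L : {sigma_finite_measure set T -> \bar R}).
Variables (K : T * T -> R) (V : T -> R -> set T) (p s Q c : R).
Local Notation L2 := (L \x L)%E.
Hypothesis K_ge0 : forall z, 0 <= K z.
Hypothesis mK : measurable_fun setT K.
Hypothesis c_gt0 : 0 < c.
Hypothesis mV : forall x t, 0 < t -> measurable (V x t).
Hypothesis L_V : forall x t, 0 < t -> L (V x t) = (c * t `^ Q)%:E.
Hypothesis V_center : forall x t, 0 < t -> V x t x.
Hypothesis K_V : forall x t a b, 0 < t -> V x t a -> V x t b ->
  a = b \/ 1 <= t `^ (Q + p * s) * K (a, b).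
Hypothesis p_ge2 : 2 <= p.
Hypothesis s_gt0 : 0 < s.
Hypothesis ps_ltQ : p * s < Q.

Definition gagliardo_energy (u : T -> R) : \bar R :=
  (\int[L2]_z (`|u z.1 - u z.2| `^ p * K z)%:E)%E.

Local Notation E := gagliardo_energy.
Local Notation r := (p * Q / (Q - p * s)).

Lemma measurable_gagliardo (u : T -> R) : measurable_fun setT u ->
  measurable_fun setT (fun z : T * T => `|u z.1 - u z.2| `^ p * K z).
Proof.
move=> mu; apply: measurable_funM => //.
apply: measurable_normr_powR.
by apply: measurable_funB; apply: (measurableT_comp mu).
Qed.

(** It measures the oscillation of u around the point x. *)
Definition gagliardo_slice (u : T -> R) (x : T) : \bar R :=
  (\int[L]_y (`|u x - u y| `^ p * K (x, y))%:E)%E.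

Lemma gagliardo_energyE u : measurable_fun setT u ->
  E u = (\int[L]_x gagliardo_slice u x)%E.
Proof.
move=> mu; rewrite /E fubini_tonelli1//.
  by apply/measurable_EFinP; exact: measurable_gagliardo.
by move=> z; rewrite lee_fin mulr_ge0 ?powR_ge0.
Qed.

Lemma measurable_gagliardo_slice u : measurable_fun setT u ->
  measurable_fun setT (gagliardo_slice u).
Proof.
move=> mu.
apply: (@measurable_fun_fubini_tonelli_F _ _ _ _ _ _
  (fun z => (`|u z.1 - u z.2| `^ p * K z)%:E)).
  by apply/measurable_EFinP; exact: measurable_gagliardo.
by move=> z; rewrite lee_fin mulr_ge0 ?powR_ge0.
Qed.

Lemma gagliardo_slice_ge0 u x : (0 <= gagliardo_slice u x)%E.
Proof.
by apply: integral_ge0 => y _; rewrite lee_fin mulr_ge0 ?powR_ge0.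
Qed.

(** The last identity is the scaling relation that characterizes the critical exponent r. *)
Lemma critical_exponent_facts : [/\ 0 < p, 0 < Q, p < r & p + r * (p * s / Q) = r].
Proof.
have p0 : 0 < p by move: p_ge2; lra.
have ps0 : 0 < p * s by rewrite mulr_gt0.
have Q0 : 0 < Q by apply: lt_trans ps_ltQ.
have Qps : 0 < Q - p * s by rewrite subr_gt0.
split => //.
- by rewrite ltr_pdivlMr// mulrBr ltrBlDr ltrDl mulr_gt0.
- field; by rewrite !gt_eqF.
Qed.

(** Let t = |u x|, and choose the radius rho such that V x rho has measure 2 * 2 ^ r * M /
    t ^ r. By Chebyshev's inequality |u| exceeds t / 2 on at most half of V x rho. On the
    other half |u x - u y| >= t / 2, and the kernel is at least rho ^ - (Q + p s) there,
    so that the slice at x is at least (t / 2) ^ p * rho ^ - (Q + p s) * c * rho ^ Q / 2.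
    Inserting rho gives the claim, the powers of t adding up to r by the scaling relation. *)
Lemma sobolev_pointwise : exists2 C : R, 0 < C &
  forall (u : T -> R) (M : R), measurable_fun setT u -> 0 < M ->
  (\int[L]_x (`|u x| `^ r)%:E <= M%:E)%E ->
  forall x, ((`|u x| `^ r)%:E <= (C * M `^ (p * s / Q))%:E * gagliardo_slice u x)%E.
Proof.
have [p0 Q0 pr rE] := critical_exponent_facts; have r0 := lt_trans p0 pr.
have [k k0 kE] : exists2 k, 0 < k & k = 2 * 2 `^ r / c.
  by exists (2 * 2 `^ r / c); rewrite ?divr_gt0// mulr_gt0// powR_gt0.
exists (2 * 2 `^ p / c * k `^ (p * s / Q)).
  by rewrite !mulr_gt0 ?invr_gt0 ?powR_gt0.
move=> u M mu M0 uM x; set C := _ * k `^ _.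
have C0 : 0 < C by rewrite !mulr_gt0 ?invr_gt0 ?powR_gt0.
have [ux0|] := eqVneq (u x) 0.
  by rewrite ux0 normr0 powR0 ?gt_eqF// mule_ge0 ?lee_fin ?gagliardo_slice_ge0// mulr_ge0 ?powR_ge0// ltW.
rewrite -normr_gt0; set t := `|u x| => t0.
have halfE a : (t / 2) `^ a = t `^ a / 2 `^ a.
  rewrite powRM ?(ltW t0)//; congr (_ * _).
  by rewrite -[X in X `^ a]powR_inv1// -powRrM mulN1r powRN.
(* The radius at which L (V x rho) = c * k * M / t ^ r, where c * k = 2 * 2 ^ r. *)
pose rho := (k * M / t `^ r) `^ Q^-1.
have tr0 : 0 < t `^ r by rewrite powR_gt0.
have rhoQ : rho `^ Q = k * M / t `^ r.
  rewrite /rho -powRrM mulVf ?gt_eqF// powRr1//.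
  by apply: divr_ge0; [apply: mulr_ge0; exact: ltW|exact: ltW].
have rho0 : 0 < rho by rewrite powR_gt0// divr_gt0// mulr_gt0.
pose B := V x rho `&` [set y | t / 2 < `|u y|].
have mnu : measurable_fun setT (fun y => `|u y|) by exact: measurableT_comp.
have mB' : measurable [set y | t / 2 < `|u y|].
  rewrite -[X in measurable X]setTI.
  have -> : [set y | t / 2 < `|u y|] = (fun y => `|u y|) @^-1` `]t / 2, +oo[.
    by apply/seteqP; split => y /=; rewrite in_itv/= andbT.
  exact: mnu.
have mB : measurable B by apply: measurableI => //; exact: mV.
pose A := V x rho `\` [set y | t / 2 < `|u y|].
have mA : measurable A by apply: measurableD => //; exact: mV.
have th0 : 0 < t / 2 by rewrite divr_gt0.
have LB : (L B <= (c * rho `^ Q / 2)%:E)%E.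
  have H : (((t / 2) `^ r)%:E * L B <= M%:E)%E.
    apply: le_trans uM; rewrite -integral_cst//.
    apply: (@le_trans _ _ (\int[L]_(x in B) (`|u x| `^ r)%:E)%E).
      apply: ge0_le_integral => //.
      - by move=> y _; rewrite lee_fin powR_ge0.
      - apply/measurable_EFinP; apply: (@measurable_funS _ _ _ _ setT) => //.
        exact: measurable_normr_powR.
      - by move=> y [_ /= ty]; rewrite lee_fin le_powR2// ltW.
    apply: ge0_subset_integral => //.
    by apply/measurable_EFinP; exact: measurable_normr_powR.
  rewrite -(@lee_pmul2l _ ((t / 2) `^ r)%:E) ?fin_numE ?lte_fin ?powR_gt0//.
  apply: (le_trans H); rewrite -EFinM lee_fin rhoQ kE.
  rewrite halfE le_eqVlt; apply/orP; left; apply/eqP; field.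
  by rewrite !gt_eqF ?powR_gt0.
have LA : ((c * rho `^ Q / 2)%:E <= L A)%E.
  have : (L (V x rho) <= L A + L B)%E.
    rewrite (_ : V x rho = A `|` B); first exact: measureU2.
    by rewrite /A /B setUC setUIDK.
  rewrite L_V// => H; have {H} := le_trans H (leeD2l _ LB).
  rewrite -leeBlDr// -EFinB; apply: le_trans.
  by rewrite lee_fin; lra.
have gA : (((t / 2) `^ p * (rho `^ (Q + p * s))^-1)%:E * L A <= gagliardo_slice u x)%E.
  rewrite -integral_cst//.
  have mg : measurable_fun setT (fun y => (`|u x - u y| `^ p * K (x, y))%:E).
    apply/measurable_EFinP.
    exact: (measurableT_comp (measurable_gagliardo mu) (pair1_measurable x)).
  have g0 y : (0 <= (`|u x - u y| `^ p * K (x, y))%:E)%E.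
    by rewrite lee_fin mulr_ge0 ?powR_ge0.
  apply: (@le_trans _ _ (\int[L]_(y in A) (`|u x - u y| `^ p * K (x, y))%:E)%E).
    apply: ge0_le_integral => //.
    - by move=> y _; rewrite lee_fin mulr_ge0 ?invr_ge0 ?powR_ge0.
    - exact: measurable_funS mg.
    - move=> y [Vy /= /negP]; rewrite -leNgt => uy; rewrite lee_fin.
      have dxy : t / 2 <= `|u x - u y|.
        have := lerB_dist (u x) (u y); rewrite -/t; lra.
      apply: ler_pM; rewrite ?invr_ge0 ?powR_ge0// ?le_powR2// ?(ltW th0) ?(ltW p0)//.
      have [xy|] := K_V rho0 (V_center x rho0) Vy.
        by move: dxy; rewrite xy subrr normr0 leNgt th0.
      by move=> K1; rewrite -[leLHS]mulr1 ler_pdivrMl// powR_gt0.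
  exact: ge0_subset_integral.
apply: (@le_trans _ _ ((C * M `^ (p * s / Q))%:E *
    (((t / 2) `^ p * (rho `^ (Q + p * s))^-1)%:E * (c * rho `^ Q / 2)%:E))%E); last first.
  apply: lee_wpmul2l; first by rewrite lee_fin mulr_ge0 ?powR_ge0// ltW.
  apply: le_trans gA; apply: lee_wpmul2l => //.
  by rewrite lee_fin mulr_ge0 ?invr_ge0 ?powR_ge0.
rewrite -!EFinM lee_fin.
rewrite (gt0_powRD _ _ rho0) halfE.
have rps : rho `^ (p * s) = k `^ (p * s / Q) * M `^ (p * s / Q) / t `^ (r * (p * s / Q)).
  rewrite [in LHS](_ : p * s = Q * (p * s / Q)); last by field; rewrite gt_eqF.
  rewrite powRrM rhoQ powRM ?divr_ge0 ?invr_ge0 ?mulr_ge0 ?(ltW k0) ?(ltW M0) ?(ltW tr0)//.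
  rewrite powRM ?(ltW k0) ?(ltW M0)//; congr (_ * _).
  by rewrite -[_^-1]powR_inv1 ?(ltW tr0)// -powRrM mulN1r powRN -powRrM.
rewrite rps /C -[in leLHS]rE (gt0_powRD _ _ t0).
rewrite le_eqVlt; apply/orP; left; apply/eqP; field.
have nz (x0 y0 : R) : 0 < x0 -> x0 `^ y0 != 0 by move=> ?; rewrite gt_eqF ?powR_gt0.
by rewrite !nz//= gt_eqF.
Qed.

(** Integrating the pointwise bound gives M <= C * M ^ (p s / Q) * e for the integral M of
    |u| ^ r. Since 1 - p s / Q = p / r is positive, the power of M on the right can be
    absorbed as soon as M is finite. *)
Lemma sobolev_a_priori : exists2 S : R, 0 < S &
  forall (u : T -> R) (e : R), measurable_fun setT u -> 0 <= e ->
  (\int[L]_x (`|u x| `^ r)%:E < +oo)%E -> (E u <= e%:E)%E ->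
  (\int[L]_x (`|u x| `^ r)%:E <= (S * e `^ (r / p))%:E)%E.
Proof.
have [p0 Q0 pr rE] := critical_exponent_facts; have r0 := lt_trans p0 pr.
have [C C0 HC] := sobolev_pointwise.
exists (C `^ (r / p)); first exact: powR_gt0.
move=> u e mu e0 ufin Ee.
have mur : measurable_fun setT (fun x => (`|u x| `^ r)%:E).
  by apply/measurable_EFinP; exact: measurable_normr_powR.
have I0 : (0 <= \int[L]_x (`|u x| `^ r)%:E)%E.
  by apply: integral_ge0 => x _; rewrite lee_fin powR_ge0.
have [M ME] : exists M : R, (\int[L]_x (`|u x| `^ r)%:E = M%:E)%E.
  by exists (fine (\int[L]_x (`|u x| `^ r)%:E)%E); rewrite fineK// ge0_fin_numE.
rewrite ME lee_fin; rewrite ME lee_fin in I0.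
move: I0; rewrite le_eqVlt => /predU1P[<-|M0]; first by rewrite mulr_ge0 ?powR_ge0.
have /(_ u M mu M0) := HC; rewrite ME lexx => /(_ isT) ptw.
have C' : 0 <= C * M `^ (p * s / Q) by rewrite mulr_ge0 ?powR_ge0// ltW.
have : (M%:E <= (C * M `^ (p * s / Q))%:E * E u)%E.
  rewrite -ME gagliardo_energyE// -ge0_integralZl_EFin//; last 2 first.
    by move=> x _; exact: gagliardo_slice_ge0.
    exact: measurable_gagliardo_slice.
  apply: ge0_le_integral => //.
  by apply: measurable_funeM; exact: measurable_gagliardo_slice.
move=> /le_trans/(_ (lee_wpmul2l _ Ee)); rewrite lee_fin => /(_ C').
rewrite -EFinM lee_fin => MCe.
(* Division by M ^ (p s / Q), which is possible as M is finite and positive. *)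
have M1 : M `^ (p / r) <= C * e.
  have -> : p / r = 1 - p * s / Q by field; rewrite !gt_eqF// subr_gt0.
  rewrite gt0_powRD// powRr1 ?(ltW M0)// powRN ler_pdivrMr ?powR_gt0//.
  by move: MCe; rewrite mulrAC.
have -> : M = (M `^ (p / r)) `^ (r / p).
  rewrite -powRrM (_ : p / r * (r / p) = 1) ?powRr1 ?(ltW M0)//.
  by rewrite mulrA divfK ?divff// gt_eqF.
rewrite -powRM ?(ltW C0)//; apply: le_powR2 => //.
- by rewrite divr_ge0// ltW.
- exact: powR_ge0.
Qed.

(** The truncations min (|u|, n) have finite r-th powers because u is in L^p and p < r,
    and truncating does not increase the energy. The a priori bound for them passes to the
    limit by Fatou's lemma. *)
Lemma sobolev_inequality : exists2 S : R, 0 < S &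
  forall (u : T -> R) (e : R), measurable_fun setT u -> 0 <= e ->
  (\int[L]_x (`|u x| `^ p)%:E < +oo)%E -> (E u <= e%:E)%E ->
  (\int[L]_x (`|u x| `^ r)%:E <= (S * e `^ (r / p))%:E)%E.
Proof.
have [p0 Q0 pr rE] := critical_exponent_facts; have r0 := lt_trans p0 pr.
have [S S0 HS] := sobolev_a_priori; exists S => // u e mu e0 uLp Ee.
pose v (n : nat) x := Num.min `|u x| n%:R.
have v0 n x : 0 <= v n x by rewrite le_min normr_ge0 ler0n.
have mv n : measurable_fun setT (v n).
  by apply: measurable_minr => //; exact: measurableT_comp.
apply: (@fatou_le _ _ _ _ (fun n x => `|v n x| `^ r)).
- by move=> n; exact: measurable_normr_powR.
- by move=> n x; exact: powR_ge0.
- move=> x; apply: cvg_near_cst.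
  near=> n; rewrite /v min_l ?normr_id//; near: n.
  exact: nbhs_infty_ger.
move=> n; apply: (HS (v n) e (mv n) e0).
- have mnp : measurable_fun setT (fun x => (`|u x| `^ p)%:E).
    by apply/measurable_EFinP; exact: measurable_normr_powR.
  apply: (@le_lt_trans _ _ (\int[L]_x ((n%:R `^ (r - p))%:E * (`|u x| `^ p)%:E))%E).
    apply: ge0_le_integral => //.
    + by apply/measurable_EFinP; exact: measurable_normr_powR.
    + by apply: measurable_funeM.
    + move=> x _; rewrite -EFinM lee_fin ger0_norm//.
      have [->|] := eqVneq (v n x) 0; first by rewrite powR0 ?gt_eqF// mulr_ge0 ?powR_ge0.
      move=> vn0; have {}vn0 : 0 < v n x by rewrite lt0r vn0 v0.
      rewrite -[in leLHS](subrK p r) gt0_powRD// ler_pM ?powR_ge0//.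
        by rewrite le_powR2 ?subr_ge0 ?(ltW pr)// ge_min lexx orbT.
      by rewrite le_powR2 ?(ltW p0)// ge_min lexx.
  rewrite ge0_integralZl_EFin ?powR_ge0//.
  by rewrite lte_mul_pinfty// ?lee_fin ?powR_ge0.
- apply: le_trans Ee; apply: ge0_le_integral => //.
  + by move=> x _; rewrite lee_fin mulr_ge0 ?powR_ge0.
  + by apply/measurable_EFinP; exact: measurable_gagliardo.
  + by apply/measurable_EFinP; exact: measurable_gagliardo.
  + move=> [x y] _ /=; rewrite lee_fin ler_wpM2r// le_powR2 ?(ltW p0)//.
    apply: (@le_trans _ _ `| `|u x| - `|u y| |); last exact: ler_dist_dist.
    rewrite /v; case: (leP `|u x| n%:R); case: (leP `|u y| n%:R) => h1 h2;
      rewrite ?subrr ?normr0//.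
    * move: h1 h2; move: `|u x| `|u y| n%:R => a b k h1 h2.
      by rewrite distrC [leRHS]distrC !ger0_norm; lra.
    * move: h1 h2; move: `|u x| `|u y| n%:R => a b k h1 h2.
      by rewrite !ger0_norm; lra.
Unshelve. all: by end_near. Qed.
End sobolev.

(** * Compactness of energy-bounded sequences *)

Section compactness.
Context d (T : measurableType d) (R : realType)
  (L : {sigma_finite_measure set T -> \bar R}).
Variables (K : T * T -> R) (V : T -> R -> set T) (p s Q c : R).
Local Notation L2 := (L \x L)%E.
Hypothesis K_ge0 : forall z, 0 <= K z.
Hypothesis mK : measurable_fun setT K.
Hypothesis c_gt0 : 0 < c.
Hypothesis mV : forall x (t : R), 0 < t -> measurable (V x t).
Hypothesis L_V : forall x (t : R), 0 < t -> L (V x t) = (c * t `^ Q)%:E.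
Hypothesis K_V : forall x (t : R) a b, 0 < t -> V x t a -> V x t b ->
  a = b \/ 1 <= t `^ (Q + p * s) * K (a, b).
Hypothesis p_ge2 : 2 <= p.
Hypothesis s_gt0 : 0 < s.
Local Notation E := (gagliardo_energy L K p).

Lemma gagliardo_energy_ge0 u : (0 <= E u)%E.
Proof. by apply: integral_ge0 => z _; rewrite lee_fin mulr_ge0 ?powR_ge0. Qed.

Lemma gagliardo_energyD_le (a : R) (u v : T -> R) : 0 < a ->
  measurable_fun setT u -> measurable_fun setT v ->
  (E (fun x => (u x + v x)%R) <= ((1 + a) `^ p)%:E * E u + ((1 + a^-1) `^ p)%:E * E v)%E.
Proof.
move=> a0 mu mv.
have mE (w : T -> R) : measurable_fun setT w ->
    measurable_fun setT (fun z : T * T => (`|w z.1 - w z.2| `^ p * K z)%:E).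
  by move=> mw; apply/measurable_EFinP; exact: measurable_gagliardo.
have E0 (w : T -> R) (z : T * T) : (0 <= (`|w z.1 - w z.2| `^ p * K z)%:E)%E.
  by rewrite lee_fin mulr_ge0 ?powR_ge0.
rewrite -!ge0_integralZl_EFin ?powR_ge0//; try exact: mE.
rewrite -ge0_integralD//; try (by apply: measurable_funeM; exact: mE);
  try by move=> z _; rewrite mule_ge0// lee_fin powR_ge0.
apply: ge0_le_integral => //.
- by move=> z _; exact: (E0 (fun x => u x + v x)).
- exact: (mE (fun x => u x + v x) (measurable_funD mu mv)).
- by apply: emeasurable_funD; apply: measurable_funeM; exact: mE.
- move=> z _; rewrite -!EFinM -EFinD lee_fin !mulrA -mulrDl ler_wpM2r//.
  rewrite (_ : _ - _ = (u z.1 - u z.2) + (v z.1 - v z.2)); last by ring.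
  by apply: normr_powRD_le => //; move: p_ge2; lra.
Qed.

Lemma gagliardo_energyN (u : T -> R) : E (fun x => - u x) = E u.
Proof.
by apply: eq_integral => z _; rewrite -opprD normrN.
Qed.

(** The difference between f x and the average of f over V y t is the average of f x - f
    z. For x and z in V y t the interpolation |f x - f z| <= e + e ^ (1 - p) * |f x - f z|
    ^ p has a right-hand side controlled by the kernel. All terms are multiplied by the
    measure of V y t. *)
Lemma average_deviation_le (f : T -> R) (e t : R) (x y : T) :
  measurable_fun setT f -> L.-integrable setT (EFin \o f) -> 0 < e -> 0 < t -> V y t x ->
  ((c * t `^ Q * `|f x|)%:E <= (e * (c * t `^ Q))%:E +
    (e `^ (1 - p) * t `^ (Q + p * s))%:E * gagliardo_slice L K p f x +
    `| \int[L]_(z in V y t) (f z)%:E |)%E.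
Proof.
move=> mf fi e0 t0 Vx; have mVy := mV y t0.
have fiV : L.-integrable (V y t) (EFin \o f) by apply: integrableS fi.
have LVoo : (L (V y t) < +oo)%E by rewrite L_V// ltry.
have ci (k : R) : L.-integrable (V y t) (EFin \o cst k).
  apply/integrableP; split; first exact/measurable_EFinP.
  by rewrite /= integral_cst// lte_mul_pinfty.
have df : L.-integrable (V y t) (EFin \o (fun z => f x - f z)).
  exact: (integrableB mVy (ci (f x)) fiV).
have fE : ((c * t `^ Q * f x)%:E =
    \int[L]_(z in V y t) (f x - f z)%:E + \int[L]_(z in V y t) (f z)%:E)%E.
  rewrite -(@integralD _ _ _ _ _ mVy _ _ df fiV).
  rewrite mulrC EFinM -(L_V y t0) -integral_cst//; apply: eq_integral => z _.
  by rewrite -EFinD /= subrK.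
have Q0 : 0 <= c * t `^ Q by rewrite mulr_ge0 ?powR_ge0// ltW.
rewrite -[in leLHS](ger0_norm Q0) -normrM -abse_EFin fE.
apply: (le_trans (lee_abs_add _ _)); apply: leeD => //.
apply: (le_trans (le_abse_integral _ mVy _)); first exact: measurable_int df.
have ms : measurable_fun setT (fun z => (`|f x - f z| `^ p * K (x, z))%:E).
  apply/measurable_EFinP.
  exact: (measurableT_comp (measurable_gagliardo p mK mf) (pair1_measurable x)).
have sl0 z : (0 <= (`|f x - f z| `^ p * K (x, z))%:E)%E.
  by rewrite lee_fin mulr_ge0 ?powR_ge0.
have k0 : 0 <= e `^ (1 - p) * t `^ (Q + p * s) by rewrite mulr_ge0 ?powR_ge0.
apply: (@le_trans _ _ (\int[L]_(z in V y t) (e%:E +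
    (e `^ (1 - p) * t `^ (Q + p * s))%:E * (`|f x - f z| `^ p * K (x, z))%:E))%E).
  apply: ge0_le_integral => //.
  - apply/measurable_EFinP; apply: measurableT_comp => //.
    by apply/measurable_EFinP; exact: measurable_int df.
  - apply: emeasurable_funD; first exact/measurable_EFinP.
    by apply: measurable_funeM; exact: measurable_funS ms.
  - move=> z Vz; rewrite -EFinM -EFinD lee_fin.
    have [->|K1] := K_V t0 Vx Vz.
      by rewrite subrr normr0 addr_ge0 ?mulr_ge0 ?powR_ge0// ltW.
    have := @powR_le_interpolation _ e 1 p `|f x - f z| e0 ler01.
    rewrite powRr1// powRr1 ?(ltW e0)// => H.
    apply: le_trans (H _ _) _ => //; first by move: p_ge2; lra.
    rewrite lerD2l -mulrA ler_wpM2l ?powR_ge0// mulrCA.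
    by rewrite -[leLHS]mulr1 ler_wpM2l ?powR_ge0.
rewrite ge0_integralD//; last 3 first.
- by move=> z _; rewrite lee_fin ltW.
- by move=> z _; rewrite mule_ge0.
- by apply: measurable_funeM; exact: measurable_funS ms.
have -> : (\int[L]_(_ in V y t) e%:E = (e * (c * t `^ Q))%:E)%E.
  by rewrite integral_cst// EFinM -(L_V y t0).
rewrite leeD// ge0_integralZl_EFin//; last exact: measurable_funS ms.
by apply: lee_wpmul2l => //; exact: ge0_subset_integral.
Qed.

Variable Omega : set T.
Hypothesis mOmega : measurable Omega.
Hypothesis Omega_fin : (L Omega < +oo)%E.
Hypothesis Omega_cover : forall t : R, 0 < t ->
  exists sq : seq T, forall x, Omega x -> exists2 y, y \in sq & V y t x.

(** Functions of bounded energy are determined in L^1(Omega), up to eps, by finitely many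
    averages: integrate `average_deviation_le` over Omega, choosing first the threshold e
    of that lemma, then the scale t, and last a finite cover of Omega by sets V y t. The
    power t ^ (p s) in front of the energy is what makes a small scale useful. *)
Lemma l1_le_averages (eps e : R) : 0 < eps -> 0 <= e ->
  exists2 t : R, 0 < t & exists sq : seq T, exists2 k : R, 0 <= k &
  forall f : T -> R, measurable_fun setT f -> L.-integrable setT (EFin \o f) ->
  (E f <= e%:E)%E ->
  (\int[L]_(x in Omega) `|f x|%:E <=
    (eps + k * \sum_(y <- sq) `|\int[L]_(z in V y t) f z|)%:E)%E.
Proof.
move=> eps0 e0; pose m := fine (L Omega).
have LOE : L Omega = m%:E by rewrite /m fineK// ge0_fin_numE.
have m0 : 0 <= m by rewrite /m fine_ge0.
have [del del0 delm] : exists2 del : R, 0 < del & del * m <= eps / 2.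
  exists (eps / 2 / (m + 1)); first by rewrite !divr_gt0// ltr_wpDl.
  rewrite mulrAC ler_pdivrMr ?ltr_wpDl// ler_wpM2l ?divr_ge0 ?(ltW eps0)//.
  by rewrite lerDl.
have ps0 : 0 < p * s by rewrite mulr_gt0// (lt_le_trans _ p_ge2).
have [t t0 te] : exists2 t : R, 0 < t & del `^ (1 - p) / c * t `^ (p * s) * e <= eps / 2.
  have X0 : 0 < del `^ (1 - p) / c by rewrite divr_gt0 ?powR_gt0.
  move: (del `^ (1 - p) / c) X0 => X X0; pose Y := eps / 2 / (X * (e + 1)).
  have Xe0 : 0 < X * (e + 1) by rewrite mulr_gt0// ltr_wpDl.
  have Y0 : 0 < Y by rewrite !divr_gt0.
  exists (Y `^ (p * s)^-1); first by rewrite powR_gt0.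
  rewrite -powRrM mulVf ?gt_eqF// powRr1 ?(ltW Y0)//.
  rewrite mulrAC mulrC (_ : eps / 2 = Y * (X * (e + 1))); last first.
    by rewrite /Y divfK// gt_eqF.
  by rewrite ler_wpM2l ?(ltW Y0)// ler_wpM2l ?(ltW X0)// lerDl.
exists t => //; have [sq cov] := Omega_cover t0; exists sq.
pose a := c * t `^ Q; have a0 : 0 < a by rewrite mulr_gt0 ?powR_gt0.
exists (a^-1 * m); first by rewrite mulr_ge0 ?invr_ge0// ltW.
move=> f mf fi Ef; set S := \sum_(y <- sq) _.
have S0 : 0 <= S by apply: sumr_ge0.
have msl := measurable_gagliardo_slice L p K_ge0 mK mf.
have sl0 := gagliardo_slice_ge0 L p K_ge0 f.
pose A := del `^ (1 - p) / c * t `^ (p * s).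
have A0 : 0 <= A by rewrite mulr_ge0 ?divr_ge0 ?powR_ge0// ltW.
have ptw x : Omega x -> (`|f x|%:E <= (del + a^-1 * S)%:E + A%:E * gagliardo_slice L K p f x)%E.
  move=> Ox; have [y ysq Vx] := cov x Ox.
  have := average_deviation_le mf fi del0 t0 Vx.
  have -> : (`| \int[L]_(z in V y t) (f z)%:E | = `|\int[L]_(z in V y t) f z|%:E)%E.
    rewrite -abse_EFin /Rintegral fineK//; apply: integrable_fin_num; first exact: mV.
    by apply: integrableS fi => //; exact: mV.
  have IS : `|\int[L]_(z in V y t) f z| <= S.
    rewrite /S (big_rem y)//= lerDl; exact: sumr_ge0.
  rewrite -/a => H.
  rewrite -(@lee_pmul2l _ a%:E)// muleDr//.
  have aE : (a * (del + a^-1 * S) = del * a + S)%R.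
    by field; rewrite gt_eqF.
  rewrite muleA -!EFinM aE; apply: (le_trans H).
  rewrite EFinD addeAC.
  have -> : (del `^ (1 - p) * t `^ (Q + p * s) = a * A)%R.
    by rewrite /a /A gt0_powRD//; field; rewrite gt_eqF.
  by rewrite leeD2r// leeD2l// lee_fin.
apply: (@le_trans _ _ (\int[L]_(x in Omega) ((del + a^-1 * S)%:E + A%:E * gagliardo_slice L K p f x))%E).
  apply: ge0_le_integral => //.
  - apply/measurable_EFinP; apply: measurableT_comp => //; exact: measurable_funS mf.
  - apply: emeasurable_funD; first exact/measurable_EFinP.
    by apply: measurable_funeM; exact: measurable_funS msl.
have dS0 : 0 <= del + a^-1 * S by rewrite addr_ge0 ?mulr_ge0 ?invr_ge0// ltW.
rewrite ge0_integralD//; try (by move=> x _; rewrite ?lee_fin ?mule_ge0);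
  last by apply: measurable_funeM; exact: measurable_funS msl.
have -> : (\int[L]_(_ in Omega) (del + a^-1 * S)%:E = ((del + a^-1 * S) * m)%:E)%E.
  by rewrite integral_cst// EFinM -LOE.
apply: (@le_trans _ _ (((del + a^-1 * S) * m)%:E + (A * e)%:E)%E).
  rewrite leeD2l// ge0_integralZl_EFin//; last exact: measurable_funS msl.
  rewrite (EFinM A e); apply: lee_wpmul2l => //; apply: le_trans Ef; rewrite gagliardo_energyE//.
  exact: ge0_subset_integral.
rewrite -EFinD lee_fin mulrDl; move: delm te; rewrite -/A.
rewrite [X in _ -> _ -> _ <= _ + X](_ : _ = a^-1 * S * m); last by ring.
lra.
Qed.
End compactness.

Lemma ultra_bounded_cauchy (R : realType) (I : Type) (U : set_system I) (a : I -> R) (B eta : R) :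
  UltraFilter U -> (forall i, `|a i| <= B) -> 0 < eta ->
  exists l, U [set i | `|a i - l| < eta].
Proof.
move=> UU aB eta0.
have := @segment_compact R (- B) B (fmap a U).
case.
  apply: (@filterS _ U _ setT); last exact: filterT.
  by move=> i _ /=; rewrite in_itv/= -ler_norml.
move=> l [_ cl]; exists l.
have [//|UC] := @in_ultra_setVsetC _ U [set i | `|a i - l| < eta] UU.
have UB : U (a @^-1` (~` ball l eta)).
  by apply: filterS UC => i /= H1 H2; apply: H1; rewrite /= distrC.
by have [x []] := cl _ _ UB (nbhsx_ballx l _ eta0).
Qed.

(** Along an ultrafilter every bounded real sequence converges, hence finitely many of
    them are simultaneously Cauchy. This replaces the successive extraction of
    subsequences. *)
Lemma ultra_seq_cauchy (R : realType) (I : Type) (S : eqType) (U : set_system I)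
    (a : S -> I -> R) (sq : seq S) (B eta : R) :
  UltraFilter U -> (forall y i, `|a y i| <= B) -> 0 < eta ->
  exists2 A, U A & forall i j, A i -> A j -> forall y, y \in sq -> `|a y i - a y j| < eta.
Proof.
move=> UU aB eta0; elim: sq => [|y sq [A UA HA]].
  by exists setT => //; exact: filterT.
have e20 : 0 < eta / 2 by rewrite divr_gt0.
have [l Ul] := ultra_bounded_cauchy UU (aB y) e20.
exists (A `&` [set i | `|a y i - l| < eta / 2]); first exact: filterI.
move=> i j [Ai /= li] [Aj lj] z; rewrite inE => /predU1P[->|zsq]; last exact: HA.
rewrite (_ : a y i - a y j = (a y i - l) - (a y j - l)); last by ring.
by rewrite (le_lt_trans (ler_normB _ _))// (splitr eta) ltrD.
Qed.

Lemma sumr_le_size (R : numDomainType) (S : eqType) (sq : seq S) (F : S -> R) (eta : R) :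
  (forall y, y \in sq -> F y <= eta) -> \sum_(y <- sq) F y <= (size sq)%:R * eta.
Proof.
elim: sq => [|y sq IH] H; first by rewrite big_nil mul0r.
rewrite big_cons/= -add1n natrD mulrDl mul1r lerD ?H ?mem_head//.
by apply: IH => z zsq; rewrite H// inE zsq orbT.
Qed.

Section extraction.
Context d (T : measurableType d) (R : realType)
  (L : {sigma_finite_measure set T -> \bar R}).
Variables (K : T * T -> R) (V : T -> R -> set T) (p s Q c : R).
Local Notation L2 := (L \x L)%E.
Hypothesis K_ge0 : forall z, 0 <= K z.
Hypothesis mK : measurable_fun setT K.
Hypothesis c_gt0 : 0 < c.
Hypothesis mV : forall x (t : R), 0 < t -> measurable (V x t).
Hypothesis L_V : forall x (t : R), 0 < t -> L (V x t) = (c * t `^ Q)%:E.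
Hypothesis K_V : forall x (t : R) a b, 0 < t -> V x t a -> V x t b ->
  a = b \/ 1 <= t `^ (Q + p * s) * K (a, b).
Hypothesis p_ge2 : 2 <= p.
Hypothesis s_gt0 : 0 < s.
Local Notation E := (gagliardo_energy L K p).
Variable Omega : set T.
Hypothesis mOmega : measurable Omega.
Hypothesis Omega_fin : (L Omega < +oo)%E.
Hypothesis Omega_cover : forall t : R, 0 < t ->
  exists sq : seq T, forall x, Omega x -> exists2 y, y \in sq & V y t x.

Lemma gagliardo_energyB_le (u v : T -> R) :
  measurable_fun setT u -> measurable_fun setT v ->
  (E (fun x => (u x - v x)%R) <= (2 `^ p)%:E * (E u + E v))%E.
Proof.
move=> mu mv; have mNv : measurable_fun setT (fun x => - v x) by exact: measurableT_comp.
have := @gagliardo_energyD_le _ _ _ L K p K_ge0 mK p_ge2 1 u _ ltr01 mu mNv.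
rewrite gagliardo_energyN invr1 => /le_trans; apply.
have E0 w : (0 <= E w)%E by exact: gagliardo_energy_ge0.
by rewrite (ge0_muleDr _ (E0 u) (E0 v)).
Qed.

(** Along an ultrafilter finer than the neighbourhoods of infinity, all the averages in
    `l1_le_averages` converge, so that the sequence is Cauchy in L^1(Omega). Choosing the
    k-th index in the sets of the ultrafilter that belong to the first k tolerances makes
    the increments summable. *)
Lemma l1_subsequence (u : nat -> T -> R) (e B : R) : 0 <= e ->
  (forall n, measurable_fun setT (u n)) ->
  (forall n, L.-integrable setT (EFin \o u n)) ->
  (forall n, (E (u n) <= e%:E)%E) ->
  (forall n, (\int[L]_x `|u n x|%:E <= B%:E)%E) ->
  exists f : nat -> nat, (forall k, (k <= f k)%N) /\
    forall k, (\int[L]_(x in Omega) `|u (f k.+1) x - u (f k) x|%:E <= (2^-1 ^+ k)%:E)%E.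
Proof.
move=> e0 mu iu Eu uB.
(* U is an ultrafilter that contains all the sets of almost all indices. *)
have [U [UU oU]] := @ultraFilterLemma nat \oo _.
have intB W n : measurable W -> `|\int[L]_(z in W) u n z| <= B.
  move=> mW; rewrite -lee_fin; apply: le_trans (uB n).
  have iW : L.-integrable W (EFin \o u n) by apply: integrableS (iu n).
  rewrite -abse_EFin /Rintegral fineK ?integrable_fin_num//.
  apply: (le_trans (le_abse_integral _ mW (measurable_int _ iW))).
  apply: ge0_subset_integral => //=.
  by apply/measurable_EFinP; exact: measurableT_comp.
have cauchy (eps : R) : 0 < eps -> exists2 A, U A & forall i j, A i -> A j ->
    (\int[L]_(x in Omega) `|u i x - u j x|%:E <= eps%:E)%E.
  move=> eps0; have e20 : 0 < eps / 2 by rewrite divr_gt0.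
  have e'0 : 0 <= 2 `^ p * (e + e) by rewrite mulr_ge0 ?powR_ge0// addr_ge0.
  have [t t0 [sq [k k0 H]]] := l1_le_averages K_ge0 mK c_gt0 mV L_V K_V p_ge2 s_gt0
    mOmega Omega_fin Omega_cover e20 e'0.
  pose eta := eps / 2 / (k * (size sq)%:R + 1).
  have den0 : 0 < k * (size sq)%:R + 1 by rewrite ltr_wpDl// mulr_ge0.
  have eta0 : 0 < eta by rewrite divr_gt0.
  have [A UA HA] := @ultra_seq_cauchy R nat T U (fun y i => \int[L]_(z in V y t) u i z)
    sq B eta UU (fun y i => intB _ _ (mV y t0)) eta0.
  exists A => // i j Ai Aj.
  have mij : measurable_fun setT (fun x => u i x - u j x) by exact: measurable_funB.
  have iij : L.-integrable setT (EFin \o (fun x => u i x - u j x)).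
    exact: (integrableB measurableT (iu i) (iu j)).
  apply: (le_trans (H _ mij iij _)).
    apply: (le_trans (gagliardo_energyB_le (mu i) (mu j))).
    by rewrite EFinM; apply: lee_wpmul2l; rewrite ?lee_fin ?powR_ge0// EFinD leeD.
  rewrite lee_fin [leRHS]splitr lerD2l.
  apply: (@le_trans _ _ (k * ((size sq)%:R * eta))).
    rewrite ler_wpM2l//; apply: sumr_le_size => y ysq.
    have iW n : L.-integrable (V y t) (EFin \o u n).
      by apply: integrableS (iu n) => //; exact: mV.
    rewrite RintegralB//; [|exact: mV].
    by rewrite ltW// HA.
  by rewrite /eta mulrA mulrA ler_pdivrMr// mulrC ler_wpM2l ?(ltW e20)// lerDl.
have /choice[A HA] : forall k, exists A, U A /\ forall i j, A i -> A j ->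
    (\int[L]_(x in Omega) `|u i x - u j x|%:E <= (2^-1 ^+ k)%:E)%E.
  move=> k; have h : 0 < 2^-1 ^+ k :> R by rewrite exprn_gt0.
  by have [A ? ?] := cauchy _ h; exists A.
have inter k : U [set n | forall j, (j <= k)%N -> A j n].
  elim: k => [|k IH].
    by apply: filterS (HA 0%N).1 => n A0 j; rewrite leqn0 => /eqP ->.
  apply: filterS (filterI IH (HA k.+1).1) => n [H1 H2] j.
  by rewrite leq_eqVlt => /predU1P[->//|]; rewrite ltnS; exact: H1.
have /choice[f Hf] : forall k, exists n, (k <= n)%N /\ forall j, (j <= k)%N -> A j n.
  move=> k; have Uk : U [set n | (k <= n)%N] by apply: oU; exact: nbhs_infty_ge.
  have /(@filter_ex _ U _)[n [? ?]] : U ([set n | (k <= n)%N] `&`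
      [set n | forall j, (j <= k)%N -> A j n]) by exact: filterI.
  by exists n.
exists f; split => [k|k]; first exact: (Hf k).1.
by apply: (HA k).2; [apply: (Hf k.+1).2|apply: (Hf k).2].
Qed.
End extraction.

Section ae_convergence.
Context d (T : measurableType d) (R : realType) (L : {measure set T -> \bar R}).

(** The sum of the absolute increments is integrable over Omega, hence finite almost
    everywhere. *)
Lemma ae_cvg_of_fast_cauchy (Omega : set T) (w : nat -> T -> R) : measurable Omega ->
  (forall k, measurable_fun setT (w k)) ->
  (forall k, (\int[L]_(x in Omega) `|w k.+1 x - w k x|%:E <= (2^-1 ^+ k)%:E)%E) ->
  exists D, [/\ measurable D, D `<=` Omega, L (Omega `\` D) = 0%E &
    forall x, D x -> cvgn (w ^~ x)].
Proof.
move=> mO mw wI.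
pose g k x := `|w k.+1 x - w k x|%:E.
have mg k : measurable_fun Omega (g k).
  apply/measurable_EFinP; apply: measurableT_comp => //.
  by apply: measurable_funB; apply: (@measurable_funS _ _ _ _ setT).
have g0 k x : Omega x -> (0 <= g k x)%E by move=> _; rewrite lee_fin.
(* The total variation of the sequence w at x. *)
pose S x := (\sum_(k <oo) g k x)%E.
have S0 x : Omega x -> (0 <= S x)%E.
  by move=> Ox; apply: nneseries_ge0 => k _ _; exact: g0.
have mS : measurable_fun Omega S.
  apply: (@emeasurable_fun_cvg _ _ _ _ (fun n x => \sum_(0 <= k < n) g k x)%E).
    by move=> n; exact: emeasurable_sum.
  by move=> x Ox; apply: is_cvg_nneseries => k _ _; exact: g0.
have iS : L.-integrable Omega S.
  apply/integrableP; split => //.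
  rewrite (_ : (\int[L]_(x in Omega) `|S x| = \int[L]_(x in Omega) S x)%E); last first.
    by apply: eq_integral => x /set_mem Ox; rewrite gee0_abs// S0.
  rewrite integral_nneseries//.
  apply: (@le_lt_trans _ _ (\sum_(k <oo) (2^-1 ^+ k)%:E)%E).
    apply: lee_nneseries => [k _ _|k _]; last by move=> *; exact: wI.
    by apply: integral_ge0 => x Ox; exact: g0.
  have : eseries (fun k => (2^-1 ^+ k : R)%:E) @ \oo --> (1 * (1 - 2^-1)^-1 : R)%:E.
    apply: cvg_EFin; first by near=> n; rewrite /eseries/= sumEFin.
    have h1 : `|2^-1 : R| < 1 by rewrite ger0_norm// invf_lt1// ltr1n.
    have := @cvg_geometric_series R 1 2^-1 h1.
    apply: cvg_trans; apply: near_eq_cvg; near=> n.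
    rewrite /series/eseries/= sumEFin/=.
    by apply: eq_bigr => k _; rewrite mul1r.
  by move=> /cvg_lim -> //; rewrite ltry.
have [N [mN N0 HN]] := integrable_ae mO iS.
exists (Omega `\` N); split.
- exact: measurableD.
- by move=> x [].
- rewrite setDD; apply/eqP; rewrite eq_le measure_ge0 andbT -N0.
  by apply: le_measure; rewrite ?inE//; exact: measurableI.
- move=> x [Ox Nx].
  have Sx : S x \is a fin_num.
    by apply: contrapT => h; apply: Nx; apply: HN => /(_ Ox).
  have H : cvgn (series (telescope (w ^~ x))).
    apply: normed_cvg; apply: nondecreasing_is_cvgn.
      apply/nondecreasing_seqP => n; rewrite /normed_series_of/series/=.
      by rewrite big_nat_recr//= lerDl.
    exists (fine (S x)) => _ [n _ <-].
    rewrite -lee_fin fineK// /normed_series_of/series/= -sumEFin.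
    by apply: nneseries_lim_ge => k _ _; exact: g0.
  move: H; rewrite telescopeK => H.
  rewrite (_ : w ^~ x = (fun n => w n x - w 0%N x) \+ cst (w 0%N x)); last first.
    by apply/funext => n; rewrite /= subrK.
  by apply: is_cvgD => //; exact: is_cvg_cst.
Unshelve. all: by end_near. Qed.

(** Cutting the sequence off outside the set of convergence makes it converge at every
    point, so that no exceptional set has to be carried along. *)
Lemma cvg_restrict_lim (D : set T) (w : nat -> T -> R) : measurable D ->
  (forall k, measurable_fun setT (w k)) -> (forall x, D x -> cvgn (w ^~ x)) ->
  exists2 v : T -> R, measurable_fun setT v &
    forall x, (w k \_ D) x @[k --> \oo] --> v x.
Proof.
move=> mD mw cw.
pose v x := limn (fun k => (w k \_ D) x).
have H x : (w k \_ D) x @[k --> \oo] --> v x.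
  rewrite /v; under eq_fun do rewrite patchE.
  have [xD|xD] := boolP (x \in D); last exact: is_cvg_cst.
  by apply: cw; exact: set_mem.
exists v => //; apply: (@measurable_fun_cvg _ _ _ _ (fun k => w k \_ D)) => // k.
apply/(@measurable_restrictT _ _ _ _ D) => //; exact: (@measurable_funS _ _ _ _ setT).
Qed.
End ae_convergence.

(** * The function space *)

Section continuity.
Variable R : realType.

Lemma continuous_normr_powR (r : R) : 2 <= r -> continuous (fun t : R => `|t| `^ r).
Proof.
move=> r2 x; apply: differentiable_continuous; apply/derivable1_diffP.
exact: (@ex_derive _ _ _ _ _ _ _ (is_derive_normr_powR x r2)).
Qed.

Lemma cvg_normr_powR (r : R) (u : nat -> R) (l : R) : 2 <= r ->
  u @ \oo --> l -> `|u n| `^ r @[n --> \oo] --> `|l| `^ r.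
Proof.
move=> r2 ul; apply: (@continuous_cvg _ _ _ _ _ u (fun t : R => `|t| `^ r)) => //.
exact: continuous_normr_powR.
Qed.
End continuity.

Section function_space.
Context d (T : measurableType d) (R : realType)
  (L : {sigma_finite_measure set T -> \bar R}).
Variables (K : T * T -> R) (p : R) (Omega : set T).
Local Notation L2 := (L \x L)%E.
Hypothesis K_ge0 : forall z, 0 <= K z.
Hypothesis mK : measurable_fun setT K.
Hypothesis p_ge2 : 2 <= p.
Hypothesis mOmega : measurable Omega.
Local Notation E := (gagliardo_energy L K p).

(** The counterpart of X_0^(s,p)(Omega) for an abstract measure and an abstract kernel. *)
Record X0 (u : T -> R) : Prop := {
  X0_measurable : measurable_fun setT u;
  X0_Lp : (\int[L]_x (`|u x| `^ p)%:E < +oo)%E;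
  X0_energy : (E u < +oo)%E;
  X0_support : {ae L, forall x, ~ Omega x -> u x = 0} }.

Definition renergy (u : T -> R) : R := fine (E u).

Let p0 : 0 < p. Proof. by move: p_ge2; lra. Qed.

Lemma renergyE u : X0 u -> E u = (renergy u)%:E.
Proof.
move=> Xu; rewrite /renergy fineK// ge0_fin_numE; first exact: X0_energy Xu.
exact: gagliardo_energy_ge0.
Qed.

Lemma renergy_ge0 u : 0 <= renergy u.
Proof. by rewrite /renergy fine_ge0// gagliardo_energy_ge0. Qed.

Lemma integrable_energy u : X0 u ->
  L2.-integrable setT (fun z => (`|u z.1 - u z.2| `^ p * K z)%:E).
Proof.
move=> [mu _ Eu _]; apply/integrableP; split.
  by apply/measurable_EFinP; exact: measurable_gagliardo.
rewrite (eq_integral (fun z => (`|u z.1 - u z.2| `^ p * K z)%:E))// => z _.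
by rewrite gee0_abs// lee_fin mulr_ge0 ?powR_ge0.
Qed.

Lemma X0_0 : X0 (cst 0).
Proof.
split.
- exact: measurable_cst.
- rewrite integral0_eq// => x _; by rewrite normr0 powR0// gt_eqF.
- rewrite /E integral0_eq// => x _; by rewrite subrr normr0 powR0 ?mul0r// gt_eqF.
- exact: aeW.
Qed.

Lemma renergy0 : renergy (cst 0) = 0.
Proof.
rewrite /renergy /gagliardo_energy integral0_eq// => x _.
by rewrite subrr normr0 powR0 ?mul0r// gt_eqF.
Qed.

Lemma X0_D u v : X0 u -> X0 v -> X0 (fun x => u x + v x).
Proof.
move=> [mu up Eu su] [mv vp Ev sv]; split.
- exact: measurable_funD.
- have mp (w : T -> R) : measurable_fun setT w ->
      measurable_fun setT (fun x => (`|w x| `^ p)%:E).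
    by move=> mw; apply/measurable_EFinP; exact: measurable_normr_powR.
  apply: (@le_lt_trans _ _ (\int[L]_x ((2 `^ p)%:E * (`|u x| `^ p)%:E + (2 `^ p)%:E * (`|v x| `^ p)%:E))%E).
    apply: ge0_le_integral => //.
    + exact: (mp (fun x => u x + v x) (measurable_funD mu mv)).
    + by apply: emeasurable_funD; apply: measurable_funeM; exact: mp.
    + move=> x _; rewrite -!EFinM -EFinD -mulrDr lee_fin.
      by apply: normr_powRD_le2; exact: ltW.
  rewrite ge0_integralD//; try (by move=> x _; rewrite mule_ge0// lee_fin powR_ge0);
    try (by apply: measurable_funeM; exact: mp).
  rewrite !ge0_integralZl_EFin ?powR_ge0//; try exact: mp.
  apply: lte_add_pinfty; (apply: lte_mul_pinfty; [by rewrite lee_fin powR_ge0|by []|]);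
    [exact: up|exact: vp].
- apply: (le_lt_trans (gagliardo_energyD_le L K_ge0 mK p_ge2 ltr01 mu mv)).
  apply: lte_add_pinfty; (apply: lte_mul_pinfty; [by rewrite lee_fin powR_ge0|by []|]);
    [exact: Eu|exact: Ev].
- by apply: filterS2 su sv => x su sv nO; rewrite su// sv// addr0.
Qed.

Lemma energyZ (a : R) u : measurable_fun setT u ->
  E (fun x => (a * u x)%R) = ((`|a| `^ p)%:E * E u)%E.
Proof.
move=> mu; rewrite /E -ge0_integralZl_EFin ?powR_ge0//.
- by apply: eq_integral => z _; rewrite -EFinM -mulrBr normrM powRM// mulrA.
- by move=> z _; rewrite lee_fin mulr_ge0 ?powR_ge0.
- by apply/measurable_EFinP; exact: measurable_gagliardo.
Qed.

Lemma X0_Z (a : R) u : X0 u -> X0 (fun x => a * u x).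
Proof.
move=> [mu up Eu su]; split.
- exact: measurable_funM.
- rewrite (eq_integral (fun x => (`|a| `^ p)%:E * (`|u x| `^ p)%:E)%E); last first.
    by move=> x _; rewrite -EFinM normrM powRM.
  rewrite ge0_integralZl_EFin ?powR_ge0//.
    by rewrite lte_mul_pinfty// lee_fin powR_ge0.
  by apply/measurable_EFinP; exact: measurable_normr_powR.
- by rewrite energyZ// lte_mul_pinfty// lee_fin powR_ge0.
- by apply: filterS su => x su nO; rewrite su// mulr0.
Qed.

Lemma X0_N u : X0 u -> X0 (fun x => - u x).
Proof. by move=> /(X0_Z (-1)); under eq_fun do rewrite mulN1r. Qed.

Lemma X0_B u v : X0 u -> X0 v -> X0 (fun x => u x - v x).
Proof. by move=> Xu /X0_N; exact: X0_D. Qed.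

Lemma renergyB_le u v : X0 u -> X0 v ->
  renergy (fun x => u x - v x) <= 2 `^ p * (renergy u + renergy v).
Proof.
move=> Xu Xv; rewrite -lee_fin -renergyE; last exact: X0_B.
apply: (le_trans (gagliardo_energyB_le L K_ge0 mK p_ge2 (X0_measurable Xu) (X0_measurable Xv))).
by rewrite !renergyE// -EFinD -EFinM.
Qed.

(** If the property fails only on the null set N, then it fails for one of the two
    components only on the union of N x T and T x N. *)
Lemma ae_prod (P : T -> Prop) : {ae L, forall x, P x} ->
  {ae L2, forall z, P z.1 /\ P z.2}.
Proof.
move=> [N [mN N0 HN]].
exists (N `*` setT `|` setT `*` N); split.
- by apply: measurableU; exact: measurableX.
- apply/eqP; rewrite eq_le measure_ge0 andbT.
  have -> : 0%E = (L2 (N `*` setT) + L2 (setT `*` N))%E.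
    rewrite !product_measure1E//.
    transitivity (0 * L setT + L setT * 0)%E; first by rewrite mul0e mule0 add0e.
    by congr (_ * _ + _ * _)%E; exact: esym N0.
  by apply: measureU2; exact: measurableX.
- move=> [x y] /= H; have [Nx|nNx] := pselect (N x); first by left.
  have Px : P x by apply: contrapT => nPx; apply: nNx; exact: HN.
  by right; split => //; apply: (HN) => Py; apply: H.
Qed.

Lemma ae_eq_energy u v : measurable_fun setT u -> measurable_fun setT v ->
  {ae L, forall x, u x = v x} -> E u = E v.
Proof.
move=> mu mv uv; apply: ae_eq_integral => //.
- by apply/measurable_EFinP; exact: measurable_gagliardo.
- by apply/measurable_EFinP; exact: measurable_gagliardo.
- by apply: filterS (ae_prod uv) => z [/= -> ->].
Qed.

Lemma X0_ae_eq u v : measurable_fun setT v -> {ae L, forall x, u x = v x} -> X0 u -> X0 v.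
Proof.
move=> mv uv [mu up Eu su]; split; first exact: mv.
- rewrite (ae_eq_integral (fun x => (`|u x| `^ p)%:E))//.
  + by apply/measurable_EFinP; exact: measurable_normr_powR.
  + by apply/measurable_EFinP; exact: measurable_normr_powR.
  + by apply: filterS uv => x ->.
- by rewrite -(ae_eq_energy mu mv uv).
- by apply: filterS2 uv su => x -> su.
Qed.

Lemma X0_restrict_ae u D : measurable D -> D `<=` Omega -> L (Omega `\` D) = 0%E -> X0 u ->
  measurable_fun setT (u \_ D) /\ {ae L, forall x, u x = (u \_ D) x}.
Proof.
move=> mD DO LD [mu _ _ su]; split.
  by apply/(@measurable_restrictT _ _ _ _ D) => //; exact: (@measurable_funS _ _ _ _ setT).
have aeD : {ae L, forall x, ~ (Omega `\` D) x}.
  exists (Omega `\` D); split => //; first exact: measurableD.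
  by move=> x /=; exact: contrapT.
apply: filterS2 su aeD => x su nD; rewrite patchE; case: ifPn => // /negP xD.
by apply: su => Ox; apply: nD; split => // Dx; apply: xD; exact: mem_set.
Qed.
End function_space.

(** * The functional along pointwise convergent sequences *)

Lemma le_integrable_real d (T : measurableType d) (R : realType)
    (mu : {measure set T -> \bar R}) (D : set T) (f g : T -> R) :
  measurable D -> measurable_fun D f -> mu.-integrable D (EFin \o g) ->
  (forall x, D x -> `|f x| <= g x) -> mu.-integrable D (EFin \o f).
Proof.
move=> mD mf ig fg; apply: le_integrable ig => //; first exact/measurable_EFinP.
by move=> x Dx /=; rewrite lee_fin (le_trans (fg x Dx))// ler_norm.
Qed.

Section growth.
Variable R : realType.

(** Both powers 1 and q are interpolated against the larger power r at a high threshold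
    del. The constant C depends only on the growth constants of g, so that it serves all
    the functions h x at once. *)
Lemma primitive_subcritical_growth (a1 a2 q r : R) : 0 < a1 -> 0 < a2 -> 1 <= q -> q < r ->
  forall eps : R, 0 < eps -> exists2 C : R, 0 <= C &
  forall g : R -> R, continuous g -> (forall t, `|g t| <= a1 + a2 * `|t| `^ (q - 1)) ->
  forall t, `|primitive g t| <= eps * `|t| `^ r + C.
Proof.
move=> a10 a20 q1 qr eps eps0.
have q0 : 0 < q by lra.
have a0 : 0 < a1 + a2 by rewrite addr_gt0.
have rq0 : 0 < r - q by rewrite subr_gt0.
pose del := Num.max 1 (((a1 + a2) / eps) `^ (r - q)^-1).
have del1 : 1 <= del by rewrite le_max lexx.
have del0 : 0 < del by lra.
have delq : (a1 + a2) * del `^ (q - r) <= eps.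
  have H : (a1 + a2) / eps <= del `^ (r - q).
    have -> : (a1 + a2) / eps = (((a1 + a2) / eps) `^ (r - q)^-1) `^ (r - q).
      by rewrite -powRrM mulVf ?gt_eqF// powRr1// divr_ge0// ltW.
    by apply: le_powR2; rewrite ?powR_ge0 ?(ltW rq0)// le_max lexx orbT.
  have -> : q - r = - (r - q) by rewrite opprB.
  by rewrite powRN ler_pdivrMr ?powR_gt0// mulrC -ler_pdivrMr.
exists (a1 * del + a2 * del `^ q).
  by rewrite addr_ge0 ?mulr_ge0 ?powR_ge0// ltW.
move=> g cg gb t.
have H : `|primitive g t| <= (a1 + a2 * `|t| `^ (q - 1)) * `|t|.
  apply: normr_primitive_le => // x xt; apply: (le_trans (gb x)).
  by rewrite lerD2l ler_wpM2l ?(ltW a20)// le_powR2 ?subr_ge0.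
apply: (le_trans H); rewrite mulrDl -mulrA [_ `^ _ * _]mulrC mulr_powRB1//.
have h1 := @powR_le_interpolation _ del 1 r `|t| del0 ler01 (ltW (le_lt_trans q1 qr)) (normr_ge0 t).
have h2 := @powR_le_interpolation _ del q r `|t| del0 (ltW q0) (ltW qr) (normr_ge0 t).
rewrite !powRr1 ?(ltW del0)// in h1.
have h3 : del `^ (1 - r) <= del `^ (q - r) by apply: ler_powR => //; lra.
apply: (@le_trans _ _ (a1 * (del + del `^ (q - r) * `|t| `^ r) +
    a2 * (del `^ q + del `^ (q - r) * `|t| `^ r))).
  apply: lerD; rewrite ler_wpM2l ?(ltW a10) ?(ltW a20)//.
  by apply: (le_trans h1); rewrite lerD2l ler_wpM2r ?powR_ge0.
have -> : a1 * (del + del `^ (q - r) * `|t| `^ r) + a2 * (del `^ q + del `^ (q - r) * `|t| `^ r) =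
   (a1 + a2) * del `^ (q - r) * `|t| `^ r + (a1 * del + a2 * del `^ q) by ring.
by rewrite lerD2r ler_wpM2r ?powR_ge0.
Qed.
End growth.

Section functional.
Context d (T : measurableType d) (R : realType)
  (L : {sigma_finite_measure set T -> \bar R}).
Variables (K : T * T -> R) (p r S : R) (Omega : set T) (h : T -> R -> R) (a1 a2 q : R).
Local Notation L2 := (L \x L)%E.
Hypothesis K_ge0 : forall z, 0 <= K z.
Hypothesis mK : measurable_fun setT K.
Hypothesis p_ge2 : 2 <= p.
Hypothesis p_lt_r : p < r.
Hypothesis mOmega : measurable Omega.
Hypothesis Omega_fin : (L Omega < +oo)%E.
Local Notation E := (gagliardo_energy L K p).
Local Notation A := (renergy L K p).
Local Notation X0 := (X0 L K p Omega).
Hypothesis S_gt0 : 0 < S.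
Hypothesis sobolev : forall (u : T -> R) (e : R), measurable_fun setT u -> 0 <= e ->
  (\int[L]_x (`|u x| `^ p)%:E < +oo)%E -> (E u <= e%:E)%E ->
  (\int[L]_x (`|u x| `^ r)%:E <= (S * e `^ (r / p))%:E)%E.
Hypothesis mh : forall t, measurable_fun setT (h ^~ t).
Hypothesis ch : forall x, continuous (h x).
Hypothesis a1_gt0 : 0 < a1.
Hypothesis a2_gt0 : 0 < a2.
Hypothesis q_ge1 : 1 <= q.
Hypothesis q_lt_r : q < r.
Hypothesis h_growth : forall x t, `|h x t| <= a1 + a2 * `|t| `^ (q - 1).

Definition critical_integral (u : T -> R) : R := \int[L]_(x in Omega) (`|u x| `^ r).
Definition primitive_integral (u : T -> R) : R := \int[L]_(x in Omega) primitive (h x) (u x).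
Local Notation B := critical_integral.
Local Notation H := primitive_integral.

Lemma integrable_critical_setT u : X0 u -> L.-integrable setT (fun x => (`|u x| `^ r)%:E).
Proof.
move=> Xu; apply/integrableP; split.
  by apply/measurable_EFinP; apply: measurable_normr_powR; exact: X0_measurable Xu.
rewrite (eq_integral (fun x => (`|u x| `^ r)%:E)); last first.
  by move=> x _; rewrite gee0_abs// lee_fin powR_ge0.
apply: le_lt_trans (ltry _); apply: sobolev.
- exact: X0_measurable Xu.
- exact: (renergy_ge0 L p K_ge0 u).
- exact: X0_Lp Xu.
- by rewrite (renergyE K_ge0 Xu).
Qed.

Lemma integrable_critical u : X0 u -> L.-integrable Omega (fun x => (`|u x| `^ r)%:E).
Proof. by move=> Xu; apply: integrableS (integrable_critical_setT Xu). Qed.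

Lemma critical_integral_ge0 u : 0 <= B u.
Proof. by apply: Rintegral_ge0 => x _; exact: powR_ge0. Qed.

Lemma critical_integral_le u : X0 u -> B u <= S * A u `^ (r / p).
Proof.
move=> Xu; rewrite -lee_fin /B /Rintegral fineK; last first.
  exact: integrable_fin_num (integrable_critical Xu).
apply: (@le_trans _ _ (\int[L]_x (`|u x| `^ r)%:E)%E).
  apply: ge0_subset_integral => //.
  by apply/measurable_EFinP; apply: measurable_normr_powR; exact: X0_measurable Xu.
apply: sobolev.
- exact: X0_measurable Xu.
- exact: (renergy_ge0 L p K_ge0 u).
- exact: X0_Lp Xu.
- by rewrite (renergyE K_ge0 Xu).
Qed.

Lemma integrable_Omega_cst (c : R) : L.-integrable Omega (EFin \o cst c).
Proof.
apply/integrableP; split; first exact/measurable_EFinP.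
by rewrite /= integral_cst// lte_mul_pinfty.
Qed.

Lemma integrable_critical_affine (a b : R) u : X0 u ->
  L.-integrable Omega (EFin \o (fun x => a * `|u x| `^ r + b)).
Proof.
move=> Xu.
exact: (integrableD mOmega (integrableZl mOmega a (integrable_critical Xu)) (integrable_Omega_cst b)).
Qed.

Lemma Rintegral_critical_affine (a b : R) u : X0 u ->
  \int[L]_(x in Omega) (a * `|u x| `^ r + b) = a * B u + b * fine (L Omega).
Proof.
move=> Xu; rewrite RintegralD//; last 2 first.
- exact: (integrableZl mOmega a (integrable_critical Xu)).
- exact: integrable_Omega_cst.
by rewrite RintegralZl ?Rintegral_cst//; exact: integrable_critical.
Qed.

Lemma measurable_primitive_comp u : X0 u -> measurable_fun Omega (fun x => primitive (h x) (u x)).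
Proof.
move=> Xu; apply: (@measurable_funS _ _ _ _ setT) => //.
by apply: measurable_primitive => //; exact: X0_measurable Xu.
Qed.

Lemma integrable_primitive u : X0 u ->
  L.-integrable Omega (fun x => (primitive (h x) (u x))%:E).
Proof.
move=> Xu; have [C C0 HC] := primitive_subcritical_growth a1_gt0 a2_gt0 q_ge1 q_lt_r ltr01.
apply: (le_integrable_real mOmega _ (integrable_critical_affine 1 C Xu)).
  exact: measurable_primitive_comp.
by move=> x Ox; exact: HC.
Qed.

Lemma primitive_integral_le (eps : R) : 0 < eps -> exists2 C : R, 0 <= C &
  forall u, X0 u -> `|H u| <= eps * B u + C.
Proof.
move=> eps0; have [C C0 HC] := primitive_subcritical_growth a1_gt0 a2_gt0 q_ge1 q_lt_r eps0.
exists (C * fine (L Omega)); first by rewrite mulr_ge0// fine_ge0.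
move=> u Xu; rewrite -Rintegral_critical_affine//.
apply: (le_trans (le_normr_Rintegral mOmega (integrable_primitive Xu))).
apply: le_Rintegral => //.
- by apply: integrable_norm; exact: integrable_primitive.
- exact: integrable_critical_affine.
- by move=> x Ox; exact: HC.
Qed.

Lemma ae_eq_critical u v : measurable_fun setT u -> measurable_fun setT v ->
  {ae L, forall x, u x = v x} -> B u = B v.
Proof.
move=> mu mv uv; rewrite /B /Rintegral; apply: (congr1 fine); apply: ae_eq_integral => //.
- by apply/measurable_EFinP; apply: measurable_normr_powR; exact: (@measurable_funS _ _ _ _ setT).
- by apply/measurable_EFinP; apply: measurable_normr_powR; exact: (@measurable_funS _ _ _ _ setT).
- by apply: filterS uv => x ->.
Qed.

Lemma ae_eq_primitive u v : X0 u -> X0 v ->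
  {ae L, forall x, u x = v x} -> H u = H v.
Proof.
move=> mu mv uv; rewrite /H /Rintegral; apply: (congr1 fine); apply: ae_eq_integral => //.
- by apply/measurable_EFinP; exact: measurable_primitive_comp.
- by apply/measurable_EFinP; exact: measurable_primitive_comp.
- by apply: filterS uv => x ->.
Qed.

Definition functional (mu lam : R) (u : T -> R) : R :=
  p^-1 * A u - mu / r * B u - lam * H u.

Lemma ae_eq_functional mu lam u v : X0 u -> X0 v ->
  {ae L, forall x, u x = v x} -> functional mu lam u = functional mu lam v.
Proof.
move=> Xu Xv uv; rewrite /functional (ae_eq_primitive Xu Xv uv).
rewrite (ae_eq_critical (X0_measurable Xu) (X0_measurable Xv) uv).
by rewrite /renergy (ae_eq_energy p mK (X0_measurable Xu) (X0_measurable Xv) uv).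
Qed.

Let p0 : 0 < p. Proof. by move: p_ge2; lra. Qed.
Let r0 : 0 < r. Proof. by move: p0 p_lt_r; lra. Qed.
Let r2 : 2 <= r. Proof. by move: p_ge2 p_lt_r; lra. Qed.

(** The integrand |Dw_n| ^ p - 2 ^ - p * |D(w_n - u)| ^ p, where D denotes the difference
    between two points, is bounded below by - |Du| ^ p, so that Fatou's lemma applies to
    it. This is a one-sided substitute for the Brezis-Lieb lemma: in the limit the energy
    drops by at least a fixed proportion of the energy of w_n - u. *)
Lemma energy_gap (w : nat -> T -> R) (u : T -> R) :
  (forall n, X0 (w n)) -> X0 u -> (forall x, w n x @[n --> \oo] --> u x) ->
  forall e, 0 < e -> \forall n \near \oo,
    A u + (2 `^ p)^-1 * A (fun x => w n x - u x) - e <= A (w n).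
Proof.
move=> Xw Xu wu e e0.
have two_p : 0 < 2 `^ p :> R by exact: powR_gt0.
pose D (v : T -> R) (z : T * T) : R := `|v z.1 - v z.2| `^ p * K z.
have iD v : X0 v -> L2.-integrable setT (EFin \o D v) by exact: integrable_energy.
have AE v : X0 v -> A v = \int[L2]_z D v z by [].
have Xd n : X0 (fun x => w n x - u x) by exact: X0_B.
pose a n z := D (w n) z - (2 `^ p)^-1 * D (fun x => w n x - u x) z.
have iZ n : L2.-integrable setT (EFin \o (fun z => (2 `^ p)^-1 * D (fun x => w n x - u x) z)).
  exact: (integrableZl measurableT _ (iD _ (Xd n))).
have ia n : L2.-integrable setT (EFin \o a n).
  exact: (integrableB measurableT (iD _ (Xw n)) (iZ n)).
have := @fatou_lower_bound _ _ _ L2 setT measurableT a (D u) (D u) ia (iD _ Xu) (iD _ Xu) _ _ e e0.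
have H1 n z : [set: T * T] z -> - D u z <= a n z.
  move=> _; rewrite /a /D.
  have := @normr_powRD_le2 R (w n z.1 - w n z.2) (- (u z.1 - u z.2)) p (ltW p0).
  rewrite normrN (_ : w n z.1 - w n z.2 - (u z.1 - u z.2) = w n z.1 - u z.1 - (w n z.2 - u z.2)); last by ring.
  move=> /(ler_wpM2r (K_ge0 z)) H.
  have : (2 `^ p)^-1 * (`|w n z.1 - u z.1 - (w n z.2 - u z.2)| `^ p * K z) <=
      `|w n z.1 - w n z.2| `^ p * K z + `|u z.1 - u z.2| `^ p * K z.
    by rewrite ler_pdivrMl// -mulrDl mulrA.
  lra.
have H2 z : [set: T * T] z -> a n z @[n --> \oo] --> D u z.
  move=> _; rewrite -[X in _ --> X]subr0 -[X in _ - X](mulr0 (2 `^ p)^-1) -[X in _ * X](mul0r (K z)).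
  apply: cvgB; first by apply: cvgMr_tmp; apply: cvg_normr_powR => //; apply: cvgB.
  apply: cvgMl_tmp; apply: cvgMr_tmp.
  rewrite (_ : 0 = `|(u z.1 - u z.1) - (u z.2 - u z.2)| `^ p); last first.
    by rewrite !subrr normr0 powR0// gt_eqF.
  apply: cvg_normr_powR => //; apply: cvgB; apply: cvgB => //; exact: cvg_cst.
move=> /(_ H1 H2); apply: filterS => n.
rewrite /a RintegralB//; last exact: iD.
rewrite RintegralZl//; last exact: iD.
rewrite -(AE _ (Xw n)) -(AE _ Xu) -(AE _ (Xd n)).
by move: (A (w n)) (A u) (A (fun x => w n x - u x)) => x y z; lra.
Qed.

(** Fatou's lemma for 2 ^ r * |w_n - u| ^ r - |w_n| ^ r, which is bounded below by - 2 ^ r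
    * |u| ^ r. The embedding into L^r is not compact, but what the critical integral loses
    in the limit is controlled by w_n - u. *)
Lemma critical_gap (w : nat -> T -> R) (u : T -> R) :
  (forall n, X0 (w n)) -> X0 u -> (forall x, w n x @[n --> \oo] --> u x) ->
  forall e, 0 < e -> \forall n \near \oo,
    B (w n) <= B u + 2 `^ r * B (fun x => w n x - u x) + e.
Proof.
move=> Xw Xu wu e e0.
pose D (v : T -> R) (x : T) : R := `|v x| `^ r.
have iD v : X0 v -> L.-integrable Omega (EFin \o D v) by exact: integrable_critical.
have Xd n : X0 (fun x => w n x - u x) by exact: X0_B.
pose a n x := 2 `^ r * D (fun x => w n x - u x) x - D (w n) x.
have iZ n : L.-integrable Omega (EFin \o (fun x => 2 `^ r * D (fun x => w n x - u x) x)).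
  exact: (integrableZl mOmega _ (iD _ (Xd n))).
have ia n : L.-integrable Omega (EFin \o a n).
  exact: (integrableB mOmega (iZ n) (iD _ (Xw n))).
have iN : L.-integrable Omega (EFin \o (fun x => - D u x)).
  exact: (integrableN (iD _ Xu)).
have iZu : L.-integrable Omega (EFin \o (fun x => 2 `^ r * D u x)).
  exact: (integrableZl mOmega _ (iD _ Xu)).
have H1 n x : Omega x -> - (2 `^ r * D u x) <= a n x.
  move=> _; rewrite /a /D.
  have := @normr_powRD_le2 R (w n x - u x) (u x) r (ltW r0).
  rewrite subrK mulrDr; lra.
have H2 x : Omega x -> a n x @[n --> \oo] --> - D u x.
  move=> _; rewrite -[X in _ --> X]sub0r -[X in X - _](mulr0 (2 `^ r)).
  apply: cvgB; last by apply: cvg_normr_powR.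
  apply: cvgMl_tmp.
  rewrite (_ : 0 = `|u x - u x| `^ r); last by rewrite subrr normr0 powR0// gt_eqF.
  by apply: cvg_normr_powR => //; apply: cvgB => //; exact: cvg_cst.
have := @fatou_lower_bound _ _ _ L Omega mOmega a _ _ ia iN iZu H1 H2 e e0.
apply: filterS => n.
rewrite /a RintegralB//; last exact: iD.
rewrite RintegralZl//; last exact: iD.
have -> : \int[L]_(x in Omega) (- D u x) = - B u.
  rewrite -mulN1r -RintegralZl//; last exact: iD.
  by apply: eq_Rintegral => x _; rewrite mulN1r.
have -> : \int[L]_(x in Omega) D (w n) x = B (w n) by [].
have -> : \int[L]_(x in Omega) D (fun x => w n x - u x) x = B (fun x => w n x - u x) by [].
by move: (B (w n)) (B u) (B (fun x => w n x - u x)) => x y z; lra.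
Qed.

(** The subcritical term loses nothing in the limit: del * |w| ^ r + C - primitive (h x) w
    is nonnegative for arbitrarily small del, and the critical integrals are bounded by M. *)
Lemma primitive_limsup (w : nat -> T -> R) (u : T -> R) (M : R) :
  (forall n, X0 (w n)) -> X0 u -> (forall n, B (w n) <= M) ->
  (forall x, w n x @[n --> \oo] --> u x) ->
  forall e, 0 < e -> \forall n \near \oo, H (w n) <= H u + e.
Proof.
have key (b1 b2 b3 b4 c e' : R) : b1 <= e' / 2 -> 0 <= b2 ->
    b2 + c - b4 - e' / 2 <= b1 + c - b3 -> b3 <= b4 + e' by lra.
move=> Xw Xu wM wu e e0.
have M0 : 0 <= M by apply: le_trans (wM 0%N); exact: critical_integral_ge0.
pose del := e / 2 / (M + 1).
have del0 : 0 < del by rewrite !divr_gt0// ltr_wpDl.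
have [C C0 HC] := primitive_subcritical_growth a1_gt0 a2_gt0 q_ge1 q_lt_r del0.
pose f (v : T -> R) x := (del * `|v x| `^ r + C) - primitive (h x) (v x).
have iff v : X0 v -> L.-integrable Omega (EFin \o f v).
  move=> Xv; exact: (integrableB mOmega (integrable_critical_affine del C Xv) (integrable_primitive Xv)).
have fE v : X0 v -> \int[L]_(x in Omega) f v x = del * B v + C * fine (L Omega) - H v.
  move=> Xv; rewrite RintegralB// ?Rintegral_critical_affine//.
  - exact: integrable_critical_affine.
  - exact: integrable_primitive.
have H1 n x : Omega x -> - cst 0 x <= f (w n) x.
  move=> Ox; rewrite oppr0 subr_ge0.
  have := HC (h x) (@ch x) (h_growth x) (w n x).
  by apply: le_trans; exact: ler_norm.
have H2 x : Omega x -> f (w n) x @[n --> \oo] --> f u x.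
  move=> Ox; apply: cvgB.
    apply: cvgD; last exact: cvg_cst.
    by apply: cvgMl_tmp; exact: cvg_normr_powR.
  apply: (@continuous_cvg _ _ _ _ _ (fun n => w n x) (primitive (h x))) => //.
  apply: differentiable_continuous; apply/derivable1_diffP.
  exact: (@ex_derive _ _ _ _ _ _ _ (is_derive_primitive (u x) (@ch x))).
have e20 : 0 < e / 2 by rewrite divr_gt0.
have := @fatou_lower_bound _ _ _ L Omega mOmega (fun n => f (w n)) (f u) (cst 0)
  (fun n => iff _ (Xw n)) (iff _ Xu) (integrable_Omega_cst 0) H1 H2 _ e20.
apply: filterS => n; rewrite !fE//.
have := critical_integral_ge0 u.
have : del * B (w n) <= e / 2.
  rewrite /del mulrAC ler_pdivrMr ?ltr_wpDl// ler_wpM2l ?(ltW e20)//.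
  by apply: (le_trans (wM n)); rewrite lerDl.
by move=> h1 h2; apply: key => //; rewrite mulr_ge0// ltW.
Qed.
End functional.

(** * Minimization in an energy ball *)

Lemma normr_powR_le_affine (R : realType) (a r t : R) : 0 <= a -> a <= r ->
  `|t| `^ a <= 1 * `|t| `^ r + 1.
Proof.
move=> a0 ar; have := powR_le_interpolation ltr01 a0 ar (normr_ge0 t).
by rewrite !powR1 addrC.
Qed.

Section minimization.
Context d (T : measurableType d) (R : realType)
  (L : {sigma_finite_measure set T -> \bar R}).
Variables (K : T * T -> R) (p r S : R) (Omega : set T) (h : T -> R -> R) (a1 a2 q : R).
Local Notation L2 := (L \x L)%E.
Hypothesis K_ge0 : forall z, 0 <= K z.
Hypothesis mK : measurable_fun setT K.
Hypothesis p_ge2 : 2 <= p.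
Hypothesis p_lt_r : p < r.
Hypothesis mOmega : measurable Omega.
Hypothesis Omega_fin : (L Omega < +oo)%E.
Local Notation E := (gagliardo_energy L K p).
Local Notation A := (renergy L K p).
Local Notation X0 := (X0 L K p Omega).
Hypothesis S_gt0 : 0 < S.
Hypothesis sobolev : forall (u : T -> R) (e : R), measurable_fun setT u -> 0 <= e ->
  (\int[L]_x (`|u x| `^ p)%:E < +oo)%E -> (E u <= e%:E)%E ->
  (\int[L]_x (`|u x| `^ r)%:E <= (S * e `^ (r / p))%:E)%E.
Hypothesis mh : forall t, measurable_fun setT (h ^~ t).
Hypothesis ch : forall x, continuous (h x).
Hypothesis a1_gt0 : 0 < a1.
Hypothesis a2_gt0 : 0 < a2.
Hypothesis q_ge1 : 1 <= q.
Hypothesis q_lt_r : q < r.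
Hypothesis h_growth : forall x t, `|h x t| <= a1 + a2 * `|t| `^ (q - 1).
Local Notation B := (critical_integral L r Omega).
Local Notation H := (primitive_integral L Omega h).
Local Notation J := (functional L K p r Omega h).
Let p0 : 0 < p. Proof. by move: p_ge2; lra. Qed.
Let r0 : 0 < r. Proof. by move: p0 p_lt_r; lra. Qed.
Let r2 : 2 <= r. Proof. by move: p_ge2 p_lt_r; lra. Qed.
Hypothesis extraction : forall (u : nat -> T -> R) (e b : R), 0 <= e ->
  (forall n, measurable_fun setT (u n)) ->
  (forall n, L.-integrable setT (EFin \o u n)) ->
  (forall n, (E (u n) <= e%:E)%E) ->
  (forall n, (\int[L]_x `|u n x|%:E <= b%:E)%E) ->
  exists f : nat -> nat, (forall k, (k <= f k)%N) /\
    forall k, (\int[L]_(x in Omega) `|u (f k.+1) x - u (f k) x|%:E <= (2^-1 ^+ k)%:E)%E.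

Let m := fine (L Omega).

Lemma critical_integral_le_ball (eta : R) u : X0 u -> A u <= eta -> B u <= S * eta `^ (r / p).
Proof.
move=> Xu Au; apply: (le_trans (critical_integral_le K_ge0 mOmega sobolev Xu)).
rewrite ler_wpM2l ?(ltW S_gt0)// le_powR2// ?(renergy_ge0 L p K_ge0)//.
by rewrite divr_ge0 ?(ltW p0) ?(ltW r0).
Qed.

Lemma integral_critical_affine_le (eta : R) u : X0 u -> A u <= eta ->
  (\int[L]_(x in Omega) (1 * `|u x| `^ r + 1)%:E <= (S * eta `^ (r / p) + m)%:E)%E.
Proof.
move=> Xu Au.
rewrite -(@fineK _ (\int[L]_(x in Omega) _)%E); last first.
  by apply: integrable_fin_num => //; exact: (integrable_critical_affine K_ge0 mOmega Omega_fin sobolev 1 1 Xu).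
rewrite lee_fin [leLHS](Rintegral_critical_affine K_ge0 mOmega Omega_fin sobolev 1 1 Xu) !mul1r.
by rewrite lerD2r critical_integral_le_ball.
Qed.

Lemma integral_support (u : T -> R) (a : R) : 0 < a -> (forall x, ~ Omega x -> u x = 0) ->
  (\int[L]_x (`|u x| `^ a)%:E = \int[L]_(x in Omega) (`|u x| `^ a)%:E)%E.
Proof.
move=> a0 u0; rewrite [RHS]integral_mkcond; apply: eq_integral => x _.
rewrite patchE; case: ifPn => // /negP xO.
by rewrite u0 ?normr0 ?powR0// ?gt_eqF// => Ox; apply: xO; exact: mem_set.
Qed.

Lemma integral_powR_le (eta a : R) u : 0 < a -> a <= r -> X0 u -> A u <= eta ->
  (forall x, ~ Omega x -> u x = 0) ->
  (\int[L]_x (`|u x| `^ a)%:E <= (S * eta `^ (r / p) + m)%:E)%E.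
Proof.
move=> a0 ar Xu Au u0; rewrite integral_support//.
apply: le_trans (integral_critical_affine_le Xu Au).
apply: ge0_le_integral => //.
- apply/measurable_EFinP; apply: measurable_normr_powR.
  by apply: (@measurable_funS _ _ _ _ setT) => //; exact: X0_measurable Xu.
- exact: measurable_int (integrable_critical_affine K_ge0 mOmega Omega_fin sobolev 1 1 Xu).
- by move=> x _; rewrite lee_fin normr_powR_le_affine// ltW.
Qed.

Lemma X0_integrable u : X0 u -> (forall x, ~ Omega x -> u x = 0) -> L.-integrable setT (EFin \o u).
Proof.
move=> Xu u0; have mu := X0_measurable Xu.
apply/integrableP; split; first exact/measurable_EFinP.
have r1 : 1 <= r by move: r2; lra.
apply: le_lt_trans (ltry (S * (A u) `^ (r / p) + m)).
rewrite (eq_integral (fun x => (`|u x| `^ 1)%:E)); last by move=> x _; rewrite powRr1.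
exact: integral_powR_le.
Qed.

Lemma X0_restrict_functional (mu lam : R) D u : measurable D -> D `<=` Omega ->
  L (Omega `\` D) = 0%E -> X0 u ->
  [/\ X0 (u \_ D), A (u \_ D) = A u & J mu lam (u \_ D) = J mu lam u].
Proof.
move=> mD DO LD Xu; have [mv uv] := X0_restrict_ae mOmega mD DO LD Xu.
have Xv : X0 (u \_ D) by exact: (X0_ae_eq mK mv uv Xu).
split; first exact: Xv.
- by rewrite /renergy (ae_eq_energy p mK (X0_measurable Xu) mv uv).
- exact: esym (ae_eq_functional r mK mOmega mh ch mu lam Xu Xv uv).
Qed.

(** Modifying functions on null sets and outside Omega changes neither the energy nor the
    functional, and turns the almost everywhere convergence of an extracted subsequence
    into convergence at every point. The limit stays in the energy ball by Fatou's lemma. *)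
Lemma energy_ball_compact (mu lam eta : R) (u : nat -> T -> R) : 0 <= eta ->
  (forall n, X0 (u n)) -> (forall n, A (u n) <= eta) ->
  exists (v : T -> R) (w : nat -> T -> R) (f : nat -> nat),
  [/\ X0 v, A v <= eta, (forall k, (k <= f k)%N),
      (forall k, [/\ X0 (w k), A (w k) <= eta & J mu lam (w k) = J mu lam (u (f k))]) &
      forall x, w k x @[k --> \oo] --> v x].
Proof.
move=> eta0 Xu Au.
pose u' n := u n \_ Omega.
have Hu' n : [/\ X0 (u' n), A (u' n) = A (u n) & J mu lam (u' n) = J mu lam (u n)].
  by apply: X0_restrict_functional; [exact: mOmega|exact: subset_refl|rewrite setDv measure0|exact: Xu].
have u'0 n x : ~ Omega x -> u' n x = 0.
  by move=> nO; rewrite /u' patchE memNset.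
have Xu' n : X0 (u' n) by have [] := Hu' n.
have Au' n : A (u' n) <= eta by have [_ -> _] := Hu' n.
have r1 : 1 <= r by move: r2; lra.
have [f [fk fI]] := extraction eta0 (fun n => X0_measurable (Xu' n))
  (fun n => X0_integrable (Xu' n) (@u'0 n))
  (fun n => (ltac:(by rewrite (renergyE K_ge0 (Xu' n)) lee_fin)))
  (fun n => (ltac:(by under eq_integral do rewrite -(powRr1 (normr_ge0 _)); exact: (integral_powR_le ltr01 r1 (Xu' n) (Au' n) (@u'0 n))))).
have [D [mD DO LD cD]] := ae_cvg_of_fast_cauchy mOmega (fun k => X0_measurable (Xu' (f k))) fI.
have [v mv vE] := cvg_restrict_lim mD (fun k => X0_measurable (Xu' (f k))) cD.
pose w k := u' (f k) \_ D.
have Hw k : [/\ X0 (w k), A (w k) = A (u' (f k)) & J mu lam (w k) = J mu lam (u' (f k))].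
  exact: X0_restrict_functional.
have w0 k x : ~ Omega x -> w k x = 0.
  by move=> nO; rewrite /w patchE memNset// => /DO.
have Xw k : X0 (w k) by have [] := Hw k.
have Aw k : A (w k) <= eta by have [_ -> _] := Hw k.
have v0 x : ~ Omega x -> v x = 0.
  move=> nO; apply: (@cvg_unique _ (@Rhausdorff R) _ _ _ _ (vE x)).
  have -> : (fun k => (u' (f k) \_ D) x) = cst 0 by apply/funext => k; exact: w0.
  exact: cvg_cst.
have Ev : (E v <= eta%:E)%E.
  apply: (@fatou_le _ _ _ L2 (fun k z => `|w k z.1 - w k z.2| `^ p * K z)).
  - by move=> k; apply: measurable_gagliardo => //; exact: X0_measurable (Xw k).
  - by move=> k z; rewrite mulr_ge0 ?powR_ge0.
  - by move=> z; apply: cvgMr_tmp; apply: cvg_normr_powR => //; apply: cvgB; exact: vE.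
  - by move=> k; have := renergyE K_ge0 (Xw k); rewrite /gagliardo_energy => ->; rewrite lee_fin.
have Xv : X0 v.
  split => //.
  - apply: le_lt_trans (ltry (S * eta `^ (r / p) + m)).
    apply: (@fatou_le _ _ _ L (fun k x => `|w k x| `^ p)).
    + by move=> k; apply: measurable_normr_powR; exact: X0_measurable (Xw k).
    + by move=> k x; exact: powR_ge0.
    + by move=> x; apply: cvg_normr_powR => //; exact: vE.
    + by move=> k; apply: integral_powR_le => //; [exact: ltW|exact: w0].
  - by apply: le_lt_trans Ev _; rewrite ltry.
  - exact: aeW.
exists v, w, f; split; [exact: Xv| |exact: fk| |exact: vE].
- by rewrite -lee_fin -(renergyE K_ge0 Xv).
- move=> k; split; [exact: Xw|exact: Aw|].
  by have [_ _ ->] := Hw k; have [_ _ ->] := Hu' (f k).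
Qed.
End minimization.

Section interior_minimizer.
Context d (T : measurableType d) (R : realType)
  (L : {sigma_finite_measure set T -> \bar R}).
Variables (K : T * T -> R) (p r S : R) (Omega : set T) (h : T -> R -> R) (a1 a2 q : R).
Local Notation L2 := (L \x L)%E.
Hypothesis K_ge0 : forall z, 0 <= K z.
Hypothesis mK : measurable_fun setT K.
Hypothesis p_ge2 : 2 <= p.
Hypothesis p_lt_r : p < r.
Hypothesis mOmega : measurable Omega.
Hypothesis Omega_fin : (L Omega < +oo)%E.
Local Notation E := (gagliardo_energy L K p).
Local Notation A := (renergy L K p).
Local Notation X0 := (X0 L K p Omega).
Hypothesis S_gt0 : 0 < S.
Hypothesis sobolev : forall (u : T -> R) (e : R), measurable_fun setT u -> 0 <= e ->
  (\int[L]_x (`|u x| `^ p)%:E < +oo)%E -> (E u <= e%:E)%E ->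
  (\int[L]_x (`|u x| `^ r)%:E <= (S * e `^ (r / p))%:E)%E.
Hypothesis mh : forall t, measurable_fun setT (h ^~ t).
Hypothesis ch : forall x, continuous (h x).
Hypothesis a1_gt0 : 0 < a1.
Hypothesis a2_gt0 : 0 < a2.
Hypothesis q_ge1 : 1 <= q.
Hypothesis q_lt_r : q < r.
Hypothesis h_growth : forall x t, `|h x t| <= a1 + a2 * `|t| `^ (q - 1).
Local Notation B := (critical_integral L r Omega).
Local Notation H := (primitive_integral L Omega h).
Local Notation J := (functional L K p r Omega h).
Let p0 : 0 < p. Proof. by move: p_ge2; lra. Qed.
Let r0 : 0 < r. Proof. by move: p0 p_lt_r; lra. Qed.
Let r2 : 2 <= r. Proof. by move: p_ge2 p_lt_r; lra. Qed.
Hypothesis extraction : forall (u : nat -> T -> R) (e b : R), 0 <= e ->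
  (forall n, measurable_fun setT (u n)) ->
  (forall n, L.-integrable setT (EFin \o u n)) ->
  (forall n, (E (u n) <= e%:E)%E) ->
  (forall n, (\int[L]_x `|u n x|%:E <= b%:E)%E) ->
  exists f : nat -> nat, (forall k, (k <= f k)%N) /\
    forall k, (\int[L]_(x in Omega) `|u (f k.+1) x - u (f k) x|%:E <= (2^-1 ^+ k)%:E)%E.

(** On differences of two functions of the energy ball of radius eta, the loss in
    `critical_gap` is outweighed by the gain in `energy_gap`. The bound on A v is the one
    that `renergyB_le` gives for such differences. *)
Definition sobolev_absorbs (mu eta : R) := forall v, X0 v ->
  A v <= 2 `^ p * (eta + eta) ->
  mu / r * (2 `^ r * B v) <= p^-1 * ((2 `^ p)^-1 * A v).

(** By the Sobolev inequality B v <= S * A v ^ (r / p), where r / p > 1: in a small ball,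
    B v is an arbitrarily small multiple of A v. *)
Lemma exists_sobolev_absorbs (mu : R) : 0 < mu -> exists2 eta, 0 < eta & sobolev_absorbs mu eta.
Proof.
move=> mu0.
have [kap kap0 kapE] : exists2 kap : R, 0 < kap & kap = p^-1 * (2 `^ p)^-1.
  by eexists; last reflexivity; rewrite mulr_gt0 ?invr_gt0 ?powR_gt0.
have [k k0 kE] : exists2 k : R, 0 < k & k = mu / r * 2 `^ r * S.
  by eexists; last reflexivity; rewrite !mulr_gt0 ?invr_gt0 ?powR_gt0.
have e0 : 0 < r / p - 1 by rewrite subr_gt0 ltr_pdivlMr// mul1r.
have kk : 0 < kap / k by rewrite divr_gt0.
(* For A v <= X the excess A v ^ (r / p - 1) is at most kap / k. *)
pose X := (kap / k) `^ (r / p - 1)^-1; have X_gt0 : 0 < X by rewrite powR_gt0.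
have XE : X `^ (r / p - 1) = kap / k by rewrite -powRrM mulVf ?gt_eqF// powRr1// ltW.
have tp : 0 < 2 `^ p :> R by exact: powR_gt0.
exists (X / 2 / 2 `^ p); first by rewrite !divr_gt0.
move=> v Xv; have -> : 2 `^ p * (X / 2 / 2 `^ p + X / 2 / 2 `^ p) = X.
  by field; rewrite gt_eqF.
move=> AX; have A0 : 0 <= A v by exact: (renergy_ge0 L p K_ge0).
have BA : B v <= S * (A v * (kap / k)).
  apply: (le_trans (critical_integral_le K_ge0 mOmega sobolev Xv)).
  rewrite ler_wpM2l ?(ltW S_gt0)//.
  rewrite -mulr_powRB1 ?divr_gt0// ler_wpM2l// -XE.
  by apply: le_powR2 => //; exact: ltW.
have k'0 : 0 <= mu / r * 2 `^ r by rewrite mulr_ge0 ?powR_ge0// divr_ge0// ltW.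
have := ler_wpM2l k'0 BA; rewrite !mulrA -kE -kapE.
move: (B v) (A v) => b a {BA A0 AX}; rewrite -[k * a * kap / k]mulrA.
by have -> : k * a * (kap / k) = kap * a by field; rewrite gt_eqF.
Qed.

(** The terms in w_n - u that appear in `energy_gap` and `critical_gap` add up to a
    nonnegative quantity in a small energy ball. Hence the functional is lower
    semicontinuous there although its critical term alone need not be continuous along
    such sequences. *)
Lemma functional_lsc (mu lam eta : R) (w : nat -> T -> R) (u : T -> R) :
  0 < mu -> 0 < lam -> sobolev_absorbs mu eta ->
  (forall n, X0 (w n)) -> X0 u -> (forall n, A (w n) <= eta) -> A u <= eta ->
  (forall x, w n x @[n --> \oo] --> u x) ->
  forall e, 0 < e -> \forall n \near \oo, J mu lam u - e <= J mu lam (w n).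
Proof.
move=> mu0 lam0 abs Xw Xu Aw Au wu e e0.
have c0 : 0 < p^-1 + mu / r + lam by rewrite !addr_gt0 ?invr_gt0 ?divr_gt0.
(* The three terms contribute errors e' / p, mu * e' / r and lam * e', which add up to
   e. *)
pose e' := e / (p^-1 + mu / r + lam).
have e'0 : 0 < e' by rewrite divr_gt0.
have h1 := energy_gap K_ge0 mK p_ge2 Xw Xu wu e'0.
have h2 := critical_gap K_ge0 mK p_ge2 p_lt_r mOmega sobolev Xw Xu wu e'0.
have h3 := primitive_limsup K_ge0 p_ge2 p_lt_r mOmega Omega_fin sobolev mh ch a1_gt0 a2_gt0
  q_ge1 q_lt_r h_growth Xw Xu
  (fun n => critical_integral_le_ball K_ge0 p_ge2 p_lt_r mOmega S_gt0 sobolev (Xw n) (Aw n)) wu e'0.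
have e'E : p^-1 * e' + mu / r * e' + lam * e' = e.
  by rewrite -!mulrDl /e' mulrC divfK// gt_eqF.
have mur : 0 < mu / r by rewrite divr_gt0.
have pV0 : 0 < p^-1 by rewrite invr_gt0.
near=> n.
have H1 : A u + (2 `^ p)^-1 * A (fun x => w n x - u x) - e' <= A (w n) by near: n; exact: h1.
have H2 : B (w n) <= B u + 2 `^ r * B (fun x => w n x - u x) + e' by near: n; exact: h2.
have H3 : H (w n) <= H u + e' by near: n; exact: h3.
have Xd : X0 (fun x => w n x - u x) by exact: X0_B.
have Ad : A (fun x => w n x - u x) <= 2 `^ p * (eta + eta).
  apply: (le_trans (renergyB_le K_ge0 mK p_ge2 (Xw n) Xu)).
  by rewrite ler_wpM2l ?powR_ge0//; exact: lerD (Aw n) Au.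
have := abs _ Xd Ad; rewrite /functional.
move: (A (w n)) (A u) (A (fun x => w n x - u x)) (B (w n)) (B u)
  (B (fun x => w n x - u x)) (H (w n)) (H u) H1 H2 H3 => Aw' Au' Ad' Bw' Bu' Bd' Hw' Hu' H1 H2 H3 H4.
have := ler_wpM2l (ltW pV0) H1; have := ler_wpM2l (ltW mur) H2; have := ler_wpM2l (ltW lam0) H3.
rewrite !mulrDr ?mulrN; move: H4 e'E.
move: (mu / r) (p^-1) (2 `^ p) (2 `^ r) mur pV0 => m1 p1 t1 t2 _ _.
lra.
Unshelve. all: by end_near. Qed.

Lemma functional0 (mu lam : R) : J mu lam (cst 0) = 0.
Proof.
rewrite /functional renergy0// (_ : B (cst 0) = 0); last first.
  rewrite /critical_integral /Rintegral integral0_eq// => x _.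
  by rewrite normr0 powR0// gt_eqF.
rewrite (_ : H (cst 0) = 0); first by rewrite !mulr0 !subr0.
by rewrite /primitive_integral /Rintegral integral0_eq// => x _; rewrite primitive0.
Qed.

Lemma exists_minimizer (mu lam eta : R) : 0 < mu -> 0 < lam -> 0 < eta -> sobolev_absorbs mu eta ->
  exists v, [/\ X0 v, A v <= eta & forall u, X0 u -> A u <= eta -> J mu lam v <= J mu lam u].
Proof.
move=> mu0 lam0 eta0 abs.
pose P := [set J mu lam u | u in [set u | X0 u /\ A u <= eta]].
have P0 : P !=set0.
  exists (J mu lam (cst 0)), (cst 0) => //; split; first exact: X0_0.
  by rewrite renergy0// ltW.
have [C C0 HC] := primitive_integral_le K_ge0 mOmega Omega_fin sobolev mh ch a1_gt0 a2_gt0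
  q_ge1 q_lt_r h_growth ltr01.
pose M := S * eta `^ (r / p).
have lb : has_lbound P.
  exists (- (mu / r * M + lam * (M + C))) => _ [u [Xu Au] <-]; rewrite /functional.
  have BM := critical_integral_le_ball K_ge0 p_ge2 p_lt_r mOmega S_gt0 sobolev Xu Au.
  have A0 : 0 <= p^-1 * A u by rewrite mulr_ge0 ?invr_ge0 ?(ltW p0)// (renergy_ge0 L p K_ge0).
  have HM : H u <= M + C.
    apply: (le_trans (ler_norm _)); apply: (le_trans (HC u Xu)).
    by rewrite mul1r lerD2r.
  have h1 : mu / r * B u <= mu / r * M by rewrite ler_wpM2l// divr_ge0// ltW.
  have h2 : lam * H u <= lam * (M + C) by rewrite ler_wpM2l// ltW.
  by move: A0 h1 h2; move: (p^-1 * A u) (mu / r * B u) (lam * H u) => a b c; lra.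
have hinf : has_inf P by split.
have /choice[u Hu] : forall n : nat, exists u, [/\ X0 u, A u <= eta & J mu lam u < inf P + n.+1%:R^-1].
  move=> n; have n0 : 0 < n.+1%:R^-1 :> R by rewrite invr_gt0.
  by have [_ [u [Xu Au] <-] Ju] := inf_adherent n0 hinf; exists u; split.
have [v [w [f [Xv Av fk Hw wv]]]] := energy_ball_compact K_ge0 mK p_ge2 p_lt_r mOmega Omega_fin
  S_gt0 sobolev mh ch extraction mu lam (ltW eta0)
  (fun n => let: And3 X _ _ := Hu n in X) (fun n => let: And3 _ X _ := Hu n in X).
exists v; split; [exact: Xv|exact: Av|] => z Xz Az.
apply: (@le_trans _ _ (inf P)); last by apply: ge_inf => //; exists z.
apply/ler_addgt0Pr => e e0.
have e20 : 0 < e / 2 by rewrite divr_gt0.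
have lsc := functional_lsc mu0 lam0 abs (fun n => let: And3 X _ _ := Hw n in X) Xv
  (fun n => let: And3 _ X _ := Hw n in X) Av wv e20.
near \oo => n.
have l1 : J mu lam v - e / 2 <= J mu lam (w n) by near: n; exact: lsc.
have l2 : J mu lam (w n) < inf P + (f n).+1%:R^-1.
  by have [_ _ ->] := Hw n; have [_ _] := Hu (f n).
have l3 : (f n).+1%:R^-1 <= n.+1%:R^-1 :> R by rewrite lef_pV2 ?posrE// ler_nat ltnS.
have l4 : n.+1%:R^-1 < e / 2 by near: n; exact: (near_infty_natSinv_lt (PosNum e20)).
move: l1 l2 l3 l4; move: (J mu lam v) (J mu lam (w n)) (inf P) => a b c.
by move: (n.+1%:R^-1) ((f n).+1%:R^-1) => x y; lra.
Unshelve. all: by end_near. Qed.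

(** The minimizer v over the energy ball of radius eta, which depends on mu only,
    satisfies J v <= J 0 = 0. As the critical term absorbs at most half of the energy of
    v, what remains is A v <= 2 * p * lam * (M + C), where M + C bounds the primitive
    integral on the ball. For small lam this is less than eta. *)
Lemma exists_interior_minimizer (mu : R) : 0 < mu ->
  exists2 Lam : R, 0 < Lam & forall lam, 0 < lam -> lam < Lam ->
  exists v, X0 v /\ exists2 eta, A v < eta &
    forall u, X0 u -> A u <= eta -> J mu lam v <= J mu lam u.
Proof.
move=> mu0; have [eta eta0 abs] := exists_sobolev_absorbs mu0.
have [C C0 HC] := primitive_integral_le K_ge0 mOmega Omega_fin sobolev mh ch a1_gt0 a2_gt0
  q_ge1 q_lt_r h_growth ltr01.
pose M := S * eta `^ (r / p).
have M0 : 0 <= M by rewrite mulr_ge0 ?powR_ge0// ltW.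
have MC0 : 0 < M + C + 1 by rewrite ltr_wpDl// addr_ge0.
(* The summand 1 keeps the denominator positive and the final inequality strict. *)
exists (eta / (2 * p) / (M + C + 1)); first by rewrite !divr_gt0// mulr_gt0.
move=> lam lam0; rewrite ltr_pdivlMr// ltr_pdivlMr ?mulr_gt0// => lamL.
have [v [Xv Av vmin]] := exists_minimizer mu0 lam0 eta0 abs.
exists v; split; first exact: Xv.
exists eta; last exact: vmin.
have := vmin (cst 0) (X0_0 L K Omega p_ge2).
rewrite renergy0// functional0 => /(_ (ltW eta0)).
have two_p : 2 <= 2 `^ p :> R by rewrite -[leLHS]powRr1//; apply: ler_powR; [rewrite ler1n|move: p_ge2; lra].
have two_r : 1 <= 2 `^ r :> R by rewrite -[leLHS](powRr0 2); apply: ler_powR; [rewrite ler1n|exact: ltW].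
have A0 : 0 <= A v by exact: (renergy_ge0 L p K_ge0).
have B0 := critical_integral_ge0 L r Omega v.
have := abs v Xv.
have -> : A v <= 2 `^ p * (eta + eta).
  apply: (le_trans Av); apply: (@le_trans _ _ (1 * (eta + eta))); first by lra.
  by rewrite ler_wpM2r//; lra.
move=> /(_ isT) absv.
have BM := critical_integral_le_ball K_ge0 p_ge2 p_lt_r mOmega S_gt0 sobolev Xv Av.
have HM : H v <= M + C.
  apply: (le_trans (ler_norm _)); apply: (le_trans (HC v Xv)).
  by rewrite mul1r lerD2r.
rewrite /functional => J0.
have h1 : mu / r * B v <= mu / r * (2 `^ r * B v).
  by rewrite ler_wpM2l ?divr_ge0 ?(ltW mu0) ?(ltW r0)// ler_peMl.
have h2 : (2 `^ p)^-1 * A v <= 2^-1 * A v.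
  by rewrite ler_wpM2r// lef_pV2 ?posrE ?powR_gt0.
have h3 : p^-1 * ((2 `^ p)^-1 * A v) <= p^-1 * (2^-1 * A v).
  by rewrite ler_wpM2l// invr_ge0 ltW.
have h4 : lam * H v <= lam * (M + C) by rewrite ler_wpM2l// ltW.
have h5 : p^-1 * (2^-1 * A v) <= lam * (M + C).
  move: J0 absv h1 h3 h4.
  move: (mu / r * (2 `^ r * B v)) (p^-1 * ((2 `^ p)^-1 * A v)) (mu / r * B v) (lam * H v).
  move: (A v) => a x1 x2 x3 x4; have -> : p^-1 * (2^-1 * a) = (p^-1 * a) / 2 by ring.
  lra.
have h6 : A v = p^-1 * (2^-1 * A v) * (2 * p) by field; rewrite gt_eqF.
rewrite h6; apply: le_lt_trans lamL; rewrite [leRHS]mulrC [leRHS]mulrCA.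
rewrite [leRHS](_ : _ = lam * (M + C + 1) * (2 * p)); last by ring.
rewrite ler_wpM2r ?mulr_ge0 ?(ltW p0)//; apply: (le_trans h5).
by rewrite ler_wpM2l ?(ltW lam0)// lerDl.
Qed.
End interior_minimizer.

(** * The Euler-Lagrange equation *)

Lemma normr_powR_mul_le (R : realType) (p m a b : R) : 2 <= p -> `|a| <= m -> `|b| <= m ->
  `| `|a| `^ (p - 2) * a * b| <= m `^ p.
Proof.
move=> p2 am bm; have m0 : 0 <= m by apply: le_trans am.
move: m0; rewrite le_eqVlt => /predU1P[m0|m0].
  by move: am; rewrite -m0 normr_le0 => /eqP ->; rewrite mulr0 mul0r normr0 powR_ge0.
have -> : m `^ p = m `^ (p - 2) * m * m.
  rewrite [in LHS](_ : p = p - 2 + 1 + 1); last by ring.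
  by rewrite (gt0_powRD (p - 2 + 1) 1 m0) (gt0_powRD (p - 2) 1 m0) powRr1// ltW.
rewrite !normrM ger0_norm ?powR_ge0// ler_pM// ?mulr_ge0 ?powR_ge0//.
by rewrite ler_pM ?powR_ge0// le_powR2// subr_ge0.
Qed.

Section integrable_real.
Context d (T : measurableType d) (R : realType) (mu : {measure set T -> \bar R}).
Variables (D : set T) (mD : measurable D).
Implicit Types f g : T -> R.

Lemma integrable_realZ (k : R) f : mu.-integrable D (EFin \o f) ->
  mu.-integrable D (EFin \o (fun x => k * f x)).
Proof. by move=> fi; exact: (integrableZl mD k fi). Qed.

Lemma integrable_realD f g : mu.-integrable D (EFin \o f) ->
  mu.-integrable D (EFin \o g) -> mu.-integrable D (EFin \o (fun x => f x + g x)).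
Proof. by move=> fi gi; exact: (integrableD mD fi gi). Qed.
End integrable_real.

Section euler_lagrange.
Context d (T : measurableType d) (R : realType)
  (L : {sigma_finite_measure set T -> \bar R}).
Variables (K : T * T -> R) (p r S : R) (Omega : set T) (h : T -> R -> R) (a1 a2 q : R).
Local Notation L2 := (L \x L)%E.
Hypothesis K_ge0 : forall z, 0 <= K z.
Hypothesis mK : measurable_fun setT K.
Hypothesis p_ge2 : 2 <= p.
Hypothesis p_lt_r : p < r.
Hypothesis mOmega : measurable Omega.
Hypothesis Omega_fin : (L Omega < +oo)%E.
Local Notation E := (gagliardo_energy L K p).
Local Notation A := (renergy L K p).
Local Notation X0 := (X0 L K p Omega).
Hypothesis S_gt0 : 0 < S.
Hypothesis sobolev : forall (u : T -> R) (e : R), measurable_fun setT u -> 0 <= e ->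
  (\int[L]_x (`|u x| `^ p)%:E < +oo)%E -> (E u <= e%:E)%E ->
  (\int[L]_x (`|u x| `^ r)%:E <= (S * e `^ (r / p))%:E)%E.
Hypothesis mh : forall t, measurable_fun setT (h ^~ t).
Hypothesis ch : forall x, continuous (h x).
Hypothesis a1_gt0 : 0 < a1.
Hypothesis a2_gt0 : 0 < a2.
Hypothesis q_ge1 : 1 <= q.
Hypothesis q_lt_r : q < r.
Hypothesis h_growth : forall x t, `|h x t| <= a1 + a2 * `|t| `^ (q - 1).
Local Notation B := (critical_integral L r Omega).
Local Notation H := (primitive_integral L Omega h).
Local Notation J := (functional L K p r Omega h).
Let p0 : 0 < p. Proof. by move: p_ge2; lra. Qed.
Let r0 : 0 < r. Proof. by move: p0 p_lt_r; lra. Qed.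
Let r2 : 2 <= r. Proof. by move: p_ge2 p_lt_r; lra. Qed.

Definition first_variation_integrand (u phi : T -> R) (z : T * T) : R :=
  `|u z.1 - u z.2| `^ (p - 2) * (u z.1 - u z.2) * (phi z.1 - phi z.2) * K z.

Let t01_le (t : R) (x y : R) : 0 <= t <= 1 -> `|x + t * y| <= `|x| + `|y|.
Proof.
move=> /andP[t0 t1]; apply: (le_trans (ler_normD _ _)); rewrite lerD2l normrM ger0_norm//.
by rewrite ler_piMl.
Qed.

Let le_normDr (x y : R) : `|y| <= `|x| + `|y|.
Proof. by rewrite lerDr. Qed.

(** The derivative of |t| ^ p along the segment from Du to Du + D phi is dominated by p *
    (|Du| + |D phi|) ^ p, where D denotes the difference between two points. *)
Lemma energy_variation u phi : X0 u -> X0 phi ->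
  L2.-integrable setT (EFin \o first_variation_integrand u phi) /\
  n.+1%:R * (A (fun x => u x + n.+1%:R^-1 * phi x) - A u) @[n --> \oo] -->
    p * \int[L2]_z first_variation_integrand u phi z.
Proof.
move=> Xu Xphi.
pose a (z : T * T) : R := u z.1 - u z.2.
pose b (z : T * T) : R := phi z.1 - phi z.2.
pose F (z : T * T) (t : R) : R := `|t| `^ p * K z.
pose f (z : T * T) (t : R) : R := p * (`|t| `^ (p - 2) * t) * K z.
pose g (z : T * T) : R := p * 2 `^ p * (`|a z| `^ p * K z + `|b z| `^ p * K z).
have ig : L2.-integrable setT (EFin \o g).
  apply: (integrable_realZ measurableT).
  exact: (integrable_realD measurableT (integrable_energy K_ge0 mK Xu) (integrable_energy K_ge0 mK Xphi)).
have dF z (t : R) : [set: T * T] z -> is_derive t (1 : R) (F z) (f z t).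
  move=> _; have := is_derive_normr_powR t p_ge2 => Ht.
  rewrite (_ : F z = (K z) \*: (fun t : R => `|t| `^ p)); last first.
    by apply/funext => x; rewrite /F mulrC.
  by rewrite /f mulrC; exact: is_deriveZ.
have fg z (t : R) : [set: T * T] z -> 0 <= t <= 1 -> `|f z (a z + t * b z) * b z| <= g z.
  move=> _ t01; rewrite /f /g.
  rewrite (_ : p * _ * K z * b z = p * (`|a z + t * b z| `^ (p - 2) * (a z + t * b z) * b z) * K z); last by ring.
  rewrite [leRHS](_ : _ = p * (2 `^ p * (`|a z| `^ p + `|b z| `^ p)) * K z); last by ring.
  rewrite normrM (ger0_norm (K_ge0 z)) ler_wpM2r// normrM (gtr0_norm p0) ler_wpM2l ?(ltW p0)//.
  have := @normr_powR_mul_le R p (`|a z| + `|b z|) _ _ p_ge2 (t01_le (a z) (b z) t01) (le_normDr _ _).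
  move=> /le_trans; apply.
  have := normr_powRD_le2 `|a z| `|b z| (ltW p0).
  by rewrite !normr_id ger0_norm// addr_ge0.
have XD (t : R) : X0 (fun x => u x + t * phi x) by apply: X0_D => //; exact: X0_Z.
have FE (t : R) : (fun z => F z (a z + t * b z)) =
    (fun z : T * T => `|(u z.1 + t * phi z.1) - (u z.2 + t * phi z.2)| `^ p * K z).
  apply/funext => z; rewrite /F /a /b; congr (`|_| `^ _ * _); ring.
have iF (t : R) : 0 <= t <= 1 -> L2.-integrable setT (fun z => (F z (a z + t * b z))%:E).
  move=> _; rewrite (_ : (fun z => _) = EFin \o (fun z => F z (a z + t * b z)))// FE.
  exact: (integrable_energy K_ge0 mK (XD t)).
have ma : measurable_fun setT a.
  by apply: measurable_funB; apply: measurableT_comp => //; exact: X0_measurable Xu.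
have mb : measurable_fun setT b.
  by apply: measurable_funB; apply: measurableT_comp => //; exact: X0_measurable Xphi.
have mfab : measurable_fun setT (fun z => f z (a z) * b z).
  apply: measurable_funM => //; apply: measurable_funM => //; apply: measurable_funM => //.
  by apply: measurable_funM => //; exact: measurable_normr_powR.
have [iw cw] := cvg_integral_difference_quotient measurableT ig dF fg iF mfab.
have wE z : first_variation_integrand u phi z = p^-1 * (f z (a z) * b z).
  by rewrite /first_variation_integrand /f -/(a z) -/(b z); field; rewrite gt_eqF.
have iw' : L2.-integrable setT (EFin \o first_variation_integrand u phi).
  rewrite (_ : first_variation_integrand u phi = (fun z => p^-1 * (f z (a z) * b z))); last exact/funext.
  exact: (integrable_realZ measurableT p^-1 iw).
split; first exact: iw'.
have -> : p * \int[L2]_z first_variation_integrand u phi z = \int[L2]_z (f z (a z) * b z).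
  rewrite -RintegralZl//; apply: eq_Rintegral => z _.
  by rewrite wE mulrA mulfV ?mul1r// gt_eqF.
have E1 (t : R) : \int[L2]_z F z (a z + t * b z) = A (fun x => u x + t * phi x).
  rewrite /renergy /gagliardo_energy /Rintegral; apply: (congr1 fine).
  apply: eq_integral => z _; apply: (congr1 EFin).
  exact: (congr1 (fun k => k z) (FE t)).
have E0 : \int[L2]_z F z (a z) = A u.
  rewrite /renergy /gagliardo_energy /Rintegral; apply: (congr1 fine).
  exact: eq_integral.
rewrite (_ : (fun n => _) = (fun n => n.+1%:R *
    (\int[L2]_z F z (a z + n.+1%:R^-1 * b z) - \int[L2]_z F z (a z)))).
  exact: cw.
by apply/funext => n; rewrite E1 E0.
Qed.

Lemma critical_variation u phi : X0 u -> X0 phi ->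
  L.-integrable Omega (EFin \o (fun x => `|u x| `^ (r - 2) * u x * phi x)) /\
  n.+1%:R * (B (fun x => u x + n.+1%:R^-1 * phi x) - B u) @[n --> \oo] -->
    r * \int[L]_(x in Omega) (`|u x| `^ (r - 2) * u x * phi x).
Proof.
move=> Xu Xphi.
pose F (x : T) (t : R) : R := `|t| `^ r.
pose f (x : T) (t : R) : R := r * (`|t| `^ (r - 2) * t).
pose g (x : T) : R := r * 2 `^ r * (`|u x| `^ r + `|phi x| `^ r).
have ic v : X0 v -> L.-integrable Omega (EFin \o (fun x => `|v x| `^ r)).
  exact: (integrable_critical K_ge0 mOmega sobolev).
have ig : L.-integrable Omega (EFin \o g).
  apply: (integrable_realZ mOmega).
  exact: (integrable_realD mOmega (ic _ Xu) (ic _ Xphi)).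
have dF x (t : R) : Omega x -> is_derive t (1 : R) (F x) (f x t).
  by move=> _; exact: is_derive_normr_powR.
have fg x (t : R) : Omega x -> 0 <= t <= 1 -> `|f x (u x + t * phi x) * phi x| <= g x.
  move=> _ t01; rewrite /f /g.
  rewrite -[X in `|X|]mulrA normrM (gtr0_norm r0) -[leRHS]mulrA ler_wpM2l ?(ltW r0)//.
  have := @normr_powR_mul_le R r (`|u x| + `|phi x|) _ _ r2 (t01_le (u x) (phi x) t01) (le_normDr _ _).
  move=> /le_trans; apply.
  have := normr_powRD_le2 `|u x| `|phi x| (ltW r0).
  by rewrite !normr_id ger0_norm// addr_ge0.
have XD (t : R) : X0 (fun x => u x + t * phi x) by apply: X0_D => //; exact: X0_Z.
have iF (t : R) : 0 <= t <= 1 -> L.-integrable Omega (fun x => (F x (u x + t * phi x))%:E).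
  by move=> _; exact: (ic _ (XD t)).
have mS v : X0 v -> measurable_fun Omega v.
  by move=> Xv; apply: (@measurable_funS _ _ _ _ setT) => //; exact: X0_measurable Xv.
have mfab : measurable_fun Omega (fun x => f x (u x) * phi x).
  apply: measurable_funM; last exact: mS.
  apply: measurable_funM; first exact: measurable_cst.
  by apply: measurable_funM; [apply: measurable_normr_powR|]; exact: mS.
have [iw cw] := cvg_integral_difference_quotient mOmega ig dF fg iF mfab.
have wE x : `|u x| `^ (r - 2) * u x * phi x = r^-1 * (f x (u x) * phi x).
  by rewrite /f; field; rewrite gt_eqF.
have iw' : L.-integrable Omega (EFin \o (fun x => `|u x| `^ (r - 2) * u x * phi x)).
  rewrite (_ : (fun x => _) = (fun x => r^-1 * (f x (u x) * phi x))); last exact/funext.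
  exact: (integrable_realZ mOmega r^-1 iw).
split; first exact: iw'.
have -> : r * \int[L]_(x in Omega) (`|u x| `^ (r - 2) * u x * phi x) = \int[L]_(x in Omega) (f x (u x) * phi x).
  rewrite -RintegralZl//; apply: eq_Rintegral => x _.
  by rewrite wE mulrA mulfV ?mul1r// gt_eqF.
exact: cw.
Qed.

Lemma primitive_variation u phi : X0 u -> X0 phi ->
  L.-integrable Omega (EFin \o (fun x => h x (u x) * phi x)) /\
  n.+1%:R * (H (fun x => u x + n.+1%:R^-1 * phi x) - H u) @[n --> \oo] -->
    \int[L]_(x in Omega) (h x (u x) * phi x).
Proof.
move=> Xu Xphi.
have q0 : 0 < q by move: q_ge1; lra.
have r1 : 1 <= r by move: r2; lra.
pose k := 2 `^ r * (a1 + a2).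
pose g (x : T) : R := k * (`|u x| `^ r) + (k * `|phi x| `^ r + (a1 + a2)).
have ig : L.-integrable Omega (EFin \o g).
  apply: (integrable_realD mOmega (integrable_realZ mOmega k (integrable_critical K_ge0 mOmega sobolev Xu))).
  exact: (integrable_critical_affine K_ge0 mOmega Omega_fin sobolev k (a1 + a2) Xphi).
have dF x (t : R) : Omega x -> is_derive t (1 : R) (primitive (h x)) (h x t).
  by move=> _; apply: is_derive_primitive; exact: ch.
have fg x (t : R) : Omega x -> 0 <= t <= 1 -> `|h x (u x + t * phi x) * phi x| <= g x.
  move=> _ t01; pose m : R := `|u x| + `|phi x|.
  have m0 : 0 <= m by rewrite addr_ge0.
  rewrite normrM; apply: (@le_trans _ _ ((a1 + a2 * m `^ (q - 1)) * m)).
    apply: ler_pM => //; last by rewrite lerDr.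
    apply: (le_trans (h_growth _ _)); rewrite lerD2l ler_wpM2l ?(ltW a2_gt0)//.
    by rewrite le_powR2 ?subr_ge0//; exact: t01_le.
  rewrite mulrDl -mulrA [_ `^ _ * _]mulrC mulr_powRB1//.
  have h1 := @normr_powR_le_affine R 1 r m ler01 r1.
  have h2 := @normr_powR_le_affine R q r m (ltW q0) (ltW q_lt_r).
  rewrite !(ger0_norm m0) ?powRr1// !mul1r in h1 h2.
  have h3 : m `^ r <= 2 `^ r * (`|u x| `^ r + `|phi x| `^ r).
    have := normr_powRD_le2 `|u x| `|phi x| (ltW r0).
    by rewrite !normr_id (ger0_norm m0).
  apply: (@le_trans _ _ ((a1 + a2) * (m `^ r + 1))).
    by rewrite mulrDl lerD// ler_wpM2l// ltW.
  have a0 : 0 <= a1 + a2 by rewrite addr_ge0// ltW.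
  have := ler_wpM2l a0 h3; rewrite /g /k [(a1 + a2) * (m `^ r + 1)]mulrDr mulr1.
  move: (m `^ r) (`|u x| `^ r) (`|phi x| `^ r) (2 `^ r) => y1 y2 y3 y4 h4.
  by rewrite [leRHS]addrA lerD2r; apply: (le_trans h4); rewrite le_eqVlt; apply/orP; left; apply/eqP; ring.
have XD (t : R) : X0 (fun x => u x + t * phi x) by apply: X0_D => //; exact: X0_Z.
have iF (t : R) : 0 <= t <= 1 -> L.-integrable Omega (fun x => (primitive (h x) (u x + t * phi x))%:E).
  move=> _; exact: (integrable_primitive K_ge0 mOmega Omega_fin sobolev mh ch a1_gt0 a2_gt0 q_ge1 q_lt_r h_growth (XD t)).
have mfab : measurable_fun Omega (fun x => h x (u x) * phi x).
  apply: (@measurable_funS _ _ _ _ setT) => //; apply: measurable_funM.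
    by apply: measurable_fun_caratheodory => //; exact: X0_measurable Xu.
  exact: X0_measurable Xphi.
exact: (cvg_integral_difference_quotient mOmega ig dF fg iF mfab).
Qed.

(** The functions u + phi / (n + 1) enter every energy ball around u, so that the
    difference quotients of J at u in the direction phi are eventually nonnegative; the
    left-hand side is their limit. *)
Lemma first_variation_ge0 (mu lam tau : R) u phi : X0 u -> X0 phi -> 0 < tau ->
  (forall v, X0 v -> A (fun x => v x - u x) <= tau -> J mu lam u <= J mu lam v) ->
  0 <= \int[L2]_z first_variation_integrand u phi z
    - mu * \int[L]_(x in Omega) (`|u x| `^ (r - 2) * u x * phi x)
    - lam * \int[L]_(x in Omega) (h x (u x) * phi x).
Proof.
move=> Xu Xphi tau0 umin.
have [_ cA] := energy_variation Xu Xphi.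
have [_ cB] := critical_variation Xu Xphi.
have [_ cH] := primitive_variation Xu Xphi.
set W := \int[L2]_z first_variation_integrand u phi z in cA *.
set C := \int[L]_(x in Omega) (`|u x| `^ (r - 2) * u x * phi x) in cB *.
set P := \int[L]_(x in Omega) (h x (u x) * phi x) in cH *.
pose v (n : nat) x := u x + n.+1%:R^-1 * phi x.
have cJ : n.+1%:R * (J mu lam (v n) - J mu lam u) @[n --> \oo] --> W - mu * C - lam * P.
  have -> : W - mu * C - lam * P = p^-1 * (p * W) - mu / r * (r * C) - lam * P.
    by field; rewrite !gt_eqF.
  rewrite (_ : (fun n => _) = (fun n => p^-1 * (n.+1%:R * (A (v n) - A u)) -
      mu / r * (n.+1%:R * (B (v n) - B u)) - lam * (n.+1%:R * (H (v n) - H u)))).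
    by apply: cvgB; [apply: cvgB|]; apply: cvgMl_tmp; [exact: cA|exact: cB|exact: cH].
  apply/funext => n; rewrite /functional.
  by move: (A (v n)) (A u) (B (v n)) (B u) (H (v n)) (H u) => *; ring.
apply: (cvgr_to_ge cJ).
have ct : `|n.+1%:R^-1| `^ p * A phi @[n --> \oo] --> (0 : R).
  rewrite -[X in _ --> X](mul0r (A phi)); apply: cvgMr_tmp.
  rewrite (_ : 0 = `|0 : R| `^ p); last by rewrite normr0 powR0// gt_eqF.
  by apply: cvg_normr_powR => //; exact: cvg_harmonic.
have nct : \forall n \near \oo, `|n.+1%:R^-1| `^ p * A phi <= tau.
  exact: (cvgr_le _ ct _ tau0).
near=> n.
have Xv : X0 (v n) by apply: X0_D => //; exact: X0_Z.
rewrite mulr_ge0// subr_ge0; apply: umin; first exact: Xv.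
have -> : (fun x => v n x - u x) = (fun x => n.+1%:R^-1 * phi x).
  by apply/funext => x; rewrite /v addrAC subrr add0r.
rewrite /renergy energyZ//; last exact: X0_measurable Xphi.
rewrite (renergyE K_ge0 Xphi) -EFinM /=.
by near: n; exact: nct.
Unshelve. all: by end_near. Qed.

(** The first variation is odd in phi and nonnegative in the directions phi and - phi. *)
Lemma euler_lagrange (mu lam tau : R) u : X0 u -> 0 < tau ->
  (forall v, X0 v -> A (fun x => v x - u x) <= tau -> J mu lam u <= J mu lam v) ->
  forall phi, X0 phi ->
  [/\ L2.-integrable setT (EFin \o first_variation_integrand u phi),
    L.-integrable Omega (EFin \o (fun x =>
      (mu * `|u x| `^ (r - 2) * u x + lam * h x (u x)) * phi x)) &
    \int[L2]_z first_variation_integrand u phi z =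
    \int[L]_(x in Omega) ((mu * `|u x| `^ (r - 2) * u x + lam * h x (u x)) * phi x)].
Proof.
move=> Xu tau0 umin phi Xphi.
have [iW _] := energy_variation Xu Xphi.
have [iC _] := critical_variation Xu Xphi.
have [iP _] := primitive_variation Xu Xphi.
have fE : (fun x => (mu * `|u x| `^ (r - 2) * u x + lam * h x (u x)) * phi x) =
    (fun x => mu * (`|u x| `^ (r - 2) * u x * phi x) + lam * (h x (u x) * phi x)).
  by apply/funext => x; ring.
have iZC := integrable_realZ mOmega mu iC.
have iZP := integrable_realZ mOmega lam iP.
split; first exact: iW.
  by rewrite fE; exact: integrable_realD.
rewrite fE RintegralD// RintegralZl// RintegralZl//.
have XN := X0_N K_ge0 mK Xphi.
have := first_variation_ge0 Xu Xphi tau0 umin.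
have := first_variation_ge0 Xu XN tau0 umin.
have -> : \int[L2]_z first_variation_integrand u (fun x => - phi x) z =
    - \int[L2]_z first_variation_integrand u phi z.
  rewrite -[RHS]mulN1r -RintegralZl//; apply: eq_Rintegral => z _.
  by rewrite /first_variation_integrand; ring.
have -> : \int[L]_(x in Omega) (`|u x| `^ (r - 2) * u x * - phi x) =
    - \int[L]_(x in Omega) (`|u x| `^ (r - 2) * u x * phi x).
  by rewrite -[RHS]mulN1r -RintegralZl//; apply: eq_Rintegral => x _; ring.
have -> : \int[L]_(x in Omega) (h x (u x) * - phi x) =
    - \int[L]_(x in Omega) (h x (u x) * phi x).
  by rewrite -[RHS]mulN1r -RintegralZl//; apply: eq_Rintegral => x _; ring.
set W := \int[L2]_z _; set C := \int[L]_(x in Omega) _; set P := \int[L]_(x in Omega) _.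
move: W C P => W C P h1 h2; apply/eqP; rewrite eq_le; apply/andP; split; move: h1 h2.
- by rewrite mulrN mulrN; move: (mu * C) (lam * P) => y z; lra.
- by rewrite mulrN mulrN; move: (mu * C) (lam * P) => y z; lra.
Qed.
End euler_lagrange.

(** * Measurability of open sets and continuous functions on R^n *)

Section borel_sets.
Variables (R : realType).
Implicit Types n : nat.

(** Rounding down to the grid of mesh 1 / (k + 1) approximates the identity of R^n by
    functions with countably many values. *)
Definition grid_index n (k : nat) (x : 'rV[R]_n) : 'rV[int]_n :=
  \row_j Num.floor (k.+1%:R * x ord0 j).
Definition grid_point n (k : nat) (i : 'rV[int]_n) : 'rV[R]_n :=
  \row_j ((i ord0 j)%:~R / k.+1%:R).

Lemma grid_point_close n k (x : 'rV[R]_n) j :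
  `|grid_point k (grid_index k x) ord0 j - x ord0 j| <= k.+1%:R^-1.
Proof.
have k0 : 0 < k.+1%:R :> R by rewrite ltr0n.
rewrite !mxE; have /andP[h1 h2] := floor_itv (k.+1%:R * x ord0 j).
have -> : (Num.floor (k.+1%:R * x ord0 j))%:~R / k.+1%:R - x ord0 j =
   - ((k.+1%:R * x ord0 j - (Num.floor (k.+1%:R * x ord0 j))%:~R) / k.+1%:R).
  by field; rewrite gt_eqF.
rewrite normrN ger0_norm; last by rewrite divr_ge0 ?subr_ge0// ltW.
rewrite ler_pdivrMr// mulVf ?gt_eqF//; move: h2; rewrite intrD; lra.
Qed.

Lemma cvg_grid_point n (x : 'rV[R]_n) :
  grid_point k (grid_index k x) @[k --> \oo] --> x.
Proof.
apply/cvg_ballP => e e0; near=> k; split => // i j.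
rewrite ord1 /ball/= distrC; apply: (le_lt_trans (grid_point_close k x j)).
near: k; exact: (near_infty_natSinv_lt (PosNum e0)).
Unshelve. all: by end_near. Qed.

Lemma measurable_grid_index n k (i : 'rV[int]_n) :
  measurable ((@grid_index n k : borel_rV R n -> 'rV[int]_n) @^-1` [set i]).
Proof.
rewrite (_ : _ @^-1` _ = \bigcap_(j in [set: 'I_n])
   ((fun x : borel_rV R n => (x : 'rV[R]_n) ord0 j : measurableTypeR R) @^-1`
     [set t | Num.floor (k.+1%:R * t) = i ord0 j])).
  apply: fin_bigcap_measurable; first exact: finite_finset.
  move=> j _; rewrite -[X in measurable X]setTI; apply: measurable_coord_rV => //.
  rewrite (_ : [set t | _] = (fun t : R => k.+1%:R * t) @^-1` `[(i ord0 j)%:~R, (i ord0 j + 1)%:~R[).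
    rewrite -[X in measurable X]setTI.
    by have := @measurable_funM _ _ R setT (cst k.+1%:R) id; apply => //.
  apply/seteqP; split => t /=; rewrite in_itv/=.
    by move=> <-; exact: floor_itv.
  exact: floor_def.
apply/seteqP; split => x /=.
  by move=> <- j _ /=; rewrite mxE.
by move=> H; apply/rowP => j; rewrite mxE; exact: H.
Qed.

(** An open set is the union over k of the grid cells of mesh 1 / (k + 1) all of whose 1 /
    (k + 1)-close points lie in it, and there are countably many cells. *)
Lemma open_measurable_rV n (A : set 'rV[R]_n) : open A -> measurable (A : set (borel_rV R n)).
Proof.
move=> oA.
pose good k (i : 'rV[int]_n) := forall y : 'rV[R]_n,
  (forall j, `|grid_point k i ord0 j - y ord0 j| <= k.+1%:R^-1) -> A y.
rewrite (_ : A = \bigcup_k \bigcup_(i in [set i | good k i])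
    ((@grid_index n k : borel_rV R n -> 'rV[int]_n) @^-1` [set i])).
  apply: bigcupT_measurable => k.
  rewrite bigcup_mkcond; apply: countable_bigcupT_measurable => [|i].
    exact: countableP.
  by case: ifPn => _; [exact: measurable_grid_index|exact: measurable0].
apply/seteqP; split => x /=; last first.
  by move=> [k _ [i gi /= xi]]; apply: gi => j; rewrite -xi; exact: grid_point_close.
move=> Ax; have /nbhs_ballP[e /= e0 xeA] : nbhs x A by apply: open_nbhs_nbhs.
have e20 : 0 < e / 2 by rewrite divr_gt0.
near \oo => k.
exists k => //; exists (grid_index k x) => //= y gy.
apply: xeA; split => // i j; rewrite ord1 /ball/=.
have ke : k.+1%:R^-1 < e / 2 by near: k; exact: (near_infty_natSinv_lt (PosNum e20)).
have := gy j; have := grid_point_close k x j.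
move=> g1 g2; rewrite (_ : x ord0 j - y ord0 j = (grid_point k (grid_index k x) ord0 j - y ord0 j) -
  (grid_point k (grid_index k x) ord0 j - x ord0 j)); last by ring.
apply: (le_lt_trans (ler_normB _ _)); apply: (le_lt_trans (lerD g2 g1)).
by rewrite (splitr e) ltrD.
Unshelve. all: by end_near. Qed.

Lemma continuous_measurable_rV n (f : 'rV[R]_n -> R) : continuous f ->
  measurable_fun [set: borel_rV R n] f.
Proof.
move=> cf.
apply: (@measurable_fun_subst_cvg _ (borel_rV R n) R 'rV[R]_n 'rV[int]_n (fun _ => f) id
  (@grid_index n) (@grid_point n)) => [k i|k i|x].
- exact: measurable_grid_index.
- exact: measurable_cst.
- by apply: continuous_cvg; [exact: cf|exact: cvg_grid_point].
Qed.

Lemma sub_lebesgue_measurable n (A : set (borel_rV R n)) : measurable A ->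
  measurable (A : set (lebesgue_space R n)).
Proof. by move=> mA; apply: sub_caratheodory; exact: sub_sigma_algebra. Qed.

Lemma lebesgue_rVE n (A : set (borel_rV R n)) : measurable A ->
  lebesgue_rV (A : set (lebesgue_space R n)) = borel_lebesgue_rV R n A.
Proof. by move=> mA; exact: measurable_mu_extE. Qed.

Lemma measurable_lebesgue_of_borel n (f : 'rV[R]_n -> R) :
  measurable_fun [set: borel_rV R n] f -> measurable_fun [set: lebesgue_space R n] f.
Proof.
move=> mf _ Y mY; have := mf measurableT Y mY; exact: sub_lebesgue_measurable.
Qed.

(** The second point is rounded to the grid, which leaves countably many functions of the
    first point alone. *)
Lemma continuous_measurable_pair n (f : 'rV[R]_n -> 'rV[R]_n -> R) :
  (forall x, continuous (f x)) -> (forall y, continuous (f ^~ y)) ->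
  measurable_fun [set: lebesgue_space R n * lebesgue_space R n] (fun z => f z.1 z.2).
Proof.
move=> cx cy.
apply: (@measurable_fun_subst_cvg _ _ R 'rV[R]_n 'rV[int]_n
  (fun z : lebesgue_space R n * lebesgue_space R n => f z.1) snd
  (fun k z => grid_index k z.2) (@grid_point n)) => [k i|k i|z].
- rewrite -[X in measurable X]setTI.
  exact: (@measurable_snd _ _ (lebesgue_space R n) (lebesgue_space R n) measurableT _
    (sub_lebesgue_measurable (measurable_grid_index k i))).
- have mf := measurable_lebesgue_of_borel (continuous_measurable_rV (cy (grid_point k i))).
  exact: (measurableT_comp mf measurable_fst).
- by apply: continuous_cvg; [exact: cx|exact: cvg_grid_point].
Qed.
End borel_sets.

(** * Triangular maps and Lebesgue measure *)

Section affine_line.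
Variables (R : realType) (d c : R) (d_gt0 : 0 < d).
Local Notation leb := (@lebesgue_measure R).

Let aff (a : measurableTypeR R) : measurableTypeR R := d * a + c.

Let measurable_aff : measurable_fun setT aff.
Proof.
apply: measurable_funD; last exact: measurable_cst.
by apply: measurable_funM; [exact: measurable_cst|exact: measurable_id].
Qed.

Let pushforward_aff : exists m : {measure set (measurableTypeR R) -> \bar R},
  (m : set R -> \bar R) = pushforward leb aff.
Proof. by unshelve eexists (pushforward leb aff); [exact: measurable_aff|]. Qed.

(** Both sides are measures in A, up to the factor d, and agree on half-open intervals. *)
Lemma lebesgue_measure_affine_preimage (A : set R) : measurable A ->
  leb (aff @^-1` A) = ((d^-1)%:E * leb A)%E.
Proof.
move=> mA; have [m mE] := pushforward_aff.
have -> : leb A = mscale (NngNum (ltW d_gt0)) m A.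
  apply: lebesgue_measure_unique => // _ [[a b] _ <-] /=.
  rewrite /mscale/= mE /pushforward.
  have -> : aff @^-1` [set` `]a, b]] = [set` `](a - c) / d, (b - c) / d]].
    apply/seteqP; split => x /=; rewrite !in_itv/= /aff ltr_pdivrMr// ler_pdivlMr//;
      move=> /andP[h1 h2]; apply/andP; split; lra.
  rewrite !lebesgue_measure_itv/= !lte_fin ltr_pM2r ?invr_gt0// ltrD2r.
  case: ifPn => ab; last by rewrite mule0.
  rewrite -!EFinB -EFinM; congr EFin; field; by rewrite gt_eqF.
rewrite /mscale/= mE /pushforward muleA -EFinM mulVf ?gt_eqF// mul1e.
by [].
Qed.

Lemma ge0_integral_affine (f : R -> \bar R) : measurable_fun setT f -> (forall x, (0 <= f x)%E) ->
  (\int[leb]_x f (d * x + c)%R = (d^-1)%:E * \int[leb]_x f x)%E.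
Proof.
move=> mf f0; have [m mE] := pushforward_aff.
have -> : (\int[leb]_x f (d * x + c)%R = \int[m]_x f x)%E.
  by rewrite mE (@ge0_integral_pushforward _ _ _ _ _ aff).
have dV0 : 0 <= d^-1 by rewrite invr_ge0 ltW.
rewrite -(ge0_integral_mscale leb measurableT (NngNum dV0))//.
apply: (@eq_measure_integral _ _ _ _ (mscale (NngNum dV0) leb) m) => A mA _.
by rewrite mE; exact: lebesgue_measure_affine_preimage.
Qed.
End affine_line.

Section triangular.
Variable R : realType.

(** The difference y' - y is a combination of the unit vectors along which f is constant. *)
Lemma eq_off_coordinates n (U : Type) (P : pred 'I_n) (f : 'rV[R]_n -> U) :
  (forall y c l, P l -> f (y + c *: delta_mx ord0 l) = f y) ->
  forall y y' : 'rV[R]_n, (forall l, ~~ P l -> y ord0 l = y' ord0 l) -> f y = f y'.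
Proof.
move=> fP y y' yy'.
have H (sq : seq 'I_n) (z w : 'rV[R]_n) : (forall l, ~~ P l -> z ord0 l = 0) ->
    f (w + \sum_(l <- sq) z ord0 l *: delta_mx ord0 l) = f w.
  move=> z0; elim: sq w => [|l sq IH] w; first by rewrite big_nil addr0.
  rewrite big_cons addrA IH; have [Pl|nPl] := boolP (P l); first exact: fP.
  by rewrite z0// scale0r addr0.
have yE : y' = y + \sum_(l <- index_enum 'I_n) (y' - y) ord0 l *: delta_mx ord0 l.
  by rewrite -row_sum_delta addrC subrK.
rewrite [in RHS]yE H// => l Pl.
by rewrite !mxE yy'// subrr.
Qed.

(** The coordinate f_j depends on y_0, ..., y_j only, and is affine in y_j with slope d j.
    Increments along unit vectors express this without derivatives and without splitting
    vectors. *)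
Definition triangular n (d : 'I_n -> R) (f : 'rV[R]_n -> 'rV[R]_n) :=
  forall (j l : 'I_n) (y : 'rV[R]_n) (c : R), (j <= l)%N ->
    f (y + c *: delta_mx ord0 l) ord0 j = f y ord0 j + (l == j)%:R * (d j * c).

Lemma cons_rVD n (a : R) (w : 'rV[R]_n) (c : R) (l : 'I_n) :
  cons_rV (a, w + c *: delta_mx ord0 l) =
  (cons_rV (a, w) : 'rV[R]_n.+1) + c *: delta_mx ord0 (lift ord0 l) :> 'rV[R]_n.+1.
Proof.
apply/rowP => j; rewrite [RHS]mxE.
have [i ->|->] := unliftP ord0 j.
  rewrite (cons_rVS (a, w + c *: delta_mx ord0 l)) (cons_rVS (a, w)) /= !mxE /=.
  by rewrite (inj_eq (@lift_inj _ _)).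
rewrite (cons_rV0 (a, w + c *: delta_mx ord0 l)) (cons_rV0 (a, w)) /= !mxE /=.
by rewrite mulr0 addr0.
Qed.

Lemma cons_rV_first n (a c : R) (w : 'rV[R]_n) :
  cons_rV (a + c, w) =
  (cons_rV (a, w) : 'rV[R]_n.+1) + c *: delta_mx ord0 ord0 :> 'rV[R]_n.+1.
Proof.
apply/rowP => j; rewrite [RHS]mxE.
have [i ->|->] := unliftP ord0 j.
  by rewrite (cons_rVS (a + c, w)) (cons_rVS (a, w)) /= !mxE /= mulr0 addr0.
by rewrite (cons_rV0 (a + c, w)) (cons_rV0 (a, w)) /= !mxE /= mulr1.
Qed.

(** Induction on the dimension by Fubini's theorem: the first coordinate of f is an affine
    function of y_0 alone, and for a fixed y_0 the remaining coordinates form a triangular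
    map of the remaining variables. *)
Theorem measure_triangular_preimage n (d : 'I_n -> R) (f : 'rV[R]_n -> 'rV[R]_n) :
  (forall j, 0 < d j) -> triangular d f ->
  measurable_fun setT (f : borel_rV R n -> borel_rV R n) ->
  forall A : set (borel_rV R n), measurable A ->
  borel_lebesgue_rV R n (f @^-1` A) = (((\prod_j d j)^-1)%:E * borel_lebesgue_rV R n A)%E.
Proof.
elim: n d f => [d f _ _ _ A _|n IH d f d0 tf mf A mA].
  rewrite big_ord0 invr1 mul1e; congr (borel_lebesgue_rV R 0 _).
  rewrite (_ : f = id)//; apply/funext => x; apply/rowP => j; by case: j.
pose m := borel_lebesgue_rV R n.
have mcA : measurable (@cons_rV R n @^-1` A).
  by rewrite -[X in measurable X]setTI; exact: measurable_cons_rV.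
pose c0 := f (cons_rV (0, 0)) ord0 ord0.
have f0 a w : f (cons_rV (a, w)) ord0 ord0 = d ord0 * a + c0.
  have -> : f (cons_rV (a, w)) ord0 ord0 = f (cons_rV (a, 0)) ord0 ord0.
    apply: (@eq_off_coordinates n _ xpredT (fun w => f (cons_rV (a, w)) ord0 ord0)) => //.
    move=> y c l _; rewrite cons_rVD tf//.
    by rewrite (_ : (lift ord0 l == ord0) = false) ?mul0r ?addr0.
  have -> : cons_rV (a, 0) = cons_rV (0 + a, 0) :> 'rV[R]_n.+1 by rewrite add0r.
  by rewrite cons_rV_first tf// eqxx mul1r addrC.
pose g a (w : 'rV[R]_n) : 'rV[R]_n := \row_j f (cons_rV (a, w)) ord0 (lift ord0 j).
have tg a : triangular (fun j => d (lift ord0 j)) (g a).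
  move=> j l y c jl; rewrite /g !mxE cons_rVD tf; last by rewrite /= /bump !add1n ltnS.
  by rewrite (inj_eq (@lift_inj _ _)).
have mg a : measurable_fun setT (g a : borel_rV R n -> borel_rV R n).
  apply: measurable_rVP => i; under eq_fun do rewrite /g mxE.
  apply: (measurableT_comp (measurable_coord_rV (lift ord0 i))).
  apply: (measurableT_comp mf).
  exact: (measurableT_comp (@measurable_cons_rV R n) (pair1_measurable a)).
have consE a w : f (cons_rV (a, w)) = cons_rV (d ord0 * a + c0, g a w).
  apply/rowP => j; have [i ->|->] := unliftP ord0 j.
    by rewrite (cons_rVS (d ord0 * a + c0, g a w)) /g mxE.
  by rewrite (cons_rV0 (d ord0 * a + c0, g a w)) f0.
have sec a : xsection (@cons_rV R n @^-1` (f @^-1` A)) a =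
    g a @^-1` (xsection (@cons_rV R n @^-1` A) (d ord0 * a + c0)).
  by apply/seteqP; split => w; rewrite /xsection /= !inE /= consE.
pose k := (\prod_j d (lift ord0 j))^-1.
have k0 : 0 <= k by rewrite invr_ge0 prodr_ge0// => j _; exact: ltW.
pose phi (a : R) := m (xsection (@cons_rV R n @^-1` A) a).
have mphi : measurable_fun setT phi by exact: measurable_fun_xsection.
have -> : borel_lebesgue_rV R n.+1 (f @^-1` A) =
    (\int[@lebesgue_measure R]_a (k%:E * phi (d ord0 * a + c0)%R))%E.
  apply: eq_integral => a _ /=; rewrite sec.
  apply: (IH _ _ (fun j => d0 (lift ord0 j)) (tg a) (mg a)).
  exact: measurable_xsection.
rewrite ge0_integralZl_EFin//; last first.
  apply: (measurableT_comp mphi); apply: measurable_funD; last exact: measurable_cst.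
  by apply: measurable_funM; [exact: measurable_cst|exact: measurable_id].
rewrite (@ge0_integral_affine _ _ c0 (d0 ord0))//.
by rewrite muleA -EFinM big_ord_recl /k invfM [(_^-1 * k)%R]mulrC.
Qed.
End triangular.

(** * Dilations and the group law in coordinates *)

Section box.
Variable R : realType.

(** The open ball of radius e at the origin for the sup norm, whose Lebesgue measure is
    explicit. *)
Definition box n (e : R) : set 'rV[R]_n := [set x | forall j, `|x ord0 j| < e].

Lemma measurable_box n e : measurable (@box n e : set (borel_rV R n)).
Proof.
rewrite (_ : @box n e = \bigcap_(j in [set: 'I_n])
   ((fun x : borel_rV R n => (x : 'rV[R]_n) ord0 j : measurableTypeR R) @^-1` `]- e, e[)).
  apply: fin_bigcap_measurable; first exact: finite_finset.
  by move=> j _; rewrite -[X in measurable X]setTI; apply: measurable_coord_rV.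
by apply/seteqP; split => x /=; [move=> H j _|move=> H j; have := H j I];
  rewrite /= in_itv/= -ltr_norml.
Qed.

Lemma borel_lebesgue_box n (e : R) : 0 < e ->
  borel_lebesgue_rV R n (@box n e) = ((2 * e) ^+ n)%:E.
Proof.
move=> e0; elim: n => [|n IH].
  rewrite expr0 [LHS]diracE mem_set// => -[].
  by [].
have -> : borel_lebesgue_rV R n.+1 (@box n.+1 e) =
    (@lebesgue_measure R \x borel_lebesgue_rV R n)%E (`]- e, e[ `*` @box n e).
  congr ((_ \x _)%E _); apply/seteqP; split => -[a w] /=.
    move=> H; split => /=; first by have := H ord0; rewrite (cons_rV0 (a, w)) in_itv/= -ltr_norml.
    by move=> j; have := H (lift ord0 j); rewrite (cons_rVS (a, w)).
  rewrite in_itv/= -ltr_norml => -[ae we] j.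
  by have [i ->|->] := unliftP ord0 j; rewrite ?(cons_rVS (a, w)) ?(cons_rV0 (a, w)).
rewrite product_measure1E//; last exact: measurable_box.
transitivity ((2 * e)%:E * ((2 * e) ^+ n)%:E)%E; last by rewrite -EFinM exprS.
congr (_ * _)%E; last exact: IH.
rewrite [LHS](lebesgue_measure_itv `]- e, e[)/= lte_fin ifT; last by lra.
by rewrite -EFinB; congr EFin; ring.
Qed.

Lemma rV_ball0 n (e : R) (x : 'rV[R]_n) : 0 < e -> ball (0 : 'rV[R]_n) e x <-> @box n e x.
Proof.
move=> e0; split.
  by move=> [_ H] j; have := H ord0 j; rewrite /ball/= mxE sub0r normrN.
by move=> H; split => // i j; rewrite ord1 /ball/= mxE sub0r normrN.
Qed.

Lemma continuous_rV (X : topologicalType) n (f : X -> 'rV[R]_n) :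
  (forall j, continuous (fun x => f x ord0 j)) -> continuous f.
Proof.
move=> cf x; apply/cvg_ballP => e e0.
have : \forall y \near x, forall j : 'I_n, `|f x ord0 j - f y ord0 j| < e.
  apply: filter_forall => j.
  by have /cvgrPdist_lt := cf j x; apply.
by apply: filterS => y H; split => // i j; rewrite ord1 /ball/=; exact: H.
Qed.

Lemma continuous_coord_rV n (j : 'I_n) : continuous (fun x : 'rV[R]_n => x ord0 j).
Proof. exact: coord_continuous. Qed.
End box.

Lemma is_derive_along (R : realType) (V : normedModType R) (f : V -> R) (z v : V) (t a : R) :
  is_derive (z + t *: v) v f a -> is_derive t (1 : R) (fun t : R => f (z + t *: v)) a.
Proof.
have E : (fun h : R => h^-1 *: (((fun t : R => f (z + t *: v)) \o shift t) (h *: (1 : R)) -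
    f (z + t *: v))) = (fun h : R => h^-1 *: ((f \o shift (z + t *: v)) (h *: v) - f (z + t *: v))).
  apply/funext => h /=; congr (_ *: (f _ - _)).
  by rewrite /shift/= [h *: _]mulr1 scalerDl addrCA.
move=> [df dfE]; apply: DeriveDef; first by rewrite /derivable E.
by rewrite /derive E.
Qed.

Section dilations.
Variables (R : realType) (k : nat) (N : 'I_k.+1 -> nat).
Local Notation dim := (\sum_i N i)%N.

(** The number of the layer of the coordinate j, counted from 1. *)
Definition weight (j : 'I_dim) : nat := (tagnat.sig1 j).+1.

Lemma weight_le (j l : 'I_dim) : (j <= l)%N -> (weight j <= weight l)%N.
Proof. by move=> jl; rewrite ltnS; exact: (@tagnat.le_sig1 _ N j l jl). Qed.

Lemma dilationE (l : R) (x : 'rV[R]_dim) j :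
  dilation l x ord0 j = l ^+ weight j * x ord0 j.
Proof. by rewrite /dilation mxE !mxE tagnat.sig2K. Qed.

(** The layer i + 1 has N i coordinates, each of weight i + 1. *)
Lemma sum_weight : (\sum_j weight j = homogeneous_dim N)%N.
Proof.
rewrite /homogeneous_dim.
have E (i : 'I_k.+1) : (i.+1 * N i = \sum_(j < N i) i.+1)%N by rewrite sum_nat_const card_ord mulnC.
under [RHS]eq_bigr => i _ do rewrite E.
rewrite [RHS]sig_big_dep/= [RHS](reindex _ tagnat.sig_bij_on)/=.
by apply: eq_bigr => j _.
Qed.

Lemma continuous_dilation (l : R) : continuous (@dilation R k N l).
Proof.
apply: continuous_rV => j; rewrite (_ : (fun x => _) = (fun x : 'rV[R]_dim => l ^+ weight j * x ord0 j)).
  move=> x; apply: (@continuousM _ _ (cst (l ^+ weight j)) (fun x : 'rV[R]_dim => x ord0 j)).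
    exact: cst_continuous.
  exact: continuous_coord_rV.
by apply/funext => x; rewrite dilationE.
Qed.

Lemma dilationD l (x y : 'rV[R]_dim) : dilation l (x + y) = dilation l x + dilation l y.
Proof. by apply/rowP => j; rewrite [in RHS]mxE !dilationE mxE mulrDr. Qed.

Lemma dilation_delta l c (j : 'I_dim) :
  dilation l (c *: delta_mx ord0 j) = (l ^+ weight j * c) *: delta_mx ord0 j :> 'rV[R]_dim.
Proof.
apply/rowP => i; rewrite dilationE !mxE eqxx/=.
by have [->|] := eqVneq i j; rewrite /= ?mulr1// !mulr0.
Qed.

Lemma dilation0 l : dilation l 0 = 0 :> 'rV[R]_dim.
Proof. by apply/rowP => j; rewrite dilationE !mxE mulr0. Qed.

Lemma cvg_dilation0 (x : 'rV[R]_dim) : dilation n.+1%:R^-1 x @[n --> \oo] --> (0 : 'rV[R]_dim).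
Proof.
apply/cvg_ballP => e e0.
have : \forall n \near \oo, forall j : 'I_dim, `|dilation n.+1%:R^-1 x ord0 j| < e.
  apply: filter_forall => j.
  have : (n.+1%:R^-1 ^+ weight j * x ord0 j) @[n --> \oo] --> (0 ^+ weight j * x ord0 j : R).
    apply: cvgMr_tmp.
    have := @cvg_comp _ _ _ (fun n => n.+1%:R^-1 : R) (fun t : R => t ^+ weight j) _ _ _ (@cvg_harmonic R) (@exprn_continuous R (weight j) 0).
    by [].
  rewrite expr0n mul0r => /cvgr0Pnorm_lt/(_ e e0).
  by apply: filterS => n; rewrite dilationE.
apply: filterS => n H; exact: ((rV_ball0 _ e0).2 H).
Qed.
End dilations.

Section group.
Variables (R : realType) (k : nat) (N : 'I_k.+1 -> nat) (G : stratified_group R N).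
Local Notation dim := (\sum_i N i)%N.
Local Notation V := ('rV[R]_dim * 'rV[R]_dim)%type.

Lemma is_derive_coord_gop (j : 'I_dim) (z v : V) :
  is_derive z v (fun z : V => gop G z.1 z.2 ord0 j)
    (('D_v (fun z : V => gop G z.1 z.2) z) ord0 j).
Proof.
have [_ dF _] := gop_smooth G 1%N.
have dz := dF z v; split; first by have /derivable_mxP := dz; apply.
by rewrite (derive_mx dz) mxE.
Qed.

Lemma continuous_gop : continuous (fun z : V => gop G z.1 z.2).
Proof. exact: gop_smooth G 0%N. Qed.

Lemma continuous_ginv : continuous (ginv G).
Proof. exact: ginv_smooth G 0%N. Qed.

(** Let g be this partial derivative. As dilations are automorphisms, la ^ weight l * g
    (D_la z) = la ^ weight j * g z for la > 0. Coordinates are ordered by layers, so that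
    j <= l implies weight j <= weight l; letting la tend to 0 gives g z = 0 ^ (weight l -
    weight j) * g 0 by continuity of g at the origin. Finally g 0 follows from gop 0 y =
    y. *)
Lemma gop_derivative (j l : 'I_dim) (z : V) : (j <= l)%N ->
  ('D_((0 : 'rV[R]_dim), (delta_mx ord0 l : 'rV[R]_dim)) (fun z : V => gop G z.1 z.2) z) ord0 j
  = (l == j)%:R.
Proof.
move=> jl; set v : V := (0, _).
have [_ _ /(_ v) cD] := gop_smooth G 1%N.
pose g z := ('D_v (fun z : V => gop G z.1 z.2) z) ord0 j.
have cg : continuous g.
  by move=> w; exact: (continuous_comp (cD w) (@continuous_coord_rV R _ j _)).
pose f (z : V) := gop G z.1 z.2 ord0 j.
have df w t : is_derive t (1 : R) (fun t : R => f (w + t *: v)) (g (w + t *: v)).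
  by apply: is_derive_along; exact: is_derive_coord_gop.
pose D la (w : V) : V := (dilation la w.1, dilation la w.2).
have fD la w : 0 < la -> f (D la w) = la ^+ weight j * f w.
  by move=> la0; rewrite /f /D /= -dilation_gop// dilationE.
have gD la w : 0 < la -> la ^+ weight l * g (D la w) = la ^+ weight j * g w.
  move=> la0.
  have E : (fun t : R => f (D la w + (t * la ^+ weight l) *: v)) = (fun t : R => la ^+ weight j * f (w + t *: v)).
    apply/funext => t; rewrite -fD//; congr f; rewrite /D /v.
    congr pair; rewrite /= ?scaler0 ?addr0// dilationD dilation_delta mulrC.
    by [].
  have d1 : is_derive (0 : R) (1 : R) (fun t : R => f (D la w + (t * la ^+ weight l) *: v))
      (g (D la w) * la ^+ weight l).
    have := @is_derive_line R (fun t => f (D la w + t *: v)) (fun t => g (D la w + t *: v)) 0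
      (la ^+ weight l) 0 (fun t => df _ t).
    rewrite mul0r addr0 scale0r addr0.
    by under eq_fun do rewrite add0r.
  have d2 : is_derive (0 : R) (1 : R) (fun t : R => la ^+ weight j * f (w + t *: v))
      (la ^+ weight j * g w).
    have := df w 0; rewrite scale0r addr0 => H.
    have -> : (fun t : R => la ^+ weight j * f (w + t *: v)) = (la ^+ weight j) \*: (fun t : R => f (w + t *: v)) by [].
    exact: is_deriveZ.
  rewrite mulrC; case: d1 => _ <-; rewrite E; by case: d2.
have g0 : g 0 = (l == j)%:R.
  have := df 0 0; rewrite scale0r addr0 => -[_ <-].
  rewrite (_ : (fun t : R => _) = (l == j)%:R \*: (id : R -> R)).
    by rewrite derive_val; exact: mulr1.
  apply/funext => t; rewrite /f add0r /= scaler0 gop0x !mxE eqxx/= eq_sym.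
  exact: mulrC.
(* The convention 0 ^ 0 = 1 covers the case of equal weights. *)
pose m := (weight l - weight j)%N.
have lm : weight l = (weight j + m)%N by rewrite subnKC// weight_le.
have gm w : g w = 0 ^+ m * g 0.
  have H : (n.+1%:R^-1 : R) ^+ m * g (D n.+1%:R^-1 w) @[n --> \oo] --> (0 : R) ^+ m * g 0.
    apply: cvgM.
      exact: (@cvg_comp _ _ _ (fun n => n.+1%:R^-1 : R) (fun t : R => t ^+ m) _ _ _ (@cvg_harmonic R) (@exprn_continuous R m 0)).
    have cD0 : D n.+1%:R^-1 w @[n --> \oo] --> (((0 : 'rV[R]_dim), (0 : 'rV[R]_dim)) : V).
      exact: (cvg_pair (cvg_dilation0 w.1) (cvg_dilation0 w.2)).
    exact: (cvg_comp _ _ cD0 (cg 0)).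
  apply/esym; apply: (cvg_unique _ H) => //.
  rewrite (_ : (fun n => _) = cst (g w)); first exact: cvg_cst.
  apply/funext => n; have n0 : (0 : R) < n.+1%:R^-1 by rewrite invr_gt0.
  have := gD _ w n0; rewrite lm exprD -mulrA => /mulfI; apply.
  by rewrite gt_eqF// exprn_gt0.
rewrite -/(g z) gm g0; have [lj|lj] := eqVneq l j.
  by rewrite /m lj subnn expr0 mul1r.
by rewrite mulr0.
Qed.
End group.

(** * Homogeneous balls and the kernel *)

Section balls.
Variables (R : realType) (k : nat) (N : 'I_k.+1 -> nat) (G : stratified_group R N).
Local Notation dim := (\sum_i N i)%N.
Local Notation V := ('rV[R]_dim * 'rV[R]_dim)%type.

(** Left translations are the identity plus, in each coordinate, a function of the
    preceding coordinates. This is why they preserve Lebesgue measure. *)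
Lemma triangular_gop (x : 'rV[R]_dim) : triangular (fun=> 1) (gop G x).
Proof.
move=> j l y c jl.
pose v : V := (0, delta_mx ord0 l); pose z : V := (x, y).
pose f (t : R) := gop G (z + t *: v).1 (z + t *: v).2 ord0 j.
have df (t : R) : is_derive t (1 : R) f (l == j)%:R.
  rewrite -(gop_derivative G (z + t *: v) jl).
  exact: is_derive_along (is_derive_coord_gop _ _ _ _).
have dg (t : R) : is_derive t (1 : R) (f - ((l == j)%:R \*: (id : R -> R))) 0.
  apply: is_derive_eq; apply/eqP; rewrite subr_eq0; apply/eqP; exact/esym/mulr1.
have := is_derive_0_is_cst c 0 dg; rewrite /f /z /v !fctE /= !scaler0 scale0r !addr0.
rewrite mul1r; move: (gop G _ _ _ _) (gop G _ _ _ _) => a b.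
by rewrite subr0 => <-; rewrite /GRing.scale/= subrK.
Qed.

Lemma continuous_gop_l (x : 'rV[R]_dim) : continuous (gop G x).
Proof.
move=> y.
have H : (x, y') @[y' --> y] --> ((x, y) : V) by exact: (@cvg_pair _ _ _ (nbhs y) (nbhs x) (nbhs y) _ _ _ (fun=> x) id (cvg_cst x) cvg_id).
exact: (cvg_comp _ _ H (@continuous_gop _ _ _ G (x, y))).
Qed.

Lemma continuous_gop_r (y : 'rV[R]_dim) : continuous (fun x => gop G x y).
Proof.
move=> x.
have H : (x', y) @[x' --> x] --> ((x, y) : V) by exact: (@cvg_pair _ _ _ (nbhs x) (nbhs x) (nbhs y) _ _ _ id (fun=> y) cvg_id (cvg_cst y)).
exact: (cvg_comp _ _ H (@continuous_gop _ _ _ G (x, y))).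
Qed.

Lemma gopVK (x y : 'rV[R]_dim) : gop G (ginv G x) (gop G x y) = y.
Proof. by rewrite gopA gopVx gop0x. Qed.

Lemma gopKV (x y : 'rV[R]_dim) : gop G x (gop G (ginv G x) y) = y.
Proof. by rewrite gopA gopxV gop0x. Qed.

(** The difference inverse(a) b is invariant under left translations. *)
Lemma gop_diff (x a b : 'rV[R]_dim) :
  gop G (ginv G (gop G (ginv G x) a)) (gop G (ginv G x) b) = gop G (ginv G a) b.
Proof.
set w := gop G (ginv G x) a.
have aE : a = gop G x w by rewrite /w gopKV.
rewrite aE -[in RHS](gopKV x b); set c := gop G (ginv G x) b.
by rewrite -[LHS](gopVK (gop G x w)); congr (gop G _ _); rewrite -gopA gopKV.
Qed.

Lemma dilation_ginv l (x : 'rV[R]_dim) : 0 < l -> dilation l (ginv G x) = ginv G (dilation l x).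
Proof.
move=> l0; rewrite -[LHS](gopVK (dilation l x)) -dilation_gop// gopxV dilation0 gopx0.
by [].
Qed.

(** The left translate by x of the box dilated by t. A box takes the place of a quasi-norm
    ball because its measure is known. *)
Definition homogeneous_ball (e : R) (x : 'rV[R]_dim) (t : R) : set 'rV[R]_dim :=
  [set y | @box R dim e (dilation t^-1 (gop G (ginv G x) y))].

Lemma continuous_ball_chart (x : 'rV[R]_dim) (t : R) :
  continuous (fun y => dilation t^-1 (gop G (ginv G x) y) : 'rV[R]_dim).
Proof.
move=> y; apply: (@continuous_comp _ _ _ (gop G (ginv G x)) (dilation t^-1)).
  exact: continuous_gop_l.
exact: continuous_dilation.
Qed.

Lemma measurable_ball_chart (x : 'rV[R]_dim) (t : R) :
  measurable_fun [set: borel_rV R dim]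
    (fun y => dilation t^-1 (gop G (ginv G x) y) : borel_rV R dim).
Proof.
apply: measurable_rVP => j; apply: continuous_measurable_rV => y.
exact: (continuous_comp (@continuous_ball_chart x t y) (@continuous_coord_rV R _ j _)).
Qed.

Lemma measurable_homogeneous_ball e x t :
  measurable (homogeneous_ball e x t : set (borel_rV R dim)).
Proof.
rewrite -[X in measurable X]setTI.
exact: (measurable_ball_chart x t measurableT (measurable_box e)).
Qed.

(** The ball is the preimage of a box under y |-> D_(1/t) (inverse(x) y), a triangular map
    whose slopes t ^ - weight j have the product t ^ - Q. *)
Lemma borel_lebesgue_homogeneous_ball e x t : 0 < e -> 0 < t ->
  borel_lebesgue_rV R dim (homogeneous_ball e x t) =
    ((2 * e) ^+ dim * t ^+ homogeneous_dim N)%:E.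
Proof.
move=> e0 t0.
have d0 (j : 'I_dim) : 0 < t^-1 ^+ weight j by rewrite exprn_gt0// invr_gt0.
have tr : triangular (fun j : 'I_dim => t^-1 ^+ weight j)
    (fun y => dilation t^-1 (gop G (ginv G x) y)).
  move=> j l y c jl; rewrite !dilationE triangular_gop//; ring.
have := measure_triangular_preimage d0 tr (measurable_ball_chart x t) (@measurable_box R dim e).
move=> ->; transitivity (((\prod_(j < dim) t^-1 ^+ weight j)^-1)%:E * ((2 * e) ^+ dim)%:E)%E.
  congr (_ * _)%E; exact: borel_lebesgue_box.
by rewrite -EFinM mulrC -expr_sum sum_weight exprVn invrK.
Qed.

Lemma open_box n (e : R) : open (@box R n e).
Proof.
rewrite openE => x xe.
have H (j : 'I_n) : nbhs x [set y : 'rV[R]_n | `|y ord0 j| < e].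
  have := cvg_norm (@continuous_coord_rV R n j x) => /(_ _ [set t | t < e]); apply.
  exact: (lt_nbhsl (xe j)).
exact: (@filter_forall _ _ (fun j (y : 'rV[R]_n) => `|y ord0 j| < e) (nbhs x) _ H).
Qed.

Lemma open_homogeneous_ball e x t : open (homogeneous_ball e x t).
Proof.
apply: (@open_comp _ _ (fun y => dilation t^-1 (gop G (ginv G x) y) : 'rV[R]_dim) (@box R dim e)).
  by move=> y _; exact: continuous_ball_chart.
exact: open_box.
Qed.

Lemma homogeneous_ball_center e x t : 0 < e -> homogeneous_ball e x t x.
Proof. by move=> e0 j; rewrite gopVx dilation0 mxE normr0. Qed.

End balls.

Section kernel.
Variables (R : realType) (k : nat) (N : 'I_k.+1 -> nat) (G : stratified_group R N).
Local Notation dim := (\sum_i N i)%N.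
Local Notation V := ('rV[R]_dim * 'rV[R]_dim)%type.
Variables (nu : 'rV[R]_dim -> R) (nu_norm : homogeneous_quasinorm G nu).

(** Continuity at the origin of (a, b) |-> nu (inverse(b) a), which vanishes there. *)
Lemma small_box : exists2 e : R, 0 < e & forall a b : 'rV[R]_dim,
  @box R dim e a -> @box R dim e b -> nu (gop G (ginv G b) a) < 1.
Proof.
have H1 : (ginv G z.2, z.1) @[z --> (((0 : 'rV[R]_dim), (0 : 'rV[R]_dim)) : V)] -->
    ((ginv G 0, 0) : V).
  apply: (@cvg_pair _ _ _ _ (nbhs (ginv G 0)) (nbhs (0 : 'rV[R]_dim)) _ _ _ (fun z : V => ginv G z.2) fst).
    exact: (cvg_comp _ _ (@cvg_snd _ _ (nbhs (0 : 'rV[R]_dim)) (nbhs (0 : 'rV[R]_dim)) _) (@continuous_ginv _ _ _ G 0)).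
  exact: cvg_fst.
have H2 := cvg_comp _ _ H1 (@continuous_gop _ _ _ G (ginv G 0, 0)).
have cnu : continuous nu := quasinorm_continuous nu_norm.
have H3 := cvg_comp _ _ H2 (cnu _).
have /= := H3 [set t | t < 1].
rewrite gopx0 (quasinormV nu_norm) ((quasinorm_eq0 nu_norm 0).2 erefl).
move=> /(_ (lt_nbhsl ltr01)) /nbhs_ballP[e /= e0 He]; exists e => // a b ae be.
by apply: (He (a, b)); split; apply: (rV_ball0 _ e0).2.
Qed.

Variables (s p : R) (s_gt0 : 0 < s) (p_gt0 : 0 < p).
Local Notation Q := ((homogeneous_dim N)%:R : R).

Lemma kernel_ge0 z : 0 <= Defs.kernel G nu s p z.
Proof. by rewrite invr_ge0 powR_ge0. Qed.

Lemma measurable_kernel : measurable_fun setT (Defs.kernel G nu s p).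
Proof.
rewrite (_ : Defs.kernel G nu s p = (fun t : R => t `^ (- (Q + p * s))) \o
   (fun z => nu (gop G (ginv G z.2) z.1))); last first.
  by apply/funext => z /=; rewrite powRN.
apply: measurableT_comp; first exact: measurable_powR.
have cnu : continuous nu := quasinorm_continuous nu_norm.
apply: (@continuous_measurable_pair R dim (fun x y => nu (gop G (ginv G y) x))) => [x y|y x].
  apply: (@continuous_comp _ _ _ (fun y => gop G (ginv G y) x) nu _ _ (cnu _)).
  exact: (@continuous_comp _ _ _ (ginv G) (fun y => gop G y x) _ (@continuous_ginv _ _ _ G y) (@continuous_gop_r _ _ _ _ _ _)).
exact: (@continuous_comp _ _ _ (gop G (ginv G y)) nu _ (@continuous_gop_l _ _ _ _ _ _) (cnu _)).
Qed.

(** By left invariance and homogeneity, nu (inverse(b) a) is t times the same quantity for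
    two points of the box, hence less than t. *)
Lemma kernel_on_ball e : (forall a b : 'rV[R]_dim,
    @box R dim e a -> @box R dim e b -> nu (gop G (ginv G b) a) < 1) ->
  forall x (t : R) a b, 0 < t -> homogeneous_ball G e x t a -> homogeneous_ball G e x t b ->
  a = b \/ 1 <= t `^ (Q + p * s) * Defs.kernel G nu s p (a, b).
Proof.
move=> He x t a b t0 xa xb; have tV : 0 < t^-1 by rewrite invr_gt0.
have := He _ _ xa xb; rewrite -dilation_ginv// -dilation_gop// gop_diff.
rewrite (quasinorm_dilation nu_norm)// mulrC ltr_pdivrMr// mul1r => nut.
have [/(quasinorm_eq0 nu_norm) nu0|nu0] := eqVneq (nu (gop G (ginv G b) a)) 0; [left|right].
  by rewrite -(gopKV G b a) nu0 gopx0.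
have nup : 0 < nu (gop G (ginv G b) a) by rewrite lt_def nu0 (quasinorm_ge0 nu_norm).
rewrite /kernel/= ler_pdivlMr ?powR_gt0// mul1r.
have a0 : 0 <= Q + p * s by apply: addr_ge0; [exact: ler0n|rewrite mulr_ge0// ltW].
exact: (le_powR2 a0 (ltW nup) (ltW nut)).
Qed.
End kernel.

Section bounded_open_sets.
Variables (R : realType) (k : nat) (N : 'I_k.+1 -> nat) (G : stratified_group R N).
Local Notation dim := (\sum_i N i)%N.
Variables (Omega : set 'rV[R]_dim).

Lemma bounded_sub_box n (A : set 'rV[R]_n) : bounded_set A ->
  exists2 M : R, 0 < M & A `<=` @box R n M.
Proof.
move=> bA; have [M M0 AM] := ex_strict_bound_gt0 bA; exists M => // x Ax j.
apply: le_lt_trans (AM x Ax).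
have -> : `|x| = \big[Num.max/0]_ij `|x ij.1 ij.2| := mx_normrE x.
exact: (@le_bigmax _ _ _ 0 (fun ij : 'I_1 * 'I_n => `|x ij.1 ij.2|) (ord0, j)).
Qed.

Lemma finite_homogeneous_cover e t : 0 < e -> bounded_set Omega ->
  exists sq : seq 'rV[R]_dim, forall x, Omega x -> exists2 y, y \in sq & homogeneous_ball G e y t x.
Proof.
move=> e0 bO; have [M M0 OM] := ex_strict_bound_gt0 bO.
have cB : compact [set x : 'rV[R]_dim | `|x| <= M].
  apply: bounded_closed_compact.
    by exists M; split; [exact: num_real|move=> y My x /= xM; exact: le_trans xM (ltW My)].
  apply: (@preimage_closed _ _ (fun x : 'rV[R]_dim => `|x|) [set t : R | t <= M]); last exact: closed_le.
  by move=> x _; exact: norm_continuous.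
move: cB; rewrite compact_cover => /(_ _ setT (fun y => homogeneous_ball G e y t)).
case=> [y _|x _|D _ H]; first exact: open_homogeneous_ball.
  by exists x => //; exact: homogeneous_ball_center.
exists (finmap.enum_fset D) => x Ox; have [y Dy xy] := H x (ltW (OM x Ox)); exists y => //.
Qed.
End bounded_open_sets.

(** * From interior minimizers to local minimizers *)

Section ae_integrable.
Context d (T : measurableType d) (R : realType) (L : {measure set T -> \bar R}).

Lemma ae_eq_integrable (D : set T) (f g : T -> \bar R) : measurable D ->
  measurable_fun D g -> ae_eq L D f g -> L.-integrable D f -> L.-integrable D g.
Proof.
move=> mD mg fg /integrableP[mf f_fin]; apply/integrableP; split => //.
rewrite (ae_eq_integral (fun x => `|f x|)%E)//.
- exact: measurableT_comp.
- exact: measurableT_comp.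
- by apply: filterS fg => x + Dx => /(_ Dx) ->.
Qed.
End ae_integrable.

Section caratheodory_cut.
Context d (T : measurableType d) (R : realType) (L : {sigma_finite_measure set T -> \bar R}).
Variables (Omega : set T) (h : T -> R -> R).
Hypothesis mOmega : measurable Omega.
Hypothesis mh : forall t, measurable_fun Omega (h ^~ t).
Hypothesis ch : forall x, Omega x -> continuous (h x).

(** The function h extended by 0 outside D: with D = Omega it becomes defined on the whole
    space, and with D = Omega minus a null set its growth bound holds everywhere. *)
Definition cut (D : set T) (x : T) (t : R) : R := ((h ^~ t) \_ D) x.

Lemma cut_in D x t : D x -> cut D x t = h x t.
Proof. by move=> Dx; rewrite /cut patchE mem_set. Qed.

Lemma cut_out D x t : ~ D x -> cut D x t = 0.
Proof. by move=> Dx; rewrite /cut patchE memNset. Qed.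

Lemma measurable_cut D : measurable D -> D `<=` Omega ->
  forall t, measurable_fun setT (cut D ^~ t).
Proof.
move=> mD DO t; have := (measurable_restrictT (h ^~ t) mD).1; apply.
exact: measurable_funS (mh t).
Qed.

Lemma continuous_cut D : D `<=` Omega -> forall x, continuous (cut D x).
Proof.
move=> DO x; have [Dx|Dx] := pselect (D x).
  rewrite (_ : cut D x = h x); first exact: ch (DO _ Dx).
  by apply/funext => t; rewrite cut_in.
rewrite (_ : cut D x = cst 0); first exact: cst_continuous.
by apply/funext => t; rewrite cut_out.
Qed.

Lemma primitive_cut D x : D x -> primitive (cut D x) = primitive (h x).
Proof. by move=> Dx; congr primitive; apply/funext => t; rewrite cut_in. Qed.

Lemma measurable_subst_on (u : T -> R) : measurable_fun setT u ->
  measurable_fun Omega (fun x => h x (u x)).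
Proof.
move=> mu; apply: (@eq_measurable_fun _ _ _ _ _ (fun x => cut Omega x (u x))).
  by move=> x /[!inE] Ox; rewrite cut_in.
apply: measurable_funS (measurableT) (@subsetT _ _) _.
by apply: measurable_fun_caratheodory => //; [exact: measurable_cut|exact: continuous_cut].
Qed.

Lemma primitive_integral_cut (N : set T) (u : T -> R) : measurable N -> L N = 0%E ->
  measurable_fun setT u ->
  primitive_integral L Omega (cut (Omega `\` N)) u = primitive_integral L Omega h u.
Proof.
move=> mN N0 mu; rewrite /primitive_integral.
transitivity (\int[L]_(x in Omega) primitive (cut Omega x) (u x)); last first.
  by apply: eq_Rintegral => x /[!inE] Ox; rewrite primitive_cut.
have mP D : measurable D -> D `<=` Omega ->
    measurable_fun Omega (fun x => (primitive (cut D x) (u x))%:E).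
  move=> mD DO; apply: measurable_funTS; apply/measurable_EFinP.
  by apply: measurable_primitive => //; [exact: measurable_cut|exact: continuous_cut].
apply: (congr1 fine); apply: ae_eq_integral => //.
- by apply: mP => [|x []//]; exact: measurableD.
- exact: mP.
- exists N; split => // x /= H; apply: contrapT => Nx; apply: H => Ox.
  by rewrite !primitive_cut.
Qed.
End caratheodory_cut.

Section local_minimizer.
Context d (T : measurableType d) (R : realType)
  (L : {sigma_finite_measure set T -> \bar R}).
Variables (K : T * T -> R) (p r S : R) (Omega : set T) (h : T -> R -> R) (a1 a2 q : R).
Local Notation L2 := (L \x L)%E.
Hypothesis K_ge0 : forall z, 0 <= K z.
Hypothesis mK : measurable_fun setT K.
Hypothesis p_ge2 : 2 <= p.
Hypothesis p_lt_r : p < r.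
Hypothesis mOmega : measurable Omega.
Hypothesis Omega_fin : (L Omega < +oo)%E.
Local Notation E := (gagliardo_energy L K p).
Local Notation A := (renergy L K p).
Local Notation X0 := (X0 L K p Omega).
Hypothesis S_gt0 : 0 < S.
Hypothesis sobolev : forall (u : T -> R) (e : R), measurable_fun setT u -> 0 <= e ->
  (\int[L]_x (`|u x| `^ p)%:E < +oo)%E -> (E u <= e%:E)%E ->
  (\int[L]_x (`|u x| `^ r)%:E <= (S * e `^ (r / p))%:E)%E.
Hypothesis a1_gt0 : 0 < a1.
Hypothesis a2_gt0 : 0 < a2.
Hypothesis q_ge1 : 1 <= q.
Hypothesis q_lt_r : q < r.
Hypothesis mh : forall t, measurable_fun Omega (h ^~ t).
Hypothesis ch : forall x, Omega x -> continuous (h x).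
Hypothesis h_growth : {ae L, forall x, Omega x ->
  forall t, `|h x t| <= a1 + a2 * `|t| `^ (q - 1)}.
Hypothesis extraction : forall (u : nat -> T -> R) (e b : R), 0 <= e ->
  (forall n, measurable_fun setT (u n)) ->
  (forall n, L.-integrable setT (EFin \o u n)) ->
  (forall n, (E (u n) <= e%:E)%E) ->
  (forall n, (\int[L]_x `|u n x|%:E <= b%:E)%E) ->
  exists f : nat -> nat, (forall k, (k <= f k)%N) /\
    forall k, (\int[L]_(x in Omega) `|u (f k.+1) x - u (f k) x|%:E <= (2^-1 ^+ k)%:E)%E.

(** `gagliardo_energyD_le` bounds the energy of w = v + (w - v) by c * A v plus a multiple
    of the energy of w - v, where c > 1 may be as close to 1 as desired, so that c * A v <
    eta. *)
Lemma renergy_neighborhood v eta : X0 v -> A v < eta ->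
  exists2 tau, 0 < tau & forall w, X0 w -> A (fun x => w x - v x) <= tau -> A w <= eta.
Proof.
move=> Xv Aveta; have Av0 := renergy_ge0 L p K_ge0 v.
have p0 : 0 < p by move: p_ge2; lra.
have eta0 : 0 < eta by apply: le_lt_trans Aveta.
(* This c satisfies 1 < c and c * A v < eta, also when A v = 0. *)
pose c := 2 * eta / (eta + A v).
have den0 : 0 < eta + A v by rewrite ltr_pwDl.
have c1 : 1 < c by rewrite ltr_pdivlMr// mul1r; move: (A v) Aveta => y; lra.
have cA : c * A v < eta.
  rewrite /c mulrAC ltr_pdivrMr//; move: (A v) Aveta Av0 eta0 => y; nra.
(* The weight (1 + a) ^ p is then equal to c. *)
pose a := c `^ p^-1 - 1.
have a0 : 0 < a.
  have -> : a = c `^ p^-1 - 1 `^ p^-1 by rewrite powR1.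
  by rewrite subr_gt0; apply: gt0_ltr_powR; rewrite ?invr_gt0// nnegrE; lra.
have aE : (1 + a) `^ p = c.
  by rewrite /a addrC subrK -powRrM mulVf ?gt_eqF// powRr1//; lra.
pose b := (1 + a^-1) `^ p.
have b0 : 0 < b by rewrite powR_gt0// addr_gt0// invr_gt0.
exists ((eta - c * A v) / b); first by rewrite divr_gt0// subr_gt0.
move=> w Xw Aw; have Xwv := X0_B K_ge0 mK p_ge2 Xw Xv.
have := gagliardo_energyD_le L K_ge0 mK p_ge2 a0 (X0_measurable Xv) (X0_measurable Xwv).
rewrite (_ : (fun x => _) = w); last by apply/funext => x; rewrite addrC subrK.
rewrite (renergyE K_ge0 Xv) (renergyE K_ge0 Xw) (renergyE K_ge0 Xwv) aE -/b -!EFinM -EFinD lee_fin => H.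
have final y z : z <= (eta - c * y) / b -> c * y + b * z <= eta.
  by rewrite ler_pdivlMr// lerBrDl [z * b]mulrC.
exact: (le_trans H (final _ _ Aw)).
Qed.

(** The growth bound holds outside a null set N. Cutting h off to Omega minus N makes it
    hold everywhere, and changes neither the functional nor the weak formulation. *)
Theorem exists_local_minimizer (mu : R) : 0 < mu ->
  exists2 Lam : R, 0 < Lam & forall lam, 0 < lam -> lam < Lam ->
  exists u, [/\ X0 u,
    exists2 tau, 0 < tau & forall v, X0 v -> A (fun x => v x - u x) <= tau ->
      functional L K p r Omega h mu lam u <= functional L K p r Omega h mu lam v &
    forall phi, X0 phi ->
    [/\ L2.-integrable setT (EFin \o first_variation_integrand K p u phi),
      L.-integrable Omega (EFin \o (fun x =>
        (mu * `|u x| `^ (r - 2) * u x + lam * h x (u x)) * phi x)) &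
      \int[L2]_z first_variation_integrand K p u phi z =
      \int[L]_(x in Omega) ((mu * `|u x| `^ (r - 2) * u x + lam * h x (u x)) * phi x)]].
Proof.
move=> mu0; have [N [mN N0 HN]] := h_growth.
pose D := Omega `\` N.
have mD : measurable D by exact: measurableD.
have DO : D `<=` Omega by move=> x [].
have mg := measurable_cut mOmega mh mD DO.
have cg := continuous_cut ch DO.
have g_growth x t : `|cut h D x t| <= a1 + a2 * `|t| `^ (q - 1).
  have [Dx|Dx] := pselect (D x); last first.
    by rewrite cut_out// normr0 addr_ge0 ?mulr_ge0 ?powR_ge0// ltW.
  rewrite cut_in//; case: Dx => Ox Nx; move: t.
  by apply: contrapT => H; apply: Nx; apply: HN => /= /(_ Ox).
have [Lam Lam0 HLam] := exists_interior_minimizer K_ge0 mK p_ge2 p_lt_r mOmega Omega_fin S_gt0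
  sobolev mg cg a1_gt0 a2_gt0 q_ge1 q_lt_r g_growth extraction mu0.
exists Lam => // lam lam0 lamLam; have [u [Xu [eta Aueta umin]]] := HLam lam lam0 lamLam.
have [tau tau0 Htau] := renergy_neighborhood Xu Aueta.
have loc v : X0 v -> A (fun x => v x - u x) <= tau ->
    functional L K p r Omega (cut h D) mu lam u <= functional L K p r Omega (cut h D) mu lam v.
  move=> Xv Av; exact: (umin v Xv (Htau v Xv Av)).
exists u; split => //.
  have FE w : X0 w -> functional L K p r Omega (cut h D) mu lam w =
      functional L K p r Omega h mu lam w.
    move=> Xw; have HE := primitive_integral_cut mOmega mh ch mN N0 (X0_measurable Xw).
    by rewrite /functional HE.
  exists tau; first exact: tau0.
  by move=> v Xv Av; rewrite -(FE u Xu) -(FE v Xv); exact: loc.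
move=> phi Xphi.
have [w1 w2 w3] := euler_lagrange K_ge0 mK p_ge2 p_lt_r mOmega Omega_fin
  sobolev mg cg a1_gt0 a2_gt0 q_ge1 q_lt_r g_growth Xu tau0 loc Xphi.
have m_rhs : measurable_fun Omega (EFin \o (fun x =>
    (mu * `|u x| `^ (r - 2) * u x + lam * h x (u x)) * phi x)).
  apply/measurable_EFinP; apply: measurable_funM; last exact: measurable_funTS (X0_measurable Xphi).
  apply: measurable_funD.
    apply: measurable_funTS; apply: measurable_funM; last exact: X0_measurable Xu.
    apply: measurable_funM => //; apply: measurable_normr_powR; exact: X0_measurable Xu.
  apply: measurable_funM => //; exact: (measurable_subst_on mOmega mh ch (X0_measurable Xu)).
have ae : ae_eq L Omega (EFin \o (fun x =>
    (mu * `|u x| `^ (r - 2) * u x + lam * cut h D x (u x)) * phi x))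
    (EFin \o (fun x => (mu * `|u x| `^ (r - 2) * u x + lam * h x (u x)) * phi x)).
  exists N; split => // x /= H; apply: contrapT => Nx; apply: H => Ox.
  by rewrite cut_in.
split => //; first exact: ae_eq_integrable w2.
rewrite w3; apply: (congr1 fine); apply: ae_eq_integral => //.
by case/integrableP: w2.
Qed.
End local_minimizer.

(** * Stratified groups *)

Section transfer.
Variables (R : realType) (k : nat) (N : 'I_k.+1 -> nat) (G : stratified_group R N).
Local Notation dim := (\sum_i N i)%N.
Variables (nu : 'rV[R]_dim -> R) (nu_norm : homogeneous_quasinorm G nu) (s p : R).
Hypothesis p_ge2 : 2 <= p.
Local Notation leb := (@lebesgue_rV R dim).
Local Notation K := (Defs.kernel G nu s p).
Local Notation E := (gagliardo_energy leb K p).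

Let p0 : 0 < p. Proof. by move: p_ge2; lra. Qed.

Lemma gagliardo_powR (u : lebesgue_space R dim -> R) : E u = ((gagliardo G nu s p u) `^ p)%E.
Proof.
rewrite -poweRrM mulVf ?gt_eqF// poweRe1//.
by apply: gagliardo_energy_ge0 => z; exact: kernel_ge0.
Qed.

Lemma sobolev0P (Omega : set (lebesgue_space R dim)) (u : lebesgue_space R dim -> R) :
  sobolev0 G nu s p Omega u <-> X0 leb K p Omega u.
Proof.
have NE : (\int[leb]_x (`|u x| `^ p)%:E = 'N[leb]_p%:E[EFin \o u] `^ p)%E.
  by rewrite poweR_Lnorm ?gt_eqF.
split.
  move=> [[mu Lu Eu] su]; split => //.
  - by rewrite NE poweR_lty.
  - by rewrite gagliardo_powR poweR_lty.
move=> [mu Lu Eu su]; split => //; split => //.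
- by rewrite unlock; apply: poweR_lty; apply: le_lt_trans Lu.
- exact: poweR_lty.
Qed.

Lemma renergy_lt_gagliardo (u : lebesgue_space R dim -> R) (e : R) :
  (gagliardo G nu s p u < e%:E)%E -> renergy leb K p u <= e `^ p.
Proof.
rewrite /renergy gagliardo_powR; have := poweR_ge0 (E u) p^-1.
rewrite -/(gagliardo G nu s p u); case: (gagliardo G nu s p u) => [x| |]//=.
rewrite lte_fin lee_fin => x0 xe; exact: le_powR2 (ltW p0) x0 (ltW xe).
Qed.

Lemma energy_functional (Omega : set (lebesgue_space R dim)) h mu lam u :
  energy G nu s p Omega h mu lam u =
  functional leb K p (critical_exponent N s p) Omega h mu lam u.
Proof.
rewrite /energy /functional /renergy /gagliardo_energy /critical_integral /primitive_integral /Rintegral.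
reflexivity.
Qed.
End transfer.

Theorem theorem1p1 (R : realType) (k : nat) (N : 'I_k.+1 -> nat)
    (G : stratified_group R N)
    (nu : 'rV[R]_(\sum_i N i) -> R) (nu_norm : homogeneous_quasinorm G nu)
    (Omega : set 'rV[R]_(\sum_i N i))
    (Omega_open : open Omega) (Omega_bounded : bounded_set Omega)
    (s p q : R) (s_gt0 : 0 < s) (s_lt1 : s < 1)
    (p_ge2 : 2 <= p) (p_lt : p < (homogeneous_dim N)%:R / s)
    (q_ge1 : 1 <= q) (q_lt : q < critical_exponent N s p)
    (h : 'rV[R]_(\sum_i N i) -> R -> R) (h_car : caratheodory Omega h)
    (a1 a2 : R) (a1_gt0 : 0 < a1) (a2_gt0 : 0 < a2)
    (h_growth : {ae @lebesgue_rV R (\sum_i N i), forall x, Omega x ->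
      forall t, `|h x t| <= a1 + a2 * `|t| `^ (q - 1)}) :
  forall mu : R, 0 < mu ->
  exists2 Lambda : R, 0 < Lambda &
  forall lambda : R, 0 < lambda -> lambda < Lambda ->
  exists u : 'rV[R]_(\sum_i N i) -> R,
    weak_solution G nu s p Omega
      (fun x t => mu * `|t| `^ (critical_exponent N s p - 2) * t
                  + lambda * h x t) u /\
    local_minimum G nu s p Omega (energy G nu s p Omega h mu lambda) u.
Proof.
pose n := (\sum_i N i)%N; pose L := @lebesgue_rV R n; pose K := Defs.kernel G nu s p.
pose Q := (homogeneous_dim N)%:R : R.
have p0 : 0 < p by move: p_ge2; lra.
have psQ : p * s < Q by move: p_lt; rewrite ltr_pdivlMr.
have K0 : forall z, 0 <= K z by exact: kernel_ge0.
have mK : measurable_fun setT K by exact: measurable_kernel.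
(* The sets V x t are the homogeneous balls of radius t built on the box of size e. *)
have [e e0 He] := small_box nu_norm.
pose c := (2 * e) ^+ n; have c0 : 0 < c by rewrite exprn_gt0// mulr_gt0.
pose V (x : lebesgue_space R n) (t : R) : set (lebesgue_space R n) := homogeneous_ball G e x t.
have mV x (t : R) : 0 < t -> measurable (V x t).
  by move=> _; apply: sub_lebesgue_measurable; exact: measurable_homogeneous_ball.
have LV x (t : R) : 0 < t -> L (V x t) = (c * t `^ Q)%:E.
  move=> t0; rewrite powR_mulrn ?ltW// -(borel_lebesgue_homogeneous_ball G x e0 t0).
  apply: lebesgue_rVE; exact: measurable_homogeneous_ball.
have Vc x (t : R) : 0 < t -> V x t x by move=> _; exact: homogeneous_ball_center.
have KV : forall x (t : R) a b, 0 < t -> V x t a -> V x t b ->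
    a = b \/ 1 <= t `^ (Q + p * s) * K (a, b).
  move=> x t a b t0; exact: (kernel_on_ball nu_norm s_gt0 p0 He t0).
have mO : measurable (Omega : set (lebesgue_space R n)).
  by apply: sub_lebesgue_measurable; exact: open_measurable_rV.
have LO : (L Omega < +oo)%E.
  have [M M0 OM] := bounded_sub_box Omega_bounded.
  apply: (@le_lt_trans _ _ (L (@box R n M))).
    apply: le_measure; rewrite ?inE//.
    by apply: sub_lebesgue_measurable; exact: measurable_box.
  have -> : L (@box R n M) = ((2 * M) ^+ n)%:E.
    rewrite -(borel_lebesgue_box n M0); apply: lebesgue_rVE; exact: measurable_box.
  exact: ltry.
have cover (t : R) : 0 < t -> exists sq : seq (lebesgue_space R n),
    forall x, Omega x -> exists2 y, y \in sq & V y t x.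
  by move=> _; exact: finite_homogeneous_cover.
have [S S0 HS] := sobolev_inequality K0 mK c0 mV LV Vc KV p_ge2 s_gt0 psQ.
have [_ _ pr _] := critical_exponent_facts p_ge2 s_gt0 psQ.
have extr := l1_subsequence K0 mK c0 mV LV KV p_ge2 s_gt0 mO LO cover.
move=> mu mu0; have [mh ch] := h_car.
have [Lam Lam0 HLam] := exists_local_minimizer K0 mK p_ge2 pr mO LO S0 HS
  a1_gt0 a2_gt0 q_ge1 q_lt mh ch h_growth extr mu0.
exists Lam => // lam lam0 lamLam.
have [u [Xu [tau tau0 umin] EL]] := HLam lam lam0 lamLam.
have su : sobolev0 G nu s p Omega u by apply/sobolev0P.
exists u; split; split => //.
  by move=> phi /(sobolev0P _ _ _ p_ge2) Xphi; exact: EL.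
(* The norm of the function space is the p-th root of the energy. *)
exists (tau `^ p^-1); first by rewrite powR_gt0.
move=> v /(sobolev0P _ _ _ p_ge2) Xv /(renergy_lt_gagliardo p_ge2) H.
rewrite !energy_functional; apply: (umin v Xv); apply: (le_trans H).
by rewrite -powRrM mulVf ?gt_eqF// powRr1// ltW.
Qed.
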